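(* Let $N\ge1$ be an integer and $0<s<1$ with $N\ge2s$. Let $F^\infty:\mathbb{R}^N\times\mathbb{R}\to\mathbb{R}$ be a Carathéodory function, with partial derivative $\partial_2F^\infty(x,t)$ in the second variable, which is periodic: $F^\infty(x+z,t)=F^\infty(x,t)$ for all $x\in\mathbb{R}^N$, $t\in\mathbb{R}$, $z\in\mathbb{Z}^N$. Suppose: (F1) there exist $\Delta>0$, $S>0$, $R>0$, $\alpha>0$, $p\in[0,2)$ with $N+2s>\frac N2\alpha+p$ such that $F^\infty(x,t)>\Delta|x|^{-p}|t|^\alpha$ for all $|x|\ge R$ and $0<|t|<S$; (F4) there exist constants $B,B'>0$ and exponents $0<\gamma<\ell<\frac{4s}{N}$ such that for all $x\in\mathbb{R}^N$, $t\in\mathbb{R}$: $0\le F^\infty(x,t)\le B(|t|^{\gamma+2}+|t|^{\ell+2})$ and $|\partial_2F^\infty(x,t)|\le B'(|t|^{\gamma+1}+|t|^{\ell+1})$; (F5) there exists $\sigma\in(0,\frac{4s}{N})$ such that $F^\infty(x,\theta t)\ge\theta^{\sigma+2}F^\infty(x,t)$ for all $\theta\ge1$, $x\in\mathbb{R}^N$, $t\in\mathbb{R}$. Let $c>0$. Then there exists $u_c\in S_c$ such that $J^\infty(u_c)=I_c^\infty$.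
   Context: All functions $u$ are real-valued, and integrals without indicated domain are over the whole space. $H^s(\mathbb{R}^N)$ is the fractional Sobolev space of $u\in L^2(\mathbb{R}^N)$ with $\frac{|u(x)-u(y)|}{|x-y|^{N/2+s}}\in L^2(\mathbb{R}^N\times\mathbb{R}^N)$. Put $$|\nabla_su|_2^2=\int|\nabla_su|^2=C_{N,s}\iint\frac{|u(x)-u(y)|^2}{|x-y|^{N+2s}}\,dx\,dy,$$ where $C_{N,s}>0$ is a fixed normalization constant depending only on $N$ and $s$. For $c>0$, $$S_c=\Big\{u\in H^s(\mathbb{R}^N):\int u^2=c^2\Big\},\qquad J^\infty(u)=\frac12|\nabla_su|_2^2-\int F^\infty(x,u(x))\,dx,\qquad I_c^\infty=\inf\{J^\infty(u):u\in S_c\}.$$ *)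

(* Defs.v *)
From HB Require Import structures.
From mathcomp Require Import all_boot all_order all_algebra.
From mathcomp Require Import all_classical all_reals all_analysis.

Set Implicit Arguments.
Unset Strict Implicit.
Unset Printing Implicit Defensive.

Import Order.TTheory GRing.Theory Num.Theory.
Import numFieldNormedType.Exports.

Local Open Scope classical_set_scope.
Local Open Scope ring_scope.

(* Tuples of reals carry the product sigma-algebra, i.e. the Borel sets. *)
Notation Rn R N := (N.-tuple (measurableTypeR R)).

Section lebesgue_measure_Rn.
Context {R : realType}.

Definition cons_Rn n (p : measurableTypeR R * Rn R n) : Rn R n.+1 :=
  [tuple of p.1 :: p.2].

Definition uncons_Rn n (x : Rn R n.+1) : measurableTypeR R * Rn R n :=
  (thead x, [tuple of behead x]).

Lemma cons_RnK n : cancel (@cons_Rn n) (@uncons_Rn n).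
Proof. by move=> [a b]; rewrite /uncons_Rn theadE; congr pair; exact/val_inj. Qed.

Lemma measurable_cons_Rn n : measurable_fun setT (@cons_Rn n).
Proof. exact: measurable_cons. Qed.

Lemma measurable_uncons_Rn n : measurable_fun setT (@uncons_Rn n).
Proof.
apply/measurable_fun_pairP; split => /=; first exact: measurable_tnth.
exact: measurable_behead.
Qed.

Section step.
Variables (n : nat) (mu : {sigma_finite_measure set (Rn R n) -> \bar R}).

Definition lebesgueS : set (Rn R n.+1) -> \bar R :=
  pushforward (lebesgue_measure \x mu)%E (@cons_Rn n).

Let lebesgueS0 : lebesgueS set0 = 0%E.
Proof. by rewrite /lebesgueS/= /pushforward preimage_set0 measure0. Qed.

Let lebesgueS_ge0 A : (0 <= lebesgueS A)%E.
Proof. by apply: integral_ge0 => /= x _; exact: measure_ge0. Qed.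

Let lebesgueS_semi_sigma_additive : semi_sigma_additive lebesgueS.
Proof.
move=> F mF tF mUF; rewrite /lebesgueS /pushforward preimage_bigcup.
apply: measure_semi_sigma_additive.
- by move=> i; rewrite -[X in measurable X]setTI; exact: measurable_cons_Rn.
- apply/trivIsetP => i j _ _ ij; rewrite -preimage_setI.
  by move/trivIsetP : tF => /(_ _ _ _ _ ij) ->//; rewrite preimage_set0.
- by rewrite -preimage_bigcup -[X in measurable X]setTI;
    exact: measurable_cons_Rn.
Qed.

HB.instance Definition _ := isMeasure.Build _ _ _ lebesgueS
  lebesgueS0 lebesgueS_ge0 lebesgueS_semi_sigma_additive.

Let lebesgueS_sigma_finite : sigma_finite setT lebesgueS.
Proof.
have /sigma_finiteP[F [UF ndF mF]] := sigma_finiteT (@lebesgue_measure R).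
have /sigma_finiteP[G [UG ndG mG]] := sigma_finiteT mu.
exists (fun i => @uncons_Rn n @^-1` (F i `*` G i)).
  rewrite -preimage_bigcup (_ : \bigcup_i _ = setT) ?preimage_setT//.
  apply/seteqP; split => // -[x y] _.
  have [i _ Fx] : (\bigcup_i F i) x by rewrite -UF.
  have [j _ Gy] : (\bigcup_i G i) y by rewrite -UG.
  exists (maxn i j) => //; split => /=.
  - by move: x Fx; exact/subsetPset/ndF/leq_maxl.
  - by move: y Gy; exact/subsetPset/ndG/leq_maxr.
move=> i; have [mFi Fi] := mF i; have [mGi Gi] := mG i; split.
  rewrite -[X in measurable X]setTI; apply: measurable_uncons_Rn => //.
  exact: measurableX.
rewrite /lebesgueS /pushforward -comp_preimage.
rewrite (_ : _ \o _ = id) ?preimage_id; last by apply/funext; exact: cons_RnK.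
by rewrite product_measure1E// lte_mul_pinfty// ge0_fin_numE.
Qed.

HB.instance Definition _ := Measure_isSigmaFinite.Build _ _ _ lebesgueS
  lebesgueS_sigma_finite.

End step.

Fixpoint lebesgue_Rn (n : nat) :
    {sigma_finite_measure set (Rn R n) -> \bar R} :=
  match n with
  | 0 => dirac ([tuple] : Rn R 0)
  | n'.+1 => lebesgueS (lebesgue_Rn n')
  end.

Lemma lebesgue_RnS_setX n (A : set (measurableTypeR R)) (B : set (Rn R n)) :
  measurable A -> measurable B ->
  lebesgue_Rn n.+1 (@uncons_Rn n @^-1` (A `*` B)) =
  (lebesgue_measure A * lebesgue_Rn n B)%E.
Proof.
move=> mA mB; rewrite /= /lebesgueS /pushforward -comp_preimage.
rewrite (_ : _ \o _ = id); last by apply/funext; exact: cons_RnK.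
by rewrite preimage_id product_measure1E.
Qed.

(* The measure of a box is the product of its sides, which characterizes
   Lebesgue measure on the Borel sets. *)
Lemma lebesgue_Rn_box n (A : 'I_n -> set (measurableTypeR R)) :
  (forall i, measurable (A i)) ->
  lebesgue_Rn n [set x | forall i, A i (tnth x i)] =
  (\prod_(i < n) lebesgue_measure (A i))%E.
Proof.
elim: n A => [|n IH] A mA.
  rewrite big_ord0 (_ : mkset _ = setT); first by rewrite /= diracT.
  by apply/seteqP; split => // x _ [].
rewrite big_ord_recl -IH// -lebesgue_RnS_setX//; last first.
  rewrite (_ : mkset _ = \bigcap_(i in [set: 'I_n])
     ((@tnth _ _ ^~ i) @^-1` A (lift ord0 i))); last first.
    by apply/seteqP; split => [x Ax i _|x Ax i]; exact: Ax.
  apply: fin_bigcap_measurable; first exact: finite_finset.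
  by move=> i _; rewrite -[X in measurable X]setTI; exact: measurable_tnth.
congr (lebesgue_Rn n.+1 _); apply/seteqP; split => [x Ax|x [/= A0 Ax] i].
  split => [|i] /=; first exact: Ax.
  by rewrite -(tnthS (thead x)) -tuple_eta; exact: Ax.
have [j ->|->] := unliftP ord0 i; last exact: A0.
by rewrite (tuple_eta x) tnthS; exact: Ax.
Qed.

End lebesgue_measure_Rn.

Section fractional_sobolev.
Context {R : realType}.
Variable N : nat.
Implicit Types (x y : Rn R N) (u : Rn R N -> R) (F : Rn R N -> R -> R).

Definition enorm x : R := Num.sqrt (\sum_(i < N) tnth x i ^+ 2).

Definition edist x y : R := Num.sqrt (\sum_(i < N) (tnth x i - tnth y i) ^+ 2).

Definition translate x (z : 'I_N -> int) : Rn R N :=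
  [tuple tnth x i + (z i)%:~R | i < N].

(* u belongs to H^s(R^N). Elements are functions rather than a.e. classes; every
   class has a Borel measurable representative. The quotient is 0 on the
   (negligible) diagonal, because 0^-1 = 0. *)
Definition Hs (s : R) u : Prop :=
  u \in Lfun (lebesgue_Rn N) 2%:E /\
  (fun z : Rn R N * Rn R N =>
     `|u z.1 - u z.2| / edist z.1 z.2 `^ (N%:R / 2 + s))
    \in Lfun (lebesgue_Rn N \x lebesgue_Rn N)%E 2%:E.

(* |grad_s u|_2^2, with normalization constant C *)
Definition grad_s_norm2 (C s : R) u : \bar R :=
  (C%:E * \int[lebesgue_Rn N \x lebesgue_Rn N]_z
     (`|u z.1 - u z.2| ^+ 2 / edist z.1 z.2 `^ (N%:R + 2 * s))%:E)%E.

Definition sphere (s c : R) : set (Rn R N -> R) :=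
  [set u | Hs s u /\ (\int[lebesgue_Rn N]_x (u x ^+ 2)%:E = (c ^+ 2)%:E)%E].

(* Extended-real valued, so that no integrability is presumed; on sphere s c, and
   under condF4, both terms are finite (Gagliardo-Nirenberg). *)
Definition energy (C s : R) F u : \bar R :=
  ((2^-1)%:E * grad_s_norm2 C s u - \int[lebesgue_Rn N]_x (F x (u x))%:E)%E.

Definition energy_inf (C s : R) F (c : R) : \bar R :=
  ereal_inf [set energy C s F u | u in sphere s c].

(* Measurability with respect to the Lebesgue sets, the completion of the Borel
   sets: equality a.e. with a Borel measurable function. If f >= 0 is such a
   function, its integral against lebesgue_Rn (the supremum over the Borel
   simple functions below f) is its Lebesgue integral. *)
Definition lebesgue_measurable_fun (f : Rn R N -> R) : Prop :=
  exists2 g : Rn R N -> R, measurable_fun setT g &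
    \forall x \ae lebesgue_Rn N, f x = g x.

Definition caratheodory_fun F : Prop :=
  (forall t, lebesgue_measurable_fun (F ^~ t)) /\
  (\forall x \ae lebesgue_Rn N, continuous (F x)).

Definition Zperiodic F : Prop :=
  forall x t (z : 'I_N -> int), F (translate x z) t = F x t.

Definition condF1 (s : R) F : Prop :=
  exists Delta S r alpha p : R,
    [/\ [/\ 0 < Delta, 0 < S, 0 < r & 0 < alpha],
        0 <= p < 2,
        N%:R / 2 * alpha + p < N%:R + 2 * s
      & forall x t, r <= enorm x -> 0 < `|t| -> `|t| < S ->
          Delta * enorm x `^ (- p) * `|t| `^ alpha < F x t].

Definition condF4 (s : R) F : Prop :=
  exists B B' gamma l : R,
    [/\ 0 < B /\ 0 < B',
        0 < gamma, gamma < l, l < 4 * s / N%:R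
      & forall x t,
          0 <= F x t <= B * (`|t| `^ (gamma + 2) + `|t| `^ (l + 2)) /\
          `|derive1 (F x) t| <= B' * (`|t| `^ (gamma + 1) + `|t| `^ (l + 1))].

Definition condF5 (s : R) F : Prop :=
  exists2 sigma : R, 0 < sigma < 4 * s / N%:R &
    forall (theta : R) x t, 1 <= theta ->
      theta `^ (sigma + 2) * F x t <= F x (theta * t).

End fractional_sobolev.

(* Main.v *)
(* The growth l < 4s/N makes the energy coercive on the sphere, by a
   Gagliardo-Nirenberg inequality obtained pointwise: u x is compared with the
   values of u on a cube around x whose volume depends on |u x|. Spread-out tent
   functions and (F1) show that the infimum I is negative, so the potential term
   does not vanish along a minimizing sequence, and hence neither does the mass
   in suitable unit cubes. Integer translations, under which the energy is
   invariant, bring these cubes into a fixed one. Averages over small cubes give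
   local compactness, so that a subsequence w_n converges almost everywhere to
   some u of mass t > 0. By Brezis-Lieb the mass, the seminorm and the potential
   all split between u and w_n - u. Dilating a function of mass t <= c^2 to the
   sphere bounds its energy below by (t / c^2) I, and (F5) adds the gain
   ((c / sqrt t)^sigma - 1) times its potential. Applied to u and to w_n - u
   this forces t = c^2, and then the energy of u is I. *)

Require Import Defs.
From mathcomp Require Import all_boot all_order all_algebra.
From mathcomp Require Import all_classical all_reals all_analysis.
From mathcomp Require Import measurable_realfun.
From mathcomp Require Import ring lra zify.

Set Implicit Arguments.
Unset Strict Implicit.
Unset Printing Implicit Defensive.

Import Order.TTheory GRing.Theory Num.Theory.
Import numFieldNormedType.Exports.

Local Open Scope classical_set_scope.
Local Open Scope ring_scope.

(** The Gagliardo-Nirenberg inequality [GN_le] keeps two parameters free. A cut-off level [lam]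
    trades mass against seminorm, and a large value gives coercivity. The bound [M] on the local
    mass enters as an overall factor $(2M)^r$, so a small value gives the estimate that excludes
    vanishing. The lower bounds obtained by dilation are linear in the mass: those of u and of w_n -
    u add up to exactly I in the limit, which leaves no room for the positive gain. A separate
    obstacle is measurability. F is only Lebesgue measurable in x, while the functions on the sphere
    and all simple functions are Borel, so x -> F(x, u(x)) need not be Borel. F is therefore set to
    0 on a null set A off which its values at dyadic t agree with Borel functions. A need not be
    periodic, so translation invariance of the new potential is recovered only after integration.
    This is why it enters the minimization as a hypothesis on [pot] and not on the integrand. *)

Section powers.
Context {R : realType}.
Implicit Types a b r t : R.

Lemma le_powR_neg a b r : 0 < a -> a <= b -> r <= 0 -> b `^ r <= a `^ r.
Proof.
move=> a0 ab r0; rewrite -(opprK r) !(powRN _ (- r)).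
have b0 := lt_le_trans a0 ab.
rewrite lef_pV2 ?posrE ?powR_gt0// ge0_ler_powR ?nnegrE ?oppr_ge0//; exact: ltW.
Qed.

(** Puts the growth bounds of (F4) into the form $t^2|t|^r$, with the mass density split off, in
    which Gagliardo-Nirenberg is proved. *)
Lemma powR_add2 t r : 0 < r -> `|t| `^ (r + 2) = `|t| ^+ 2 * `|t| `^ r.
Proof.
move=> r0; have [->|t0] := eqVneq t 0.
  by rewrite normr0 expr0n mul0r powR0// gt_eqF// addr_gt0.
rewrite powRD; last by rewrite normr_eq0 t0 implybT.
by rewrite powR_mulrn// mulrC.
Qed.

Lemma powR_lt1 a r : 1 < a -> r < 0 -> a `^ r < 1.
Proof.
move=> a1 r0; have a0 := lt_trans ltr01 a1.
rewrite lt_neqAle powR_eq1 (gt_eqF a1) (lt_eqF r0) ltNge (ltW a0)/=.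
by rewrite -[leRHS](powRr0 a) ler_powR ?ltW.
Qed.

Lemma powR_exprn a r n : 0 <= a -> (a ^+ n) `^ r = (a `^ r) ^+ n.
Proof.
move=> a0; rewrite -(powR_mulrn n a0) -powRrM mulrC powRrM.
by rewrite powR_mulrn// powR_ge0.
Qed.

End powers.

(** * Integration *)

Section integrals.
Context d (T : measurableType d) (R : realType).
Variable mu : {measure set T -> \bar R}.

Import HBNNSimple.

(** Neither function is assumed measurable. The integral is a supremum over simple functions, and
    multiplying such an [h] below [f] by the indicator of the complement of [A] keeps its integral
    and puts it below [g]. This allows a potential that is only Lebesgue measurable to be replaced
    by a Borel one. *)
Let le_integral_off_null (A : set T) (f g : T -> \bar R) :
  measurable A -> mu A = 0%E -> (forall x, 0 <= f x)%E ->
  (forall x, 0 <= g x)%E -> (forall x, ~ A x -> f x = g x) ->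
  (\int[mu]_x f x <= \int[mu]_x g x)%E.
Proof.
move=> mA A0 f0 g0 fg.
rewrite !ge0_integralTE//; apply: ge_ereal_sup => _ [h hf <-].
have mAc := measurableC mA.
pose h' : {nnsfun T >-> R} := mul_nnsfun h (indic_nnsfun R mAc).
have -> : sintegral mu h = sintegral mu h'.
  rewrite -!integralT_nnsfun; apply: ge0_ae_eq_integral => //.
  - exact/measurable_EFinP.
  - exact/measurable_EFinP.
  - by move=> x _; rewrite lee_fin.
  - by move=> x _; rewrite lee_fin.
  exists A; split => // x /= /not_implyP[_ hh]; apply: contrapT => Ax.
  by apply: hh; rewrite /= [mindic _ _ _]indicE mem_set// mulr1.
apply: ereal_sup_ubound; exists h' => //= x.
rewrite [mindic _ _ _]indicE; have [Ax|Ax] := boolP (x \in ~` A).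
  by rewrite mulr1 -fg//; exact/set_mem.
by rewrite mulr0.
Qed.

Lemma integral_eq_off_null (A : set T) (f g : T -> \bar R) :
  measurable A -> mu A = 0%E -> (forall x, 0 <= f x)%E ->
  (forall x, 0 <= g x)%E -> (forall x, ~ A x -> f x = g x) ->
  (\int[mu]_x f x = \int[mu]_x g x)%E.
Proof.
move=> mA A0 f0 g0 fg; apply/eqP; rewrite eq_le.
rewrite (le_integral_off_null mA A0 f0 g0 fg)/=.
by apply: (le_integral_off_null mA A0) => // x Ax; rewrite fg.
Qed.

Lemma le_integral_EFin (f g : T -> R) : measurable_fun setT f ->
  measurable_fun setT g -> (forall x, 0 <= f x) -> (forall x, f x <= g x) ->
  (\int[mu]_x (f x)%:E <= \int[mu]_x (g x)%:E)%E.
Proof.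
move=> mf mg f0 fg; apply: ge0_le_integral => //.
- by move=> x _; rewrite lee_fin.
- exact/measurable_EFinP.
- exact/measurable_EFinP.
- by move=> x _; rewrite lee_fin.
Qed.

Lemma integralD_EFin_ge0 (f g : T -> R) : measurable_fun setT f ->
  measurable_fun setT g -> (forall x, 0 <= f x) -> (forall x, 0 <= g x) ->
  (\int[mu]_x (f x + g x)%:E = \int[mu]_x (f x)%:E + \int[mu]_x (g x)%:E)%E.
Proof.
move=> mf mg f0 g0; under eq_integral do rewrite EFinD.
rewrite ge0_integralD//.
- by move=> x _; rewrite lee_fin.
- exact/measurable_EFinP.
- by move=> x _; rewrite lee_fin.
- exact/measurable_EFinP.
Qed.

Lemma integralZ_EFin_ge0 (k : R) (f : T -> R) : 0 <= k ->
  measurable_fun setT f -> (forall x, 0 <= f x) ->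
  (\int[mu]_x (k * f x)%:E = k%:E * \int[mu]_x (f x)%:E)%E.
Proof.
move=> k0 mf f0; under eq_integral do rewrite EFinM.
rewrite ge0_integralZl_EFin//.
- by move=> x _; rewrite lee_fin.
- exact/measurable_EFinP.
Qed.

Lemma integral_EFin_ge0 (f : T -> R) : (forall x, 0 <= f x) ->
  (0 <= \int[mu]_x (f x)%:E)%E.
Proof. by move=> f0; apply: integral_ge0 => x _; rewrite lee_fin. Qed.

(* Brezis-Lieb: [(D n - e * H n)^+] is dominated by the fixed function [h] *)
Lemma brezis_lieb (D H : nat -> T -> R) (L : R) :
  (forall n, measurable_fun setT (D n)) -> (forall n x, 0 <= D n x) ->
  (forall n, measurable_fun setT (H n)) -> (forall n x, 0 <= H n x) ->
  (forall n, \int[mu]_x (H n x)%:E <= L%:E)%E ->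
  (\forall x \ae mu, D ^~ x @ \oo --> 0) ->
  (forall e : R, 0 < e -> exists h, [/\ measurable_fun setT h,
      (\int[mu]_x (h x)%:E < +oo)%E, forall x, 0 <= h x &
      forall n x, D n x <= e * H n x + h x]) ->
  forall e : R, 0 < e -> \forall n \near \oo, (\int[mu]_x (D n x)%:E <= e%:E)%E.
Proof.
move=> mD D0 mH H0 HL Dcvg dom e e0.
have L0 : 0 <= L.
  by rewrite -lee_fin; apply: le_trans (HL 0%N); exact: integral_EFin_ge0.
have L1 : 0 < L + 1 by rewrite ltr_wpDl.
(* Half of [e] pays for [e' * L], the other half for the integral of [W n], which tends to 0 by
   dominated convergence; [L + 1] keeps the divisor positive. *)
pose e' := e / 2 / (L + 1).
have e'0 : 0 < e' by rewrite !divr_gt0.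
have [h [mh hoo h0 Dh]] := dom _ e'0.
pose W n x := Num.max (D n x - e' * H n x) 0.
have mW n : measurable_fun setT (W n).
  apply: measurable_maxr => //; apply: measurable_funB => //.
  exact: measurable_funM.
have W0 n x : 0 <= W n x by rewrite /W le_max lexx orbT.
have Wh n x : W n x <= h x.
  by rewrite /W ge_max h0 andbT lerBlDl.
have WD n x : W n x <= D n x.
  by rewrite /W ge_max D0 andbT lerBlDr lerDl mulr_ge0// ltW.
have WW : (\int[mu]_x (W n x)%:E)%E @[n --> \oo] --> 0%E.
  have [|||||_ _] := @dominated_convergence _ T R mu setT measurableT
    (fun n x => (W n x)%:E) (cst 0%E) (EFin \o h).
  - by move=> n; exact/measurable_EFinP.
  - exact: measurable_cst.
  - apply: filterS Dcvg => x Dx _ /=; apply/cvg_EFin; first exact: nearW.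
    apply: (@squeeze_cvgr _ _ _ _ (cst 0) (D ^~ x)) => //.
      by apply: nearW => n /=; rewrite W0 WD.
    exact: cvg_cst.
  - apply/integrableP; split; first exact/measurable_EFinP.
    by under eq_integral do rewrite gee0_abs ?lee_fin//.
  - by apply: nearW => x n _ /=; rewrite lee_fin ger0_norm.
  - by rewrite integral0.
have e20 : 0 < e / 2 by rewrite divr_gt0.
move/fine_cvgP : WW => [Wfin Wcvg].
have Wlt : \forall n \near \oo, `|fine (\int[mu]_x (W n x)%:E)| < e / 2.
  move/cvgrPdist_lt : Wcvg => /(_ _ e20).
  by apply: filterS => n; rewrite sub0r normrN.
near=> n.
have Wn : (\int[mu]_x (W n x)%:E <= (e / 2)%:E)%E.
  rewrite -(@fineK _ (\int[mu]_x (W n x)%:E)%E); last by near: n.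
  rewrite lee_fin; apply: le_trans (ler_norm _) _; apply: ltW.
  by near: n.
have -> : e%:E = ((e / 2)%:E + (e / 2)%:E)%E :> \bar R.
  by rewrite -EFinD -splitr.
apply: (@le_trans _ _ (\int[mu]_x (W n x + e' * H n x)%:E)%E).
  apply: le_integral_EFin => //.
    by apply: measurable_funD => //; exact: measurable_funM.
  by move=> x; rewrite -lerBlDr /W le_max lexx.
rewrite integralD_EFin_ge0//; last 2 first.
  exact: measurable_funM.
  by move=> x; rewrite mulr_ge0// ltW.
apply: leeD => //; rewrite integralZ_EFin_ge0 ?(ltW e'0)//.
apply: (@le_trans _ _ (e'%:E * L%:E)%E).
  by apply: lee_wpmul2l; [rewrite lee_fin ltW|exact: HL].
rewrite -EFinM lee_fin /e' mulrAC ler_pdivrMr// ler_pM2l//.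
by rewrite lerDl.
Unshelve. all: by end_near.
Qed.

End integrals.

(** * Cubes and integer translations *)

(* Reclaims the name from the pseudometric [edist] of MathComp-Analysis. *)
Local Notation edist := Defs.edist.

Section Rn_geometry.
Context {R : realType}.
Variable N : nat.
Implicit Types (x y a : Rn R N) (h : R).

Lemma measurable_tnth_fst (i : 'I_N) :
  measurable_fun setT (fun z : Rn R N * Rn R N => tnth z.1 i).
Proof. exact: (measurableT_comp (measurable_tnth i) measurable_fst). Qed.

Lemma measurable_tnth_snd (i : 'I_N) :
  measurable_fun setT (fun z : Rn R N * Rn R N => tnth z.2 i).
Proof. exact: (measurableT_comp (measurable_tnth i) measurable_snd). Qed.

Lemma measurable_edist :
  measurable_fun setT (fun z : Rn R N * Rn R N => edist z.1 z.2).
Proof.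
apply: (@measurableT_comp _ _ _ _ _ _ (@Num.sqrt R)).
  by apply: continuous_measurable_fun => x; exact: sqrt_continuous.
apply: measurable_sum => i; apply: measurable_funX.
by apply: measurable_funB; [exact: measurable_tnth_fst|exact: measurable_tnth_snd].
Qed.

Lemma edist_eq0 x y : edist x y = 0 -> x = y.
Proof.
move/eqP; rewrite sqrtr_eq0 => xy0.
have S0 i : 0 <= (tnth x i - tnth y i) ^+ 2 by exact: sqr_ge0.
apply: eq_from_tnth => i; apply/eqP; rewrite -subr_eq0 -sqrf_eq0; apply/eqP.
apply: (psumr_eq0P (P := xpredT) (fun i _ => S0 i)) => //.
by apply/eqP; rewrite eq_le xy0 sumr_ge0.
Qed.

Lemma edist_ge0 x y : 0 <= edist x y.
Proof. exact: sqrtr_ge0. Qed.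

Lemma edistC x y : edist x y = edist y x.
Proof. by rewrite /edist; under eq_bigr do rewrite -sqrrN opprB. Qed.

Lemma edistxx x : edist x x = 0.
Proof.
by rewrite /edist big1 ?sqrtr0// => i _; rewrite subrr expr0n.
Qed.

(** Closed balls of the sup norm, of side [2 * h]: their measure is read off from
    [lebesgue_Rn_box]. *)
Definition cube a h : set (Rn R N) :=
  [set y | forall i, `|tnth y i - tnth a i| <= h].

Lemma cubeE a h : cube a h =
  [set y | forall i, `[tnth a i - h, tnth a i + h]%classic (tnth y i)].
Proof.
apply/seteqP; split => y /= yh i; have := yh i;
  by rewrite /= in_itv/= ler_distl.
Qed.

Lemma measurable_cube a h : measurable (cube a h).
Proof.
rewrite (_ : cube a h = \bigcap_(i in [set: 'I_N])
    ((fun y : Rn R N => tnth y i) @^-1` `[tnth a i - h, tnth a i + h])).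
  apply: fin_bigcap_measurable; first exact: finite_finset.
  by move=> i _; rewrite -[X in measurable X]setTI; exact: measurable_tnth.
rewrite cubeE; apply/seteqP; split => [x Ax i _|x Ax i]; exact: Ax.
Qed.

Lemma lebesgue_cube a h : 0 <= h ->
  lebesgue_Rn N (cube a h) = ((2 * h) ^+ N)%:E.
Proof.
move=> h0; rewrite cubeE.
rewrite (lebesgue_Rn_box (A := fun i => `[tnth a i - h, tnth a i + h]%classic))//.
under eq_bigr.
  move=> i _; rewrite lebesgue_measure_itv/= lte_fin.
  rewrite (_ : (if _ then _ else _) = (2 * h)%:E); first over.
  have [h1|h1] := ltrP (tnth a i - h) (tnth a i + h).
    by rewrite -EFinB; congr EFin; ring.
  have -> : h = 0 by lra.
    by rewrite mulr0.
by rewrite big_const_ord; elim: (N) => //= n ->; rewrite exprS EFinM.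
Qed.

Lemma cube_refl a h : 0 <= h -> cube a h a.
Proof. by move=> h0 i; rewrite subrr normr0. Qed.

Lemma edist_cube a h x y : cube a h x -> cube a h y ->
  edist x y <= 2 * h * Num.sqrt N%:R.
Proof.
(* For [N = 0] the cube is the whole space even when [h < 0]; otherwise some coordinate shows
   [0 <= h]. *)
move=> xa ya; have [N0|N0] := posnP N.
  rewrite /edist big1 ?sqrtr0//; last by move=> [i iN]; exfalso; rewrite N0 in iN.
  by rewrite N0 sqrtr0 mulr0.
have h0 : 0 <= h by apply: le_trans (xa (Ordinal N0)); exact: normr_ge0.
have h20 : 0 <= 2 * h by rewrite mulr_ge0.
rewrite -{1}(ger0_norm h20) -sqrtr_sqr -sqrtrM ?sqr_ge0//.
rewrite ler_wsqrtr//.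
apply: (@le_trans _ _ (\sum_(i < N) (2 * h) ^+ 2)).
  apply: ler_sum => i _; rewrite -real_normK ?num_real//.
  rewrite ler_sqr ?nnegrE//.
  rewrite -(subrKA (tnth a i)) (le_trans (ler_normD _ _))//.
  by rewrite mulr_natl mulr2n lerD ?xa// distrC ya.
by rewrite sumr_const card_ord mulr_natr.
Qed.

Lemma le_edist x y r : ~ cube x r y -> r <= edist x y.
Proof.
move=> /existsNP[i /negP]; rewrite -ltNge distrC => /ltW ri.
apply: (le_trans ri); rewrite -sqrtr_sqr ler_wsqrtr//.
rewrite (bigD1 i)//= lerDl sumr_ge0// => j _; exact: sqr_ge0.
Qed.

End Rn_geometry.

Section translation.
Context {R : realType}.

Lemma lebesgue_measure_translate (t : R) (A : set (measurableTypeR R)) :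
  measurable A ->
  pushforward lebesgue_measure ((fun x => x + t) : _ -> measurableTypeR R) A =
  lebesgue_measure A.
Proof.
move=> mA; apply/esym/lebesgue_measure_unique => //=.
  exact: measurable_funD.
move=> _.
move=> _ [[a b]] _ <-.
rewrite /pushforward.
rewrite (_ : _ @^-1` _ = `]a - t, b - t]%classic).
  by rewrite !lebesgue_measure_itv/= !lte_fin ltrD2r -!EFinB opprB addrA subrK.
by apply/seteqP; split => x /=; rewrite !in_itv/= ltrBlDr lerBrDr.
Qed.

Lemma ge0_integral_lebesgue_translate (t : R) (f : measurableTypeR R -> \bar R) :
  measurable_fun setT f -> (forall x, 0 <= f x)%E ->
  (\int[lebesgue_measure]_x f (x + t)%R = \int[lebesgue_measure]_x f x)%E.
Proof.
move=> mf f0.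
have mt : measurable_fun setT ((fun x => x + t) : measurableTypeR R -> measurableTypeR R).
  exact: measurable_funD.
rewrite -[LHS](@ge0_integral_pushforward _ _ _ _ R _ mt lebesgue_measure setT f)//.
by apply: eq_measure_integral => // A mA _; exact: lebesgue_measure_translate.
Qed.

Lemma ge0_integral_lebesgue_RnS n (f : Rn R n.+1 -> \bar R) :
  measurable_fun setT f -> (forall x, 0 <= f x)%E ->
  (\int[lebesgue_Rn n.+1]_x f x =
   \int[lebesgue_measure]_x \int[lebesgue_Rn n]_y f (cons_Rn (x, y)))%E.
Proof.
move=> mf f0.
rewrite (@ge0_integral_pushforward _ _ _ _ R _ (@measurable_cons_Rn R n) _ setT f)//.
rewrite preimage_setT fubini_tonelli1//=.
by apply: measurableT_comp => //; exact: measurable_cons_Rn.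
Qed.

Lemma measurable_translate N (z : 'I_N -> int) :
  measurable_fun setT (fun x : Rn R N => translate x z).
Proof.
apply/measurable_fun_tnthP => i.
rewrite (_ : _ \o _ = fun x => tnth x i + (z i)%:~R).
  by apply: measurable_funD => //; exact: measurable_tnth.
by apply/funext => x /=; rewrite tnth_mktuple.
Qed.

Lemma ge0_integral_translate n (z : 'I_n -> int) (f : Rn R n -> \bar R) :
  measurable_fun setT f -> (forall x, 0 <= f x)%E ->
  (\int[lebesgue_Rn n]_x f (translate x z) = \int[lebesgue_Rn n]_x f x)%E.
Proof.
elim: n z f => [|n IH] z f mf f0.
  by congr integral; apply/funext => x; rewrite [translate x z]tuple0 [x]tuple0.
rewrite !ge0_integral_lebesgue_RnS//; last first.
  by apply: measurableT_comp => //; exact: measurable_translate.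
have fc x : measurable_fun setT (fun y => f (cons_Rn (x, y))).
  apply: measurableT_comp => //; apply: measurableT_comp.
    exact: measurable_cons_Rn.
  exact: measurable_pair1.
pose z' i := z (lift ord0 i).
have tr x y : translate (cons_Rn (x, y)) z =
    cons_Rn (x + (z ord0)%:~R, translate y z').
  apply: eq_from_tnth => i; rewrite tnth_mktuple.
  have [j ->|->] := unliftP ord0 i; last by rewrite !tnth0.
  by rewrite !tnthS tnth_mktuple.
under eq_integral.
  move=> x _; under eq_integral do rewrite tr.
  rewrite (IH z' (fun y => f (cons_Rn (x + (z ord0)%:~R, y))))//.
  over.
rewrite (ge0_integral_lebesgue_translate _
  (f := fun x => \int[lebesgue_Rn n]_y f (cons_Rn (x, y)))%E)//.
  apply: (measurable_fun_fubini_tonelli_F (fun z => f (cons_Rn z))) => //.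
  by apply: measurableT_comp => //; exact: measurable_cons_Rn.
by move=> x; exact: integral_ge0.
Qed.

End translation.

(** * Mass, Gagliardo seminorm and a Gagliardo-Nirenberg inequality *)

Section gagliardo.
Context {R : realType}.
Variables (N : nat) (s : R).
Implicit Types (x y a : Rn R N) (u v : Rn R N -> R) (k h M r lam : R).
Local Notation mu := (@lebesgue_Rn R N).

Definition slope u x y : R :=
  `|u x - u y| ^+ 2 / edist x y `^ (N%:R + 2 * s).

(** Energy density of the seminorm: pointwise estimates are stated against it and then integrated
    through [gagE]. It may be infinite at some points, hence the extended values. *)
Definition gagd u x : \bar R := (\int[mu]_y (slope u x y)%:E)%E.

Definition gag u : \bar R := (\int[mu \x mu]_z (slope u z.1 z.2)%:E)%E.

Definition mass u : \bar R := (\int[mu]_x (u x ^+ 2)%:E)%E.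

Lemma slope_ge0 u x y : 0 <= slope u x y.
Proof. by rewrite mulr_ge0// invr_ge0 powR_ge0. Qed.

Lemma gag_ge0 u : (0 <= gag u)%E.
Proof. by apply: integral_EFin_ge0 => z; exact: slope_ge0. Qed.

Lemma gagd_ge0 u x : (0 <= gagd u x)%E.
Proof. by apply: integral_EFin_ge0 => z; exact: slope_ge0. Qed.

Lemma mass_ge0 u : (0 <= mass u)%E.
Proof. by apply: integral_EFin_ge0 => z; exact: sqr_ge0. Qed.

Lemma measurable_slope u : measurable_fun setT u ->
  measurable_fun setT (fun z : Rn R N * Rn R N => slope u z.1 z.2).
Proof.
move=> mu_; apply: measurable_funM.
  apply: measurable_funX; apply: measurableT_comp => //.
  by apply: measurable_funB; apply: measurableT_comp.
rewrite (_ : (fun _ => _) = fun z : Rn R N * Rn R N =>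
    edist z.1 z.2 `^ (- (N%:R + 2 * s))); last first.
  by apply/funext => z; rewrite powRN.
apply: (@measurableT_comp _ _ _ _ _ _ (fun t : R => t `^ (- (N%:R + 2 * s)))).
  exact: measurable_powR.
exact: measurable_edist.
Qed.

Lemma measurable_slope1 u x : measurable_fun setT u ->
  measurable_fun setT (slope u x).
Proof.
move=> mu_.
rewrite (_ : slope u x = (fun z => slope u z.1 z.2) \o pair x)//.
apply: measurableT_comp; first exact: measurable_slope.
exact: measurable_pair1.
Qed.

Lemma measurable_gagd u : measurable_fun setT u ->
  measurable_fun setT (gagd u).
Proof.
move=> mu_.
apply: (measurable_fun_fubini_tonelli_F (fun z => (slope u z.1 z.2)%:E)) => //.
- by apply/measurable_EFinP; exact: measurable_slope.
- by move=> z; rewrite lee_fin slope_ge0.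
Qed.

Lemma gagE u : measurable_fun setT u -> (gag u = \int[mu]_x gagd u x)%E.
Proof.
move=> mu_; rewrite /gag fubini_tonelli1//.
- by apply/measurable_EFinP; exact: measurable_slope.
- by move=> z; rewrite lee_fin slope_ge0.
Qed.

Lemma measurable_sqr u : measurable_fun setT u ->
  measurable_fun setT (fun x => u x ^+ 2).
Proof. exact: measurable_funX. Qed.

Lemma Lfun2P d (T : measurableType d) (m : {measure set T -> \bar R})
    (f : T -> R) :
  f \in Lfun m 2%:E <->
  measurable_fun setT f /\ (\int[m]_x (f x ^+ 2)%:E < +oo)%E.
Proof.
have E : (\int[m]_x (f x ^+ 2)%:E = 'N[m]_2%:E[EFin \o f] `^ 2)%E.
  rewrite poweR_Lnorm//; apply: eq_integral => x _ /=.
  by rewrite powR_mulrn// real_normK// num_real.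
split.
- move=> /andP[/[!inE]/= mf ff]; split => //.
  by rewrite E poweR_lty.
- move=> [mf]; rewrite E => ff; rewrite inE; apply/andP; split; rewrite inE//=.
  rewrite /finite_norm ltey; apply/eqP => f1; move: ff; rewrite f1.
  by rewrite poweRyr.
Qed.

Lemma slopeE u x y : 0 < N%:R + 2 * s ->
  slope u x y = (`|u x - u y| / edist x y `^ (N%:R / 2 + s)) ^+ 2.
Proof.
move=> Ns; rewrite /slope exprMn exprVn.
rewrite -[(edist _ _ `^ _) ^+ 2]powR_mulrn ?powR_ge0// -powRrM.
by congr (_ / _ `^ _); field.
Qed.

Lemma HsP u : 0 < N%:R + 2 * s ->
  Hs s u <-> [/\ measurable_fun setT u, (mass u < +oo)%E & (gag u < +oo)%E].
Proof.
move=> Ns; rewrite /Hs Lfun2P Lfun2P /gag.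
under [X in _ <-> [/\ _, _ & (X < +oo)%E]]eq_integral do rewrite slopeE//.
split=> [[[mf f2] [_ g2]] //|[mf f2 g2]]; split => //; split => //.
apply: measurable_funM.
  by apply: measurableT_comp => //; apply: measurable_funB;
    apply: measurableT_comp.
rewrite (_ : (fun _ => _) = fun z : Rn R N * Rn R N =>
    edist z.1 z.2 `^ (- (N%:R / 2 + s))); last first.
  by apply/funext => z; rewrite powRN.
apply: (@measurableT_comp _ _ _ _ _ _ (fun t : R => t `^ (- (N%:R / 2 + s)))).
  exact: measurable_powR.
exact: measurable_edist.
Qed.

Lemma slopeB_le u v x y :
  slope (fun x => u x - v x) x y <= 2 * slope u x y + 2 * slope v x y.
Proof.
rewrite /slope (mulrA 2 (`|u x - u y| ^+ 2)) (mulrA 2 (`|v x - v y| ^+ 2)).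
rewrite -mulrDl ler_wpM2r ?invr_ge0 ?powR_ge0//.
rewrite !real_normK ?num_real//.
set a := u x - u y; set b := v x - v y.
have -> : u x - v x - (u y - v y) = a - b by rewrite /a /b; ring.
have := sqr_ge0 (a + b); lra.
Qed.

Lemma slopeZ k u x y : slope (fun x => k * u x) x y = k ^+ 2 * slope u x y.
Proof.
by rewrite /slope -mulrBr normrM exprMn (real_normK (num_real k)) -mulrA.
Qed.

Lemma gagB_le u v : measurable_fun setT u -> measurable_fun setT v ->
  (gag (fun x => u x - v x)%R <= 2%:E * gag u + 2%:E * gag v)%E.
Proof.
move=> mu_ mv.
have mS w : measurable_fun setT w ->
    measurable_fun setT (fun z : Rn R N * Rn R N => 2 * slope w z.1 z.2).
  by move=> mw; apply: measurable_funM => //; exact: measurable_slope.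
have S0 w z : 0 <= 2 * slope w z.1 z.2 by rewrite mulr_ge0// slope_ge0.
rewrite -!integralZ_EFin_ge0 ?(measurable_slope mu_) ?(measurable_slope mv)//;
  try by move=> z; exact: slope_ge0.
rewrite -integralD_EFin_ge0//; [|exact: mS..].
apply: le_integral_EFin.
- by apply: measurable_slope; exact: measurable_funB.
- by apply: measurable_funD; exact: mS.
- by move=> z; exact: slope_ge0.
- by move=> z; exact: slopeB_le.
- exact: measurable_slope.
- exact: measurable_slope.
Qed.

Lemma massB_le u v : measurable_fun setT u -> measurable_fun setT v ->
  (mass (fun x => u x - v x)%R <= 2%:E * mass u + 2%:E * mass v)%E.
Proof.
move=> mu_ mv; have mu2 := measurable_sqr mu_; have mv2 := measurable_sqr mv.
rewrite -!integralZ_EFin_ge0//; [|by move=> x; exact: sqr_ge0..].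
have mZ (w : Rn R N -> R) : measurable_fun setT w ->
    measurable_fun setT (fun x : Rn R N => 2 * w x : R).
  by move=> mw; exact: measurable_funM.
have S0 (w : Rn R N -> R) x : 0 <= 2 * w x ^+ 2 by rewrite mulr_ge0// sqr_ge0.
rewrite -integralD_EFin_ge0//; [|exact: mZ..].
apply: le_integral_EFin.
- by apply: measurable_sqr; exact: measurable_funB.
- by apply: measurable_funD; exact: mZ.
- by move=> x; exact: sqr_ge0.
- by move=> x; have := sqr_ge0 (u x + v x); lra.
Qed.

Lemma gagZ k u : measurable_fun setT u ->
  (gag (fun x => k * u x)%R = (k ^+ 2)%:E * gag u)%E.
Proof.
move=> mu_; rewrite /gag; under eq_integral do rewrite slopeZ.
rewrite integralZ_EFin_ge0 ?sqr_ge0//; first exact: measurable_slope.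
by move=> z; exact: slope_ge0.
Qed.

Lemma massZ k u : measurable_fun setT u ->
  (mass (fun x => k * u x)%R = (k ^+ 2)%:E * mass u)%E.
Proof.
move=> mu_; rewrite /mass; under eq_integral do rewrite exprMn.
rewrite integralZ_EFin_ge0 ?sqr_ge0//; first exact: measurable_sqr.
by move=> z; exact: sqr_ge0.
Qed.

Lemma gag_translate u (z : 'I_N -> int) : measurable_fun setT u ->
  gag (fun x => u (translate x z)) = gag u.
Proof.
move=> mu_; have mt := @measurable_translate R N z.
rewrite (gagE mu_) gagE; last exact: measurableT_comp.
rewrite -[RHS](ge0_integral_translate z); last 2 first.
  exact: measurable_gagd.
  by move=> x; exact: gagd_ge0.
apply: eq_integral => x _.
rewrite /gagd -[RHS](ge0_integral_translate z); last 2 first.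
  by apply/measurable_EFinP; exact: measurable_slope1.
  by move=> y; rewrite lee_fin slope_ge0.
apply: eq_integral => y _; rewrite /slope; congr (_ / _ `^ _)%:E.
by rewrite /Defs.edist; congr Num.sqrt; apply: eq_bigr => i _;
  rewrite !tnth_mktuple opprD addrACA subrr addr0.
Qed.

Lemma mass_translate u (z : 'I_N -> int) : measurable_fun setT u ->
  mass (fun x => u (translate x z)) = mass u.
Proof.
move=> mu_; rewrite /mass.
rewrite (ge0_integral_translate z (f := fun x => (u x ^+ 2)%:E))//.
  by apply/measurable_EFinP; exact: measurable_sqr.
by move=> x; rewrite lee_fin sqr_ge0.
Qed.

Hypothesis s0 : 0 < s.

(** On the cube [edist x y] is at most the diameter, which bounds the singular kernel from below. On
    the diagonal, where [slope] takes the value 0, the left integrand vanishes as well. *)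
Lemma cube_dist2_le u a h x : measurable_fun setT u -> cube a h x ->
  (\int[mu]_(y in cube a h) (`|u x - u y| ^+ 2)%:E <=
   ((2 * h * Num.sqrt N%:R) `^ (N%:R + 2 * s))%:E * gagd u x)%E.
Proof.
move=> mu_ ax; set e := N%:R + 2 * s; set D := 2 * h * _.
have e0 : 0 < e by rewrite ltr_wpDl// mulr_gt0.
have mA := @measurable_cube R N a h.
rewrite -integralZ_EFin_ge0 ?powR_ge0//; last 2 first.
  exact: measurable_slope1.
  by move=> y; exact: slope_ge0.
have mS : measurable_fun setT (fun y => D `^ e * slope u x y).
  by apply: measurable_funM => //; exact: measurable_slope1.
apply: (@le_trans _ _ (\int[mu]_(y in cube a h) (D `^ e * slope u x y)%:E)%E).
  apply: ge0_le_integral => //.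
  - apply/measurable_EFinP; apply: (@measurable_funS _ _ _ _ setT) => //.
    apply: measurable_funX; apply: measurableT_comp => //.
    exact: measurable_funB.
  - by apply/measurable_EFinP; apply: (@measurable_funS _ _ _ _ setT).
  - move=> y ay; rewrite lee_fin /slope mulrCA.
    have [/edist_eq0 ->|xy0] := eqVneq (edist x y) 0.
      by rewrite subrr normr0 expr0n/= mul0r.
    rewrite ler_peMr// ler_pdivlMr; last first.
      by rewrite powR_gt0// lt_neqAle eq_sym xy0 edist_ge0.
    rewrite mul1r ge0_ler_powR ?nnegrE ?edist_ge0 ?(ltW e0)//.
      exact: le_trans (edist_ge0 x x) (edist_cube ax ax).
    exact: edist_cube.
apply: ge0_subset_integral => //.
- exact/measurable_EFinP.
- by move=> y _; rewrite lee_fin mulr_ge0 ?powR_ge0 ?slope_ge0.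
Qed.

Hypothesis N0 : (0 < N)%N.

(** The mass-critical power: here the seminorm enters Gagliardo-Nirenberg with exponent one.
    Strictly below it, its coefficient can be made small by a power of the cut-off level. *)
Definition crit : R := 4 * s / N%:R.

(** The factor $(2h\sqrt N)^{N+2s}$ of [cube_dist2_le] with $(2h)^N h^{2s}$ taken out; the 4 comes
    from squaring a sum and absorbing the local mass. *)
Definition GN_const : R := 4 * 2 `^ (2 * s) * Num.sqrt N%:R `^ (N%:R + 2 * s).

Lemma GN_const_gt0 : 0 < GN_const.
Proof. by rewrite /GN_const !mulr_gt0// powR_gt0// sqrtr_gt0 ltr0n. Qed.

Lemma le_integral_cube u a h h' : measurable_fun setT u -> h <= h' ->
  (\int[mu]_(y in cube a h) (u y ^+ 2)%:E <=
   \int[mu]_(y in cube a h') (u y ^+ 2)%:E)%E.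
Proof.
move=> mu_ hh'; apply: ge0_subset_integral.
- exact: measurable_cube.
- exact: measurable_cube.
- apply/measurable_EFinP; apply: (@measurable_funS _ _ _ _ setT) => //.
  exact: measurable_sqr.
- by move=> y _; rewrite lee_fin sqr_ge0.
- by move=> y ay i; exact: le_trans (ay i) hh'.
Qed.

(* Comparing [u x] with its values on the cube centred at [x] of volume
   comparable to [(M / |u x|)^2] *)
Lemma critical_pointwise u M x : measurable_fun setT u -> 0 < M ->
  (\int[mu]_(y in cube x 1) (u y ^+ 2)%:E <= (M ^+ 2)%:E)%E ->
  2 * M <= `|u x| ->
  ((`|u x| ^+ 2 * `|u x| `^ crit)%:E <=
   (GN_const * (2 * M) `^ crit)%:E * gagd u x)%E.
Proof.
move=> mu_ M0 uM; set t := `|u x| => tM.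
have M20 : 0 < 2 * M by rewrite mulr_gt0.
have t0 : 0 < t by apply: lt_le_trans tM.
have NR : 0 < N%:R :> R by rewrite ltr0n.
set a := 2 * M / t.
have a0 : 0 < a by rewrite divr_gt0.
have a1 : a <= 1 by rewrite ler_pdivrMr// mul1r.
(* Chosen for $h^N = a^2$ and $h^{2s} = a^{4s/N}$: the first fixes the volume of the cube, the
   second produces the critical power. *)
pose h := a `^ (2 / N%:R).
have h0 : 0 < h by rewrite powR_gt0.
have h1 : h <= 1.
  by rewrite -(powRr0 a) ger_powR ?a0// divr_ge0.
have hN : h ^+ N = a ^+ 2.
  by rewrite -powR_mulrn ?(ltW h0)// -powRrM divfK ?gt_eqF// powR_mulrn// ltW.
have hs : h `^ (2 * s) = a `^ crit.
  by rewrite -powRrM /crit; congr (_ `^ _); field; rewrite gt_eqF.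
have mA := @measurable_cube R N x h.
have mf : measurable_fun setT (fun y => 2 * `|u x - u y| ^+ 2).
  apply: measurable_funM => //; apply: measurable_funX.
  by apply: measurableT_comp => //; exact: measurable_funB.
have mg : measurable_fun setT (fun y => 2 * u y ^+ 2).
  by apply: measurable_funM => //; exact: measurable_sqr.
set D := (2 * h * Num.sqrt N%:R) `^ (N%:R + 2 * s).
have main : (((2 * h) ^+ N * t ^+ 2)%:E <=
    2%:E * (D%:E * gagd u x) + (2 * M ^+ 2)%:E)%E.
  apply: (@le_trans _ _ (\int[mu]_(y in cube x h) (t ^+ 2)%:E)%E).
    by rewrite integral_cst//= lebesgue_cube ?(ltW h0)// -EFinM mulrC.
  apply: (@le_trans _ _ (\int[mu]_(y in cube x h)
      ((2 * `|u x - u y| ^+ 2)%:E + (2 * u y ^+ 2)%:E))%E).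
    apply: ge0_le_integral => //.
    - by move=> y _; rewrite lee_fin sqr_ge0.
    - apply: emeasurable_funD; apply/measurable_EFinP;
        exact: (@measurable_funS _ _ _ _ setT).
    - move=> y _; rewrite -EFinD lee_fin /t !real_normK ?num_real//.
      by have := sqr_ge0 (u x - 2 * u y); lra.
  have f0 y : cube x h y -> (0 <= (`|u x - u y| ^+ 2)%:E)%E.
    by rewrite lee_fin sqr_ge0.
  have g0 y : cube x h y -> (0 <= (u y ^+ 2)%:E)%E by rewrite lee_fin sqr_ge0.
  have mf1 : measurable_fun (cube x h) (fun y => (`|u x - u y| ^+ 2)%:E).
    apply/measurable_EFinP; apply: (@measurable_funS _ _ _ _ setT) => //.
    apply: measurable_funX; apply: measurableT_comp => //.
    exact: measurable_funB.
  have mg1 : measurable_fun (cube x h) (fun y => (u y ^+ 2)%:E).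
    apply/measurable_EFinP; apply: (@measurable_funS _ _ _ _ setT) => //.
    exact: measurable_sqr.
  under eq_integral do rewrite !EFinM.
  have D0 y k : cube x h y -> 0 <= k -> forall z, 0 <= z ->
    (0 <= k%:E * z%:E)%E by move=> _ k0 z z0; rewrite -EFinM lee_fin mulr_ge0.
  rewrite ge0_integralD; [|exact: mA|by move=> y yh; apply: mule_ge0 => //;
      exact: f0|exact: measurable_funeM|by move=> y yh; apply: mule_ge0 => //;
      exact: g0|exact: measurable_funeM].
  rewrite !ge0_integralZl_EFin//.
  apply: leeD.
    apply: lee_wpmul2l; first by rewrite lee_fin.
    by apply: cube_dist2_le => //; apply: cube_refl; exact: ltW.
  rewrite EFinM; apply: lee_wpmul2l; first by rewrite lee_fin.
  by apply: le_trans uM; exact: le_integral_cube.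
have K0 := GN_const_gt0.
case: (gagd u x) (gagd_ge0 u x) main => [r| |//].
- rewrite !lee_fin => r0 main.
  have h20 : 0 < 2 * h by rewrite mulr_gt0.
  have DE : D = (2 * h) ^+ N * (2 `^ (2 * s) * a `^ crit *
      Num.sqrt N%:R `^ (N%:R + 2 * s)).
    rewrite /D powRM ?sqrtr_ge0 ?(ltW h20)// powRD; last first.
      by apply/implyP => _; rewrite gt_eqF.
    by rewrite powR_mulrn ?(ltW h20)// powRM ?(ltW h0)// hs !mulrA.
  (* The local mass term [2 * M ^+ 2] is at most a quarter of the left side of [main], so it can be
     absorbed there; $N \ge 1$ gives the factor $2^N \ge 2$. *)
  have big : 8 * M ^+ 2 <= (2 * h) ^+ N * t ^+ 2.
    rewrite exprMn hN -mulrA /a exprMn exprVn divfK ?expf_neq0 ?gt_eqF// exprMn.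
    rewrite (_ : 8 * M ^+ 2 = 2 * (2 ^+ 2 * M ^+ 2)); last by ring.
    apply: ler_wpM2r; first by rewrite mulr_ge0 ?sqr_ge0.
    by rewrite -[leLHS]expr1 ler_weXn2l// ler1n.
  have hh0 : 0 < (2 * h) ^+ N by rewrite exprn_gt0.
  have {}main : t ^+ 2 <= 4 * (2 `^ (2 * s) * a `^ crit *
      Num.sqrt N%:R `^ (N%:R + 2 * s)) * r.
    rewrite -(ler_pM2l hh0); move: main; rewrite DE.
    set z := (_ * _ * Num.sqrt _ `^ _); set q := (2 * h) ^+ N.
    rewrite (_ : q * (4 * z * r) = 2 * (2 * (q * z * r))); last by ring.
    by move: big (sqr_ge0 M); rewrite -/q; lra.
  have at_ : a `^ crit * t `^ crit = (2 * M) `^ crit.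
    by rewrite -powRM ?(ltW a0) ?(ltW t0)// /a divfK// gt_eqF.
  rewrite -at_.
  apply: (@le_trans _ _ (4 * (2 `^ (2 * s) * a `^ crit *
      Num.sqrt N%:R `^ (N%:R + 2 * s)) * r * t `^ crit)).
    by rewrite ler_wpM2r ?powR_ge0.
  rewrite /GN_const le_eqVlt; apply/orP; left; apply/eqP; ring.
- by move=> _ _; rewrite mulry gtr0_sg ?mul1e ?leey// mulr_gt0// powR_gt0.
Qed.

(** Cut at the level [2 * M * lam]. Below it the power of order [r] is bounded by that of the level.
    Above it the critical bound applies, and the leftover power, of exponent [r - crit <= 0], is
    largest at the level. *)
Lemma subcritical_pointwise u M r lam x : measurable_fun setT u -> 0 < M ->
  (\int[mu]_(y in cube x 1) (u y ^+ 2)%:E <= (M ^+ 2)%:E)%E ->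
  0 <= r <= crit -> 1 <= lam ->
  ((`|u x| ^+ 2 * `|u x| `^ r)%:E <=
   ((2 * M) `^ r * lam `^ r * u x ^+ 2)%:E +
   ((2 * M) `^ r * lam `^ (r - crit) * GN_const)%:E * gagd u x)%E.
Proof.
move=> mu_ M0 uM /andP[r0 rc] l1.
have l0 : 0 < lam by apply: lt_le_trans l1.
have M20 : 0 < 2 * M by rewrite mulr_gt0.
have K0 := GN_const_gt0.
have C0 : 0 <= (2 * M) `^ r * lam `^ (r - crit) * GN_const.
  by rewrite !mulr_ge0 ?powR_ge0// ltW.
have [ul|ul] := leP (`|u x|) (2 * M * lam).
  apply: (@le_trans _ _ ((2 * M) `^ r * lam `^ r * u x ^+ 2)%:E).
    rewrite lee_fin real_normK ?num_real// mulrC ler_wpM2r ?sqr_ge0//.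
    rewrite -powRM ?(ltW l0) ?(ltW M20)//.
    by rewrite ge0_ler_powR ?nnegrE ?mulr_ge0// ltW.
  by rewrite leeDl// mule_ge0 ?gagd_ge0.
have uM2 : 2 * M <= `|u x|.
  by apply: le_trans (ltW ul); rewrite ler_peMr// ltW.
have u0 : 0 < `|u x| by exact: lt_le_trans uM2.
have := critical_pointwise mu_ M0 uM uM2.
set t := `|u x| in u0 ul uM2 * => crt.
apply: (@le_trans _ _ (((2 * M) `^ r * lam `^ (r - crit) * GN_const)%:E *
    gagd u x)%E); last first.
  by rewrite leeDr// lee_fin mulr_ge0 ?sqr_ge0// mulr_ge0// powR_ge0.
have -> : (t ^+ 2 * t `^ r) = t `^ (r - crit) * (t ^+ 2 * t `^ crit).
  by rewrite mulrCA -powRD ?subrK// (gt_eqF u0) implybT.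
apply: (@le_trans _ _ ((t `^ (r - crit))%:E *
    ((GN_const * (2 * M) `^ crit)%:E * gagd u x))%E).
  by rewrite EFinM lee_wpmul2l// lee_fin powR_ge0.
rewrite muleA -EFinM lee_wpmul2r ?gagd_ge0// lee_fin.
rewrite [leLHS](_ : _ = t `^ (r - crit) * (2 * M) `^ crit * GN_const); last by ring.
rewrite ler_wpM2r ?(ltW K0)//.
have -> : (2 * M) `^ r = (2 * M) `^ (r - crit) * (2 * M) `^ crit.
  by rewrite -powRD ?subrK// (gt_eqF M20) implybT.
rewrite mulrAC -powRM ?(ltW l0) ?(ltW M20)// ler_wpM2r ?powR_ge0//.
by apply: le_powR_neg; rewrite ?mulr_gt0 ?subr_le0// ltW.
Qed.

(** For [r < crit] a large [lam] makes the coefficient of the seminorm small ([pot_coercive]). For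
    [r > 0] and fixed [lam], a small [M] makes the whole bound small ([pot_vanishing]). *)
Lemma GN_le u M r lam : measurable_fun setT u -> 0 < M ->
  (forall x, \int[mu]_(y in cube x 1) (u y ^+ 2)%:E <= (M ^+ 2)%:E)%E ->
  0 <= r <= crit -> 1 <= lam ->
  (\int[mu]_x (`|u x| ^+ 2 * `|u x| `^ r)%:E <=
   ((2 * M) `^ r)%:E *
   ((lam `^ r)%:E * mass u + (lam `^ (r - crit) * GN_const)%:E * gag u))%E.
Proof.
move=> mu_ M0 uM rc l1; have K0 := GN_const_gt0.
have mr : measurable_fun setT (fun x => `|u x| ^+ 2 * `|u x| `^ r).
  have mau : measurable_fun setT (fun x => `|u x|) by exact: measurableT_comp.
  apply: measurable_funM; first exact: measurable_funX.
  by apply: (@measurableT_comp _ _ _ _ _ _ (@powR R ^~ r)) => //.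
set A := (2 * M) `^ r * lam `^ r.
set B := (2 * M) `^ r * lam `^ (r - crit) * GN_const.
have A0 : 0 <= A by rewrite mulr_ge0 ?powR_ge0.
have B0 : 0 <= B by rewrite !mulr_ge0 ?powR_ge0// ltW.
have f0 x : (0 <= (A * u x ^+ 2)%:E)%E by rewrite lee_fin mulr_ge0 ?sqr_ge0.
have g0 x : (0 <= B%:E * gagd u x)%E by rewrite mule_ge0 ?gagd_ge0.
have mf : measurable_fun setT (fun x => (A * u x ^+ 2)%:E).
  by apply/measurable_EFinP; apply: measurable_funM => //; exact: measurable_sqr.
have mg : measurable_fun setT (fun x => (B%:E * gagd u x)%E).
  by apply: measurable_funeM; exact: measurable_gagd.
apply: (@le_trans _ _ (\int[mu]_x ((A * u x ^+ 2)%:E + B%:E * gagd u x))%E).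
  apply: ge0_le_integral => //.
  - exact/measurable_EFinP.
  - exact: emeasurable_funD.
  - by move=> x _; exact: subcritical_pointwise.
rewrite ge0_integralD//.
rewrite integralZ_EFin_ge0//; last 2 first.
  exact: measurable_sqr.
  by move=> x; exact: sqr_ge0.
rewrite ge0_integralZl_EFin//; last 2 first.
- by move=> x _; exact: gagd_ge0.
- exact: measurable_gagd.
have mass1 : (0 <= (lam `^ r)%:E * mass u)%E.
  by rewrite mule_ge0 ?mass_ge0// lee_fin powR_ge0.
have gag1 : (0 <= (lam `^ (r - crit) * GN_const)%:E * gag u)%E.
  by rewrite mule_ge0 ?gag_ge0// lee_fin mulr_ge0 ?powR_ge0// ltW.
by rewrite -gagE// [leRHS]ge0_muleDr// !muleA -!EFinM mulrA.
Qed.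

End gagliardo.

(** * Cube averages *)

Section bounded_family.
Context {R : realType}.
Import ArrowAsProduct.

(** Tychonoff's theorem gives a cluster point of the sequence in a product of segments. It does the
    work of a diagonal extraction, since every use inspects finitely many indices [D] at a time. *)
Lemma bounded_family_cluster (I : choiceType) (a : nat -> I -> R) (M : I -> R) :
  (forall n i, `|a n i| <= M i) ->
  exists l : I -> R, forall (D : seq I) (e : R) (n0 : nat), 0 < e ->
    exists2 n, (n0 <= n)%N & {in D, forall i, `|a n i - l i| < e}.
Proof.
move=> aM.
have := @tychonoff I (fun=> R) (fun i => `[- M i, M i]%classic)
  (fun i => @segment_compact R _ _).
move=> /(_ (a @ \oo) _ _)[].
  by exists 0%N => // n _ i /=; rewrite in_itv/= -ler_norml.
move=> l [_ cl]; exists l => D e n0 e0.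
pose A := [set f : I -> R | exists2 n, (n0 <= n)%N & f = a n].
pose B := [set f : I -> R | {in D, forall i, `|f i - l i| < e}].
have [||f [[n n0n ->] Bf]] := cl A B; last by exists n.
  by exists n0 => // n /= n0n; exists n.
rewrite {}/B; elim: D => [|i D IH].
  by apply: filterS (@filterT _ _ _) => f _ i; rewrite in_nil.
have := @proj_continuous I (fun=> R) i l.
move/cvgrPdist_lt => /(_ _ e0) Bi.
apply: filterS (filterI Bi IH) => f [fi fD] j; rewrite in_cons => /predU1P[->|].
  by rewrite distrC; exact: fi.
exact: fD.
Qed.

End bounded_family.

Section averages.
Context {R : realType}.
Variables (N : nat) (s : R).
Implicit Types (x y a : Rn R N) (u v w : Rn R N -> R) (k h M r lam : R).
Local Notation mu := (@lebesgue_Rn R N).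

Definition cellint w a h : R := (\int[mu]_(y in cube a h) w y)%R.

Lemma lebesgue_cube_lty a h : 0 <= h -> (mu (cube a h) < +oo)%E.
Proof. by move=> h0; rewrite lebesgue_cube// ltry. Qed.

Lemma integrable_cst_cube a h k : 0 <= h ->
  mu.-integrable (cube a h) (EFin \o cst k).
Proof.
move=> h0; apply/integrableP; split; first by apply/measurable_EFinP; exact: measurable_cst.
under eq_integral do rewrite /=.
rewrite integral_cst//=; last exact: measurable_cube.
by rewrite lte_mul_pinfty ?lebesgue_cube_lty.
Qed.

Lemma integral_cube_le_mass w a h : measurable_fun setT w ->
  (\int[mu]_(y in cube a h) (w y ^+ 2)%:E <= mass w)%E.
Proof.
move=> mw; apply: ge0_subset_integral => //.
- exact: measurable_cube.
- by apply/measurable_EFinP; exact: measurable_sqr.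
- by move=> y _; rewrite lee_fin sqr_ge0.
Qed.

Lemma integrable_sqr_cube w a h : measurable_fun setT w -> (mass w < +oo)%E ->
  mu.-integrable (cube a h) (fun y => (w y ^+ 2)%:E).
Proof.
move=> mw wfin; apply/integrableP; split.
  apply/measurable_EFinP; apply: (@measurable_funS _ _ _ _ setT) => //.
  exact: measurable_sqr.
under eq_integral do rewrite gee0_abs ?lee_fin ?sqr_ge0//.
exact: le_lt_trans (integral_cube_le_mass _ _ mw) wfin.
Qed.

Lemma integrable_cube w a h : 0 <= h ->
  measurable_fun setT w -> (mass w < +oo)%E ->
  mu.-integrable (cube a h) (EFin \o w).
Proof.
move=> h0 mw wfin.
have mA := @measurable_cube R N a h.
have int1 : mu.-integrable (cube a h) (fun y => (cst 1 y + w y ^+ 2)%:E).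
  rewrite (_ : (fun _ => _) = (EFin \o cst 1) \+ (fun y => (w y ^+ 2)%:E))//.
  apply: integrableD => //; last exact: integrable_sqr_cube.
  exact: integrable_cst_cube.
apply: le_integrable int1 => //.
  by apply/measurable_EFinP; apply: (@measurable_funS _ _ _ _ setT).
move=> y _ /=; rewrite lee_fin [leRHS]ger0_norm ?addr_ge0 ?sqr_ge0//.
rewrite -(@real_normK _ (w y)) ?num_real//.
by have := sqr_ge0 (`|w y| - 1); have := sqr_ge0 (`|w y|); lra.
Qed.

Lemma cellintB u v a h : 0 <= h ->
  measurable_fun setT u -> (mass u < +oo)%E ->
  measurable_fun setT v -> (mass v < +oo)%E ->
  cellint (fun x => u x - v x) a h = cellint u a h - cellint v a h.
Proof.
move=> h0 mu_ ufin mv vfin; rewrite /cellint RintegralB//.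
- exact: measurable_cube.
- exact: integrable_cube.
- exact: integrable_cube.
Qed.

Lemma cellint_bound w a h (m : R) : 0 <= h ->
  measurable_fun setT w -> (mass w <= m%:E)%E ->
  `|cellint w a h| <= (2 * h) ^+ N + m.
Proof.
move=> h0 mw wm.
have wfin : (mass w < +oo)%E by apply: le_lt_trans wm _; rewrite ltry.
have mA := @measurable_cube R N a h.
apply: le_trans (le_normr_Rintegral _ (integrable_cube _ h0 mw wfin)) _ => //.
have i1 : mu.-integrable (cube a h) (EFin \o cst 1).
  exact: integrable_cst_cube.
have i2 := integrable_sqr_cube a h mw wfin.
apply: (@le_trans _ _ (\int[mu]_(y in cube a h) (cst 1 y + w y ^+ 2))%R).
  apply: le_Rintegral => //.
  - exact/integrable_norm/integrable_cube.
  - rewrite (_ : EFin \o _ = (EFin \o cst 1) \+ (fun y => (w y ^+ 2)%:E))//.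
    exact: integrableD.
  - move=> y _ /=; rewrite -(@real_normK _ (w y)) ?num_real//.
    by have := sqr_ge0 (`|w y| - 1); have := sqr_ge0 (`|w y|); lra.
rewrite RintegralD// Rintegral_cst// mul1r.
rewrite [X in fine X](lebesgue_cube a h0)/= lerD2l.
rewrite -lee_fin /Rintegral fineK; last exact: integrable_fin_num.
exact: le_trans (integral_cube_le_mass _ _ mw) wm.
Qed.

Hypotheses (s0 : 0 < s) (N0 : (0 < N)%N).

(** Twice the diameter factor of [cube_dist2_le] divided by the volume of the cube. It is of order
    $h^{2s}$, hence small for small cubes. *)
Definition avg_const h : R :=
  2 * ((2 * h) `^ (2 * s) * Num.sqrt N%:R `^ (N%:R + 2 * s)).

(** With b = w(x) - avg, one has $|w(x)-w(y)|^2 \ge b^2 + 2b(avg - w(y))$, and the linear term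
    integrates to 0 over the cube. This is Jensen's inequality by a tangent line: the seminorm
    density controls the deviation of w(x) from the average. *)
Lemma sqr_le_avg w a h x : 0 < h -> cube a h x ->
  measurable_fun setT w -> (mass w < +oo)%E ->
  ((w x ^+ 2)%:E <= (avg_const h)%:E * gagd s w x +
     (2 * (((2 * h) ^+ N)^-1 * cellint w a h) ^+ 2)%:E)%E.
Proof.
move=> h0 ax mw wfin; set q := (2 * h) ^+ N; set avg := q^-1 * _.
have mA := @measurable_cube R N a h.
have h20 : 0 < 2 * h by rewrite mulr_gt0.
have q0 : 0 < q by rewrite exprn_gt0.
set b := w x - avg.
have DE : (2 * h * Num.sqrt N%:R) `^ (N%:R + 2 * s) = q / 2 * avg_const h.
  rewrite powRM ?sqrtr_ge0 ?(ltW h20)// powRD; last first.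
    by apply/implyP => _; rewrite gt_eqF.
  by rewrite powR_mulrn ?(ltW h20)// /avg_const -/q; field.
have C0 : 0 < avg_const h.
  by rewrite !mulr_gt0 ?powR_gt0// sqrtr_gt0 ltr0n.
have main : ((q * b ^+ 2)%:E <= (q / 2 * avg_const h)%:E * gagd s w x)%E.
  rewrite -DE; apply: le_trans (cube_dist2_le s0 mw ax).
  have intb : mu.-integrable (cube a h)
      (EFin \o ((cst (b ^+ 2 + 2 * b * avg)) \- (fun y => 2 * b * w y))).
    rewrite (_ : EFin \o _ = ((EFin \o cst (b ^+ 2 + 2 * b * avg)%R) \-
      (fun y => (2 * b)%:E * (EFin \o w) y))%E)//.
    apply: integrableB => //; first exact: integrable_cst_cube (ltW h0).
    apply: (@integrableZl _ _ _ mu _ mA (2 * b) (EFin \o w)).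
    exact: integrable_cube (ltW h0) mw wfin.
  have intd : mu.-integrable (cube a h) (fun y => (`|w x - w y| ^+ 2)%:E).
    apply: (@le_integrable _ _ _ mu _ mA _
      (EFin \o (cst (2 * w x ^+ 2) \+ (fun y => 2 * w y ^+ 2)))).
    - apply/measurable_EFinP; apply: (@measurable_funS _ _ _ _ setT) => //.
      apply: measurable_funX; apply: measurableT_comp => //.
      exact: measurable_funB.
    - move=> y _ /=; rewrite lee_fin [leRHS]ger0_norm; last first.
        by apply: addr_ge0; apply: mulr_ge0 => //; exact: sqr_ge0.
      rewrite [leLHS]ger0_norm ?sqr_ge0// real_normK ?num_real//.
      by have := sqr_ge0 (w x + w y); lra.
    - rewrite (_ : EFin \o _ = ((EFin \o cst (2 * w x ^+ 2)%R) \+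
        (fun y => 2%:E * (w y ^+ 2)%:E))%E)//.
      apply: integrableD => //; first exact: integrable_cst_cube (ltW h0).
      apply: (@integrableZl _ _ _ mu _ mA 2 (fun y => (w y ^+ 2)%:E)).
      exact: integrable_sqr_cube.
  apply: (@le_trans _ _ (\int[mu]_(y in cube a h)
     ((cst (b ^+ 2 + 2 * b * avg)) \- (fun y => 2 * b * w y)) y)%:E).
    rewrite RintegralB//; last 2 first.
      exact: integrable_cst_cube (ltW h0).
      apply: (@integrableZl _ _ _ mu _ mA (2 * b) (EFin \o w)).
      exact: integrable_cube (ltW h0) mw wfin.
    rewrite Rintegral_cst// RintegralZl//; last first.
      exact: integrable_cube (ltW h0) mw wfin.
    rewrite [X in fine X](lebesgue_cube a (ltW h0))/= -/(cellint w a h) -/q.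
    rewrite lee_fin (_ : cellint w a h = q * avg).
      rewrite le_eqVlt; apply/orP; left; apply/eqP; ring.
    by rewrite /avg mulVKf// gt_eqF.
  rewrite /Rintegral fineK; last exact: integrable_fin_num.
  apply: le_integral => // y _ /=; rewrite lee_fin real_normK ?num_real//.
  rewrite (_ : w x - w y = b + (avg - w y)); last by rewrite /b; ring.
  by have := sqr_ge0 (avg - w y); lra.
case: (gagd s w x) (gagd_ge0 s w x) main => [g| |//].
- rewrite !lee_fin => g0 main.
  have {}main : 2 * b ^+ 2 <= avg_const h * g.
    rewrite -(ler_pM2l q0); move: main.
    rewrite (_ : q / 2 * avg_const h * g = q * (avg_const h * g) / 2).
      by lra.
    by field.
  apply: (@le_trans _ _ (2 * b ^+ 2 + 2 * avg ^+ 2)); last by rewrite lerD2r.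
  by rewrite /b; have := sqr_ge0 (w x - 2 * avg); lra.
- by move=> _ _; rewrite mulry gtr0_sg ?mul1e ?addye ?leey.
Qed.

Definition origin : Rn R N := [tuple 0 | i < N].

(** A quantitative form of the compact embedding into $L^2_{loc}$: fine cells make the seminorm term
    small, and then only the averages over finitely many cells matter. Each point may use its own
    cell. *)
Lemma local_L2_le w h (L tau : R) : 0 < h -> 0 <= L -> 0 <= tau ->
  measurable_fun setT w -> (mass w < +oo)%E ->
  (forall x, cube origin L x -> exists2 a, cube a h x &
     `|((2 * h) ^+ N)^-1 * cellint w a h| <= tau) ->
  (\int[mu]_(x in cube origin L) (w x ^+ 2)%:E <=
   (avg_const h)%:E * gag s w + (2 * tau ^+ 2 * (2 * L) ^+ N)%:E)%E.
Proof.
move=> h0 L0 tau0 mw wfin cov.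
set K := cube _ L.
have mK : measurable K by exact: measurable_cube.
have C0 : 0 <= avg_const h by rewrite !mulr_ge0 ?powR_ge0.
have mg := measurable_gagd s mw.
have g0 x : (0 <= (avg_const h)%:E * gagd s w x)%E.
  by rewrite mule_ge0 ?gagd_ge0.
have mg1 : measurable_fun K (fun x => ((avg_const h)%:E * gagd s w x)%E).
  by apply: (@measurable_funS _ _ _ _ setT) => //; exact: measurable_funeM.
have t0 : (0 <= (2 * tau ^+ 2)%:E)%E by rewrite lee_fin mulr_ge0 ?sqr_ge0.
apply: (@le_trans _ _ (\int[mu]_(x in K)
    ((avg_const h)%:E * gagd s w x + (2 * tau ^+ 2)%:E))%E).
  apply: ge0_le_integral => //.
  - by move=> x _; rewrite lee_fin sqr_ge0.
  - apply/measurable_EFinP; apply: (@measurable_funS _ _ _ _ setT) => //.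
    exact: measurable_sqr.
  - exact: emeasurable_funD.
  - move=> x Kx; have [a ax ta] := cov _ Kx.
    apply: (le_trans (sqr_le_avg h0 ax mw wfin)).
    rewrite leeD2l// lee_fin ler_wpM2l// -real_normK ?num_real//.
    by rewrite ler_sqr ?nnegrE.
rewrite ge0_integralD// integral_cst//= lebesgue_cube// EFinM leeD2r//.
rewrite gagE// -ge0_integralZl_EFin//; last by move=> x _; exact: gagd_ge0.
by apply: ge0_subset_integral => //; exact: measurable_funeM.
Qed.

End averages.

(** * Local compactness *)

Section grid.
Context {R : realType}.
Variable N : nat.
Local Notation mu := (@lebesgue_Rn R N).

Lemma exists_nat_ge (x : R) : exists n : nat, x <= n%:R.
Proof.
exists (Num.bound `|x|); apply: le_trans (ler_norm x) _.
exact/ltW/archi_boundP.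
Qed.

Definition gridpt (h : R) (z : {ffun 'I_N -> int}) : Rn R N :=
  [tuple h * (z i)%:~R | i < N].

(* the lattice points with coordinates in [[-K, K]] *)
Definition lattice (K : nat) : seq {ffun 'I_N -> int} :=
  [seq [ffun i => (k i : nat)%:Z - K%:Z] |
     k : {ffun 'I_N -> 'I_(K.*2.+1)} <- enum {: {ffun 'I_N -> 'I_(K.*2.+1)}}].

Lemma mem_lattice K (z : {ffun 'I_N -> int}) :
  (forall i, - K%:Z <= z i <= K%:Z) -> z \in lattice K.
Proof.
move=> zK; apply/mapP; exists [ffun i => inord (absz (z i + K%:Z))].
  by rewrite mem_enum.
apply/ffunP => i; rewrite !ffunE inordK; last first.
  by have /andP[] := zK i; lia.
have /andP[zi1 _] := zK i.
by rewrite gez0_abs ?addrK// -lerBlDr sub0r.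
Qed.

Lemma grid_cover (h L : R) : 0 < h ->
  exists K, forall x, cube (origin N) L x ->
    exists2 z, z \in lattice K & cube (gridpt h z) h x.
Proof.
(* The added 1 allows for rounding down: the floor can fall below [- (L / h)] by up to 1. *)
move=> h0; have [K LK] := exists_nat_ge (L / h + 1).
exists K => x xL; exists [ffun i => Num.floor (tnth x i / h)].
  apply: mem_lattice => i; rewrite ffunE.
  have := xL i; rewrite tnth_mktuple subr0 => xi.
  have xhi : `|tnth x i / h| <= L / h.
    by rewrite normrM (gtr0_norm (x := h^-1)) ?invr_gt0// ler_wpM2r// invr_ge0 ltW.
  have /andP[f1 f2] := floor_itv (tnth x i / h).
  move: xhi; rewrite ler_norml => /andP[x1 x2].
  rewrite -!(ler_int R) mulrNz; move: f2; rewrite intrD => f2.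
  apply/andP; split; move: LK; rewrite -pmulrn; lra.
move=> i; rewrite tnth_mktuple ffunE.
have /andP[f1 f2] := floor_itv (tnth x i / h).
rewrite (_ : tnth x i - _ = h * (tnth x i / h - (Num.floor (tnth x i / h))%:~R)).
  rewrite normrM (gtr0_norm h0) ler_piMr ?(ltW h0)//.
  by move: f2; rewrite intrD ler_norml => f2; apply/andP; split; lra.
by rewrite mulrBr mulrCA divff ?mulr1// gt_eqF.
Qed.

End grid.

Section extraction.
Context {R : realType}.
Variables (N : nat) (s : R).
Local Notation mu := (@lebesgue_Rn R N).
Hypotheses (s0 : 0 < s) (N0 : (0 < N)%N).

Lemma avg_const_small (e : R) : 0 < e ->
  exists j : nat, avg_const N s j.+1%:R^-1 <= e.
Proof.
move=> e0; set C := 2 * Num.sqrt N%:R `^ (N%:R + 2 * s).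
have C0 : 0 < C by rewrite mulr_gt0// powR_gt0// sqrtr_gt0 ltr0n.
have s20 : 0 < 2 * s by rewrite mulr_gt0.
pose t := (e / C) `^ (2 * s)^-1.
have t0 : 0 < t by rewrite powR_gt0// divr_gt0.
have [j jt] := exists_nat_ge (2 / t); exists j.
have jt' : 2 * j.+1%:R^-1 <= t.
  rewrite ler_pdivrMr ?ltr0n// mulrC -ler_pdivrMr//.
  by apply: le_trans jt _; rewrite ler_nat.
rewrite /avg_const (_ : _ * _ = C * (2 * j.+1%:R^-1) `^ (2 * s)); last first.
  by rewrite /C; ring.
rewrite mulrC -ler_pdivlMr//.
apply: (@le_trans _ _ (t `^ (2 * s))).
  by rewrite ge0_ler_powR ?nnegrE// ?mulr_ge0// ltW.
by rewrite -powRrM mulVf ?gt_eqF// powRr1// ltW// divr_gt0.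
Qed.

Lemma seq_min_gt0 (d : nat -> R) n : (forall k, 0 < d k) ->
  exists2 e : R, 0 < e & forall k, (k <= n)%N -> e <= d k.
Proof.
move=> d0; elim: n => [|n [e e0 ed]].
  by exists (d 0%N) => // k; rewrite leqn0 => /eqP ->.
exists (Num.min e (d n.+1)); first by rewrite lt_min e0 d0.
move=> k; rewrite leq_eqVlt => /predU1P[->|]; first by rewrite ge_min lexx orbT.
by rewrite ltnS => /ed ked; rewrite ge_min ked.
Qed.

(** The averages over all cells of all grids of step [1 / j.+1] form a countable bounded family. Two
    terms of the sequence close to its cluster point on finitely many cells have a difference with
    small averages, to which [local_L2_le] applies. The map [phi] need not be increasing:
    [i <= phi i] suffices for limits. *)
Lemma local_compactness (u : nat -> Rn R N -> R) (m Lam : R) (eps : nat -> R) :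
  (forall k, 0 < eps k) ->
  (forall n, measurable_fun setT (u n)) ->
  (forall n, mass (u n) <= m%:E)%E ->
  (forall n, gag s (u n) <= Lam%:E)%E ->
  exists phi : nat -> nat, (forall i, (i <= phi i)%N) /\
    forall k i i', (k <= i)%N -> (k <= i')%N ->
    (\int[mu]_(x in cube (origin N) k%:R)
       ((u (phi i) x - u (phi i') x) ^+ 2)%:E <= (eps k)%:E)%E.
Proof.
move=> eps0 mun um ug.
have ufin n : (mass (u n) < +oo)%E by apply: le_lt_trans (um n) _; rewrite ltry.
pose I := (nat * {ffun 'I_N -> int})%type.
pose h (j : nat) : R := j.+1%:R^-1.
have h0 j : 0 < h j by rewrite invr_gt0 ltr0n.
pose a n (i : I) := cellint (u n) (gridpt (h i.1) i.2) (h i.1).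
have [i|l lP] := @bounded_family_cluster R I a (fun i => (2 * h i.1) ^+ N + m).
  by move=> i'; apply: cellint_bound => //; exact: ltW.
have Lam0 : 0 <= Lam.
  by rewrite -lee_fin; apply: le_trans (ug 0%N); exact: gag_ge0.
have claim k : exists Dd : seq I * R, 0 < Dd.2 /\ forall n n',
    {in Dd.1, forall i, `|a n i - l i| < Dd.2} ->
    {in Dd.1, forall i, `|a n' i - l i| < Dd.2} ->
    (\int[mu]_(x in cube (origin N) k%:R)
       ((u n x - u n' x) ^+ 2)%:E <= (eps k)%:E)%E.
  have e2 : 0 < eps k / 2 by rewrite divr_gt0.
  have L1 : 0 < 4 * Lam + 1 by rewrite ltr_wpDl// mulr_ge0.
  have [j jP] := avg_const_small (divr_gt0 e2 L1).
  have [K KP] := @grid_cover R N (h j) k%:R (h0 j).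
  (* Makes the average term $2\tau^2(2k)^N$ at most [eps k / 2]; the added 1 covers [k = 0]. *)
  pose tau : R := Num.sqrt (eps k / 2 / (2 * ((2 * k%:R) ^+ N + 1))).
  have Q0 : 0 < (2 * k%:R) ^+ N + 1 :> R.
    by rewrite ltr_wpDl// exprn_ge0// mulr_ge0.
  have tau0 : 0 < tau by rewrite sqrtr_gt0 !divr_gt0// mulr_gt0.
  have q0 : 0 < (2 * h j) ^+ N by rewrite exprn_gt0// mulr_gt0.
  (* Two integrals within half of [tau] times the cell volume of the cluster value differ by at most
     [tau] times that volume. *)
  exists ([seq (j, z) | z <- lattice N K], tau * (2 * h j) ^+ N / 2).
  split=> [|n n' /= nP n'P]; first by rewrite !mulr_gt0.
  set w := fun x => u n x - u n' x.
  have mw : measurable_fun setT w by exact: measurable_funB.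
  have wfin : (mass w < +oo)%E.
    apply: le_lt_trans (massB_le _ _) _ => //.
    by rewrite lte_add_pinfty// lte_mul_pinfty.
  have wgag : (gag s w <= (4 * Lam)%:E)%E.
    apply: le_trans (gagB_le _ _ _) _ => //.
    rewrite (_ : (4 * Lam)%:E = 2%:E * Lam%:E + 2%:E * Lam%:E)%E; last first.
      by rewrite -!EFinM -EFinD; congr EFin; ring.
    by apply: leeD; apply: lee_wpmul2l.
  apply: (@le_trans _ _ ((avg_const N s (h j))%:E * gag s w +
      (2 * tau ^+ 2 * (2 * k%:R) ^+ N)%:E)%E).
    apply: local_L2_le => //; first exact: ltW.
    move=> x /KP[z zK xz]; exists (gridpt (h j) z) => //.
    rewrite normrM ger0_norm ?invr_ge0 ?(ltW q0)// mulrC ler_pdivrMr//.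
    rewrite cellintB ?(ltW (h0 j))//.
    have jz : (j, z) \in [seq (j, z) | z <- lattice N K] by exact: map_f.
    have := nP _ jz; have := n'P _ jz; rewrite /a/=.
    set A := cellint _ _ _; set B := cellint _ _ _; set c := l _.
    rewrite !ltr_norml => /andP[? ?] /andP[? ?].
    by rewrite ler_norml; apply/andP; split; lra.
  have C0 : 0 <= avg_const N s (h j) by rewrite !mulr_ge0 ?powR_ge0.
  apply: (@le_trans _ _ ((avg_const N s (h j) * (4 * Lam) +
      2 * tau ^+ 2 * (2 * k%:R) ^+ N)%:E)).
    rewrite EFinD; apply: leeD => //; rewrite [leRHS]EFinM.
    by apply: lee_wpmul2l; rewrite ?lee_fin.
  rewrite lee_fin [leRHS](splitr (eps k)) lerD//.
    apply: (@le_trans _ _ (avg_const N s (h j) * (4 * Lam + 1))).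
      by rewrite ler_wpM2l// lerDl.
    by rewrite -ler_pdivlMr.
  rewrite sqr_sqrtr ?divr_ge0 ?mulr_ge0 ?(ltW Q0) ?(ltW e2) ?(ltW (eps0 k))//.
  rewrite [leLHS](_ : _ = eps k / 2 *
      ((2 * k%:R) ^+ N / ((2 * k%:R) ^+ N + 1))); last first.
    by field; rewrite gt_eqF.
  by rewrite ler_piMr ?(ltW e2)// ler_pdivrMr// mul1r lerDl.
have /choice[Dd DdP] := claim.
(* One index meets the requirements of all [k <= i] at once: their cells are concatenated and the
   least tolerance is taken. *)
have pick i : exists n, (i <= n)%N /\ forall k, (k <= i)%N ->
    {in (Dd k).1, forall j, `|a n j - l j| < (Dd k).2}.
  have [e e0 ed] := @seq_min_gt0 (fun k => (Dd k).2) i (fun k => (DdP k).1).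
  have [n ni nP] := lP (flatten [seq (Dd k).1 | k <- iota 0 i.+1]) e i e0.
  exists n; split => // k ki j jD.
  apply: lt_le_trans (ed k ki); apply: nP.
  by apply/flatten_mapP; exists k => //; rewrite mem_iota/= add0n ltnS.
have /choice[phi phiP] := pick.
exists phi; split => [i|k i i' ki ki']; first by have [] := phiP i.
by apply: (DdP k).2; [apply: (phiP i).2|apply: (phiP i').2].
Qed.

End extraction.

(** * Almost everywhere limits: Fatou and fast Cauchy sequences *)

Section ae_limits.
Context d (T : measurableType d) (R : realType).
Variable mu : {measure set T -> \bar R}.

Lemma integral_indicM (h : T -> R) (A : set T) :
  (\int[mu]_(x in A) (h x)%:E = \int[mu]_x (h x * \1_A x)%:E)%E.
Proof.
rewrite integral_mkcond; apply: eq_integral => x _.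
by rewrite patchE indicE; case: ifPn => xA; rewrite ?mulr1 ?mulr0.
Qed.

Lemma fatou_EFin (f_ : nat -> T -> R) (f : T -> R) (L : \bar R) :
  (forall n, measurable_fun setT (f_ n)) -> measurable_fun setT f ->
  (forall n x, 0 <= f_ n x) -> (forall x, 0 <= f x) ->
  (\forall x \ae mu, f_ ^~ x @ \oo --> f x) ->
  (forall n, \int[mu]_x (f_ n x)%:E <= L)%E ->
  (\int[mu]_x (f x)%:E <= L)%E.
Proof.
move=> mf_ mf f_0 f0 cv fL.
have mE n : measurable_fun setT (EFin \o f_ n) by exact/measurable_EFinP.
have E0 n x : setT x -> (0 <= (EFin \o f_ n) x)%E by rewrite lee_fin.
have mlim : measurable_fun setT (fun x => limn_einf (fun n => (f_ n x)%:E)).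
  apply: measurableT_comp => //; apply: measurable_fun_limn_esup => n.
  by apply/measurable_EFinP/measurableT_comp.
have -> : (\int[mu]_x (f x)%:E =
    \int[mu]_x limn_einf (fun n => (f_ n x)%:E))%E.
  apply: ge0_ae_eq_integral => //.
  - exact/measurable_EFinP.
  - by move=> x _; rewrite lee_fin.
  - move=> x _; rewrite limn_einf_lim; apply: lime_ge.
      exact: is_cvg_einfs.
    apply: nearW => n; apply: le_ereal_inf_tmp => _ [k _ <-].
    by rewrite lee_fin.
  - apply: filterS cv => x fx _.
    have : (f_ n x)%:E @[n --> \oo] --> (f x)%:E.
      by apply: cvg_EFin => //; exact: nearW.
    by move=> /cvg_limn_einf_sup[-> _].
apply: le_trans (fatou mu measurableT mE E0) _.
rewrite limn_einf_lim; apply: lime_le; first exact: is_cvg_einfs.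
apply: nearW => n; apply: le_trans (fL n); apply: ge_ereal_inf.
by exists (\int[mu]_x (f_ n x)%:E)%E => //; exists n => /=.
Qed.

(** The upper limit is measurable everywhere, also where the sequence diverges, and [fine] makes it
    real. *)
Lemma ae_limit_measurable (w : nat -> T -> R) :
  (forall n, measurable_fun setT (w n)) ->
  (\forall x \ae mu, cvgn (w ^~ x)) ->
  exists2 u : T -> R, measurable_fun setT u &
    \forall x \ae mu, w ^~ x @ \oo --> u x.
Proof.
move=> mw cw; exists (fun x => fine (limn_esup (fun n => (w n x)%:E))).
  apply: measurableT_comp => //; apply: measurable_fun_limn_esup => n.
  exact/measurable_EFinP.
apply: filterS cw => x wx.
have : (w n x)%:E @[n --> \oo] --> (limn (w ^~ x))%:E.
  by apply: cvg_EFin => //; exact: nearW.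
by move=> /cvg_limn_einf_sup[_ ->].
Qed.

(* [sum_k 4^k |w k - w (k+1)|^2] is integrable over the sets [A k], which
   exhaust the space *)
Lemma fast_cauchy_cvg (w : nat -> T -> R) (A : nat -> set T) :
  (forall n, measurable_fun setT (w n)) ->
  (forall n, measurable (A n)) ->
  (forall x, \forall n \near \oo, A n x) ->
  (forall k, \int[mu]_(x in A k) ((w k x - w k.+1 x) ^+ 2)%:E <=
     ((4 ^+ k)^-1 / (2 ^ (k + 1))%:R)%:E)%E ->
  \forall x \ae mu, cvgn (w ^~ x).
Proof.
move=> mw mA Ax wk.
pose f k x := 4 ^+ k * (w k x - w k.+1 x) ^+ 2 * \1_(A k) x : R.
have f0 k x : 0 <= f k x.
  by rewrite /f mulr_ge0// mulr_ge0 ?sqr_ge0// exprn_ge0.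
have mwk k : measurable_fun setT (fun x => (w k x - w k.+1 x) ^+ 2).
  by apply: measurable_funX; exact: measurable_funB.
have mf k : measurable_fun setT (f k).
  apply: measurable_funM => //; exact: measurable_funM.
have mfE k : measurable_fun setT (EFin \o f k) by exact/measurable_EFinP.
have fE0 k x : setT x -> (0 <= (EFin \o f k) x)%E by rewrite lee_fin.
pose g x := (\sum_(k <oo) (f k x)%:E)%E.
have g0 x : (0 <= g x)%E by apply: nneseries_ge0 => n _ _; rewrite lee_fin.
have mg : measurable_fun setT g.
  apply: (@ge0_emeasurable_sum _ _ _ _ (fun k => EFin \o f k) xpredT) => //.
  by move=> k x _ _; rewrite lee_fin.
have gint : mu.-integrable setT g.
  apply/integrableP; split; first exact: mg.
  under eq_integral do rewrite gee0_abs//.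
  rewrite integral_nneseries//.
  apply: (@le_lt_trans _ _ 1%E); last by rewrite ltry.
  have := @cvg_geometric_eseries_half R 1 0.
  rewrite expr0 divr1 => /cvg_lim <-//.
  apply: lee_nneseries => [k _ _|k _]; first exact: integral_EFin_ge0.
  under eq_integral do rewrite /f -mulrA.
  rewrite integralZ_EFin_ge0 ?exprn_ge0//; last 2 first.
    exact: measurable_funM.
    by move=> x; rewrite mulr_ge0 ?sqr_ge0.
  rewrite -integral_indicM.
  apply: (@le_trans _ _ ((4 ^+ k)%:E * ((4 ^+ k)^-1 / (2 ^ (k + 1))%:R)%:E)%E).
    by apply: lee_wpmul2l => //; rewrite lee_fin exprn_ge0.
  by rewrite -EFinM lee_fin mulrA divff// expf_neq0.
have := integrable_ae measurableT gint.
apply: filterS => x /(_ Logic.I) gx.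
have [k0 _ Ak0] := Ax x.
pose c k : R := `|w k x - w k.+1 x|.
(* From index [k0] on, [x] lies in [A k] and the series [g x] bounds every term; the finitely many
   earlier increments are put into the constant. *)
pose C := Num.sqrt (fine (g x)) + \sum_(k < k0) c k * 2 ^+ k.
have cC k : c k <= C / 2 ^+ k.
  rewrite ler_pdivlMr ?exprn_gt0//.
  have S0 : 0 <= \sum_(k < k0) c k * 2 ^+ k.
    by apply: sumr_ge0 => i _; rewrite mulr_ge0 ?normr_ge0 ?exprn_ge0.
  have [kk0|kk0] := ltnP k k0.
    rewrite /C (bigD1 (Ordinal kk0))//= addrCA lerDl addr_ge0 ?sqrtr_ge0//.
    by apply: sumr_ge0 => i _; rewrite mulr_ge0 ?normr_ge0 ?exprn_ge0.
  rewrite (@le_trans _ _ (Num.sqrt (fine (g x))))// ?lerDl//.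
  have -> : c k * 2 ^+ k = Num.sqrt (f k x).
    rewrite /f indicE mem_set ?mulr1; last exact: Ak0.
    rewrite (_ : 4 = 2 ^+ 2); last by ring.
    by rewrite exprAC -exprMn sqrtr_sqr normrM mulrC ger0_norm ?exprn_ge0.
  rewrite ler_wsqrtr// -lee_fin fineK//.
  apply: le_trans (nneseries_lim_ge k.+1 _) => /=; last first.
    by move=> n _ _; rewrite lee_fin.
  rewrite big_nat_recr//= leeDr// sume_ge0// => i _.
  by rewrite lee_fin.
have cvs : cvgn (series (telescope (w ^~ x))).
  apply: normed_cvg; apply: (@series_le_cvg _ _ (geometric C (2^-1))).
  - by move=> n /=.
  - move=> n; apply: geometric_ge0 => //.
    by apply: le_trans (normr_ge0 _) _; have := cC 0%N; rewrite expr0 divr1; exact.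
  - by move=> n; rewrite /= /telescope/= distrC exprVn; exact: cC.
  - apply: is_cvg_geometric_series; rewrite ger0_norm ?invr_ge0//.
    by rewrite invf_lt1// ltr1n.
rewrite telescopeK in cvs.
rewrite (_ : w ^~ x = [sequence w n x - w 0%N x]_n \+ cst (w 0%N x)).
  by apply: is_cvgD => //; exact: is_cvg_cst.
by apply/funext => n /=; rewrite subrK.
Qed.

End ae_limits.

(** * Splitting along almost everywhere convergent sequences *)

Section splitting.
Context d (T : measurableType d) (R : realType).
Variable mu : {measure set T -> \bar R}.

(** The $L^1$ bound on the defect is turned into two inequalities between sums of nonnegative
    integrals, so that no subtraction takes place before all values are known to be finite. *)
Lemma fine_splitting (f g : nat -> T -> R) (h : T -> R) :
  (forall n, measurable_fun setT (f n)) -> (forall n x, 0 <= f n x) ->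
  (forall n, measurable_fun setT (g n)) -> (forall n x, 0 <= g n x) ->
  measurable_fun setT h -> (forall x, 0 <= h x) ->
  (forall n, \int[mu]_x (f n x)%:E < +oo)%E ->
  (forall n, \int[mu]_x (g n x)%:E < +oo)%E ->
  (\int[mu]_x (h x)%:E < +oo)%E ->
  (forall e : R, 0 < e -> \forall n \near \oo,
     (\int[mu]_x `|f n x - g n x - h x|%:E <= e%:E)%E) ->
  forall e : R, 0 < e -> \forall n \near \oo,
    `|fine (\int[mu]_x (f n x)%:E)%E - fine (\int[mu]_x (g n x)%:E)%E -
      fine (\int[mu]_x (h x)%:E)%E| <= e.
Proof.
move=> mf f0 mg g0 mh h0 fi gi hi De e e0.
apply: filterS (De _ e0) => n Dn.
have mD : measurable_fun setT (fun x => `|f n x - g n x - h x|).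
  by apply: measurableT_comp => //; apply: measurable_funB => //;
    exact: measurable_funB.
set D := (\int[mu]_x `|f n x - g n x - h x|%:E)%E in Dn.
have D0 : (0 <= D)%E by apply: integral_EFin_ge0.
have Dfin : D \is a fin_num.
  by rewrite ge0_fin_numE//; apply: le_lt_trans Dn _; rewrite ltry.
have F k : (forall x, 0 <= k x) -> (\int[mu]_x (k x)%:E < +oo)%E ->
    (\int[mu]_x (k x)%:E)%E \is a fin_num.
  by move=> k0 ki; rewrite ge0_fin_numE//; exact: integral_EFin_ge0.
have le1 : (\int[mu]_x (f n x)%:E <=
    \int[mu]_x (g n x)%:E + \int[mu]_x (h x)%:E + D)%E.
  rewrite -integralD_EFin_ge0//= -integralD_EFin_ge0//=; last 2 first.
    exact: measurable_funD.
    by move=> x; rewrite addr_ge0.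
  apply: le_integral_EFin => //.
    by apply: measurable_funD => //; exact: measurable_funD.
  by move=> x; have := ler_norm (f n x - g n x - h x); lra.
have le2 : (\int[mu]_x (g n x)%:E + \int[mu]_x (h x)%:E <=
    \int[mu]_x (f n x)%:E + D)%E.
  rewrite -!integralD_EFin_ge0//=; apply: le_integral_EFin => //.
  - exact: measurable_funD.
  - exact: measurable_funD.
  - by move=> x; rewrite addr_ge0.
  - by move=> x; have := ler_norm (- (f n x - g n x - h x)); rewrite normrN; lra.
move: le1 le2 Dn.
rewrite -(fineK Dfin) -(fineK (F _ (f0 n) (fi n))) -(fineK (F _ (g0 n) (gi n))).
rewrite -(fineK (F _ h0 hi)) -!EFinD !lee_fin /=.
by move=> le1 le2 De'; rewrite ler_norml; apply/andP; split; lra.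
Qed.

(** The defect is the cross term [2 * ((w n x - u x) * u x)], which Young's inequality bounds in the
    form required by [brezis_lieb]. The measure is abstract because the lemma serves twice: for the
    mass, and on the product space for the seminorm. *)
Lemma sqr_splitting (w : nat -> T -> R) (u : T -> R) (m : R) :
  (forall n, measurable_fun setT (w n)) -> measurable_fun setT u ->
  (forall n, \int[mu]_x ((w n x) ^+ 2)%:E <= m%:E)%E ->
  (\int[mu]_x (u x ^+ 2)%:E <= m%:E)%E ->
  (\forall x \ae mu, w ^~ x @ \oo --> u x) ->
  forall e : R, 0 < e -> \forall n \near \oo,
    `|fine (\int[mu]_x (w n x ^+ 2)%:E)%E -
      fine (\int[mu]_x ((w n x - u x) ^+ 2)%:E)%E -
      fine (\int[mu]_x (u x ^+ 2)%:E)%E| <= e.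
Proof.
move=> mw mu_ wm um cv.
have msq (f : T -> R) : measurable_fun setT f ->
  measurable_fun setT (fun x => f x ^+ 2) by exact: measurable_funX.
have mB n : measurable_fun setT (fun x => w n x - u x) by exact: measurable_funB.
have Bm n : (\int[mu]_x ((w n x - u x) ^+ 2)%:E <= (4 * m)%:E)%E.
  apply: (@le_trans _ _ (\int[mu]_x (2 * w n x ^+ 2 + 2 * u x ^+ 2)%:E)%E).
    apply: le_integral_EFin.
    - exact: msq.
    - by apply: measurable_funD; apply: measurable_funM => //; exact: msq.
    - by move=> x; exact: sqr_ge0.
    - by move=> x; have := sqr_ge0 (w n x + u x); lra.
  rewrite integralD_EFin_ge0; last 4 first.
  - by apply: measurable_funM => //; exact: msq.
  - by apply: measurable_funM => //; exact: msq.
  - by move=> x; rewrite mulr_ge0 ?sqr_ge0.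
  - by move=> x; rewrite mulr_ge0 ?sqr_ge0.
  rewrite !integralZ_EFin_ge0//; try exact: msq; try by move=> x; exact: sqr_ge0.
  rewrite (_ : (4 * m)%:E = 2%:E * m%:E + 2%:E * m%:E)%E; last first.
    by rewrite -!EFinM -EFinD; congr EFin; ring.
  by apply: leeD; apply: lee_wpmul2l; rewrite ?lee_fin.
apply: fine_splitting => //.
- by move=> n; exact: msq.
- by move=> n x; exact: sqr_ge0.
- by move=> n; exact: msq.
- by move=> n x; exact: sqr_ge0.
- exact: msq.
- by move=> x; exact: sqr_ge0.
- by move=> n; apply: le_lt_trans (wm n) _; rewrite ltry.
- by move=> n; apply: le_lt_trans (Bm n) _; rewrite ltry.
- by apply: le_lt_trans um _; rewrite ltry.
apply: (@brezis_lieb _ _ _ mu _ (fun n x => (w n x - u x) ^+ 2) (4 * m)) => //.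
- move=> n; apply: measurableT_comp => //; apply: measurable_funB; last exact: msq.
  by apply: measurable_funB; exact: msq.
- by move=> n; exact: msq.
- by move=> n x; exact: sqr_ge0.
- apply: filterS cv => x wx.
  rewrite (_ : (fun n => _) =
      fun n => `|2 * ((w n x - u x) * u x)|); last first.
    by apply/funext => n; congr (`|_|); ring.
  have -> : 0 = `|2 * ((u x - u x) * u x)| by rewrite subrr mul0r mulr0 normr0.
  apply: cvg_norm; apply: cvgM; first exact: cvg_cst.
  apply: cvgM; last exact: cvg_cst.
  by apply: cvgB => //; exact: cvg_cst.
- move=> e e0; exists (fun x => e^-1 * u x ^+ 2); split.
  + by apply: measurable_funM => //; exact: msq.
  + rewrite integralZ_EFin_ge0 ?invr_ge0 ?(ltW e0)//; last 2 first.
      exact: msq.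
      by move=> x; exact: sqr_ge0.
    rewrite lte_mul_pinfty ?lee_fin ?invr_ge0 ?(ltW e0)//.
    by apply: le_lt_trans um _; rewrite ltry.
  + by move=> x; rewrite mulr_ge0 ?sqr_ge0// invr_ge0 ltW.
  + move=> n x.
    rewrite (_ : _ - _ - _ = 2 * ((w n x - u x) * u x)); last by ring.
    set a := w n x - u x; set b := u x.
    have ie : 0 < e^-1 by rewrite invr_gt0.
    have ei : e * e^-1 = 1 by rewrite divff// gt_eqF.
    have := mulr_ge0 (ltW ie) (sqr_ge0 (e * a - b)).
    have := mulr_ge0 (ltW ie) (sqr_ge0 (e * a + b)).
    rewrite (_ : e^-1 * (e * a + b) ^+ 2 =
      (e * e^-1) * e * a ^+ 2 + 2 * (e * e^-1) * (a * b) + e^-1 * b ^+ 2); last by ring.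
    rewrite (_ : e^-1 * (e * a - b) ^+ 2 =
      (e * e^-1) * e * a ^+ 2 - 2 * (e * e^-1) * (a * b) + e^-1 * b ^+ 2); last by ring.
    by rewrite ei !mul1r !mulr1 ler_norml => ? ?; apply/andP; split; lra.
Qed.

End splitting.

(** * The potential term: coercivity, vanishing and splitting *)

Section potential.
Context {R : realType}.
Variables (N : nat) (s : R).
Hypotheses (s0 : 0 < s) (N0 : (0 < N)%N).
Implicit Types (x y a : Rn R N) (u v w : Rn R N -> R) (k h M r lam : R).
Local Notation mu := (@lebesgue_Rn R N).
Variable G : Rn R N -> R -> R.
Hypothesis mG : forall u, measurable_fun setT u ->
  measurable_fun setT (fun x => G x (u x)).
Variables (B gam l : R).
Hypotheses (B0 : 0 < B) (gam0 : 0 < gam) (gl : gam < l) (lc : l < crit N s).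
Hypothesis Gbound : forall x t,
  0 <= G x t <= B * (`|t| ^+ 2 * `|t| `^ gam + `|t| ^+ 2 * `|t| `^ l).

Definition pot u : \bar R := (\int[mu]_x (G x (u x))%:E)%E.

Lemma pot_ge0 u : (0 <= pot u)%E.
Proof. by apply: integral_EFin_ge0 => x; have /andP[] := Gbound x (u x). Qed.

Definition GN_bound M lam (m A : R) r : R :=
  (2 * M) `^ r * (lam `^ r * m + lam `^ (r - crit N s) * GN_const N s * A).

Lemma measurable_pow2 u r : measurable_fun setT u ->
  measurable_fun setT (fun x => `|u x| ^+ 2 * `|u x| `^ r).
Proof.
move=> mu_.
have mau : measurable_fun setT (fun x => `|u x|) by exact: measurableT_comp.
apply: measurable_funM; first exact: measurable_funX.
by apply: (@measurableT_comp _ _ _ _ _ _ (@powR R ^~ r)) => //.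
Qed.

Lemma pow_le u M lam m A r : measurable_fun setT u ->
  (mass u <= m%:E)%E -> (gag s u <= A%:E)%E -> 0 < M ->
  (forall x, \int[mu]_(y in cube x 1) (u y ^+ 2)%:E <= (M ^+ 2)%:E)%E ->
  1 <= lam -> 0 <= r <= crit N s ->
  (\int[mu]_x (`|u x| ^+ 2 * `|u x| `^ r)%:E <= (GN_bound M lam m A r)%:E)%E.
Proof.
move=> mu_ um uA M0 uM l1 rc; have K0 := GN_const_gt0 s N0.
apply: le_trans (GN_le s0 N0 mu_ M0 uM rc l1) _.
rewrite /GN_bound [leRHS]EFinM [X in (_ <= _ * X)%E]EFinD; apply: lee_wpmul2l.
  by rewrite lee_fin powR_ge0.
apply: leeD; rewrite [leRHS]EFinM; apply: lee_wpmul2l => //.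
  by rewrite lee_fin powR_ge0.
by rewrite lee_fin mulr_ge0 ?powR_ge0// ltW.
Qed.

Lemma pot_le_pow u : measurable_fun setT u ->
  (pot u <= B%:E * (\int[mu]_x (`|u x| ^+ 2 * `|u x| `^ gam)%:E +
                    \int[mu]_x (`|u x| ^+ 2 * `|u x| `^ l)%:E))%E.
Proof.
move=> mu_.
have p0 r x : 0 <= `|u x| ^+ 2 * `|u x| `^ r by rewrite mulr_ge0 ?powR_ge0 ?sqr_ge0.
rewrite -integralD_EFin_ge0//; try exact: measurable_pow2.
rewrite -integralZ_EFin_ge0 ?(ltW B0)//; last first.
  by apply: measurable_funD; exact: measurable_pow2.
apply: le_integral_EFin.
- exact: mG.
- apply: measurable_funM => //.
  by apply: measurable_funD; exact: measurable_pow2.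
- by move=> x; have /andP[] := Gbound x (u x).
- by move=> x; have /andP[] := Gbound x (u x).
Qed.

Lemma pot_le u M lam m A : measurable_fun setT u ->
  (mass u <= m%:E)%E -> (gag s u <= A%:E)%E -> 0 < M ->
  (forall x, \int[mu]_(y in cube x 1) (u y ^+ 2)%:E <= (M ^+ 2)%:E)%E ->
  1 <= lam ->
  (pot u <= (B * (GN_bound M lam m A gam + GN_bound M lam m A l))%:E)%E.
Proof.
move=> mu_ um uA M0 uM l1; apply: le_trans (pot_le_pow mu_) _.
rewrite EFinM; apply: lee_wpmul2l; first by rewrite lee_fin ltW.
rewrite EFinD; apply: leeD; apply: pow_le => //.
  by rewrite (ltW gam0) (ltW (lt_trans gl lc)).
by rewrite (ltW (lt_trans gam0 gl)) ltW.
Qed.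

(** With nothing known about single cubes, the total mass serves as the local bound; $|m| + 1$ keeps
    the resulting [M] positive for every [m]. *)
Lemma cube_mass_le u m : measurable_fun setT u -> (mass u <= m%:E)%E ->
  forall x, (\int[mu]_(y in cube x 1) (u y ^+ 2)%:E <=
    (Num.sqrt (`|m| + 1) ^+ 2)%:E)%E.
Proof.
move=> mu_ um x; apply: le_trans (integral_cube_le_mass _ _ mu_) _.
apply: le_trans um _; rewrite lee_fin sqr_sqrtr ?addr_ge0//.
by apply: le_trans (ler_norm m) _; rewrite lerDl.
Qed.

Lemma pow_lty u r : measurable_fun setT u ->
  (mass u < +oo)%E -> (gag s u < +oo)%E -> 0 <= r <= crit N s ->
  (\int[mu]_x (`|u x| ^+ 2 * `|u x| `^ r)%:E < +oo)%E.
Proof.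
move=> mu_ um uA rc.
have um' : (mass u <= (fine (mass u))%:E)%E.
  by rewrite fineK// ge0_fin_numE// mass_ge0.
have uA' : (gag s u <= (fine (gag s u))%:E)%E.
  by rewrite fineK// ge0_fin_numE// gag_ge0.
have M0 : 0 < Num.sqrt (`|fine (mass u)| + 1) by rewrite sqrtr_gt0 ltr_wpDl.
apply: le_lt_trans (pow_le mu_ um' uA' M0 (cube_mass_le mu_ um') (lexx 1) rc) _.
by rewrite ltry.
Qed.

Lemma pot_lty u : measurable_fun setT u ->
  (mass u < +oo)%E -> (gag s u < +oo)%E -> (pot u < +oo)%E.
Proof.
move=> mu_ um uA; apply: le_lt_trans (pot_le_pow mu_) _.
rewrite lte_mul_pinfty ?lee_fin ?(ltW B0)// lte_add_pinfty// pow_lty//.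
  by rewrite (ltW gam0) (ltW (lt_trans gl lc)).
by rewrite (ltW (lt_trans gam0 gl)) ltW.
Qed.

Lemma powR_neg_small (e eta : R) : e < 0 -> 0 < eta ->
  exists2 lam : R, 1 <= lam & forall lam', lam <= lam' -> lam' `^ e <= eta.
Proof.
move=> e0 eta0; pose t := eta `^ e^-1.
exists (Num.max 1 t); first by rewrite le_max lexx.
move=> lam' lamlam'.
have t0 : 0 < t by rewrite powR_gt0.
have tlam : t <= lam' by apply: le_trans lamlam'; rewrite le_max lexx orbT.
apply: (@le_trans _ _ (t `^ e)); first by apply: le_powR_neg => //; exact: ltW.
by rewrite -powRrM mulVf ?lt_eqF// powRr1// ltW.
Qed.

(** Both growth exponents are below [crit], so a large cut-off level brings the seminorm coefficient
    of each of the two terms below [eta / 2]. What remains depends on the mass bound only. *)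
Lemma pot_coercive (m eta : R) : 0 < eta -> exists2 K : R, 0 <= K &
  forall u A, measurable_fun setT u -> (mass u <= m%:E)%E ->
    (gag s u <= A%:E)%E -> (pot u <= (eta * A + K)%:E)%E.
Proof.
move=> eta0; set M := Num.sqrt (`|m| + 1).
have M0 : 0 < M by rewrite sqrtr_gt0 ltr_wpDl.
have M20 : 0 < 2 * M by rewrite mulr_gt0.
have K0 := GN_const_gt0 s N0.
have small r : r < crit N s -> exists2 lam : R, 1 <= lam & forall lam',
    lam <= lam' -> B * ((2 * M) `^ r * (lam' `^ (r - crit N s) * GN_const N s)) <= eta / 2.
  move=> rc; have D0 : 0 < B * (2 * M) `^ r * GN_const N s.
    by apply: mulr_gt0 => //; apply: mulr_gt0 => //; exact: powR_gt0.
  have e0 : 0 < eta / 2 / (B * (2 * M) `^ r * GN_const N s).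
    by apply: divr_gt0 => //; exact: divr_gt0.
  have rc' : r - crit N s < 0 by rewrite subr_lt0.
  have [lam l1 ll] := powR_neg_small rc' e0; exists lam => // lam' /ll.
  rewrite ler_pdivlMr// => le1; apply: le_trans le1.
  by rewrite le_eqVlt; apply/orP; left; apply/eqP; ring.
have [lam1 l11 ll1] := small _ (lt_trans gl lc).
have [lam2 l21 ll2] := small _ lc.
pose lam := Num.max lam1 lam2.
have l1 : 1 <= lam by rewrite le_max l11.
exists (B * ((2 * M) `^ gam * (lam `^ gam * `|m|) + (2 * M) `^ l * (lam `^ l * `|m|))).
  by rewrite mulr_ge0 ?(ltW B0)// addr_ge0 ?mulr_ge0 ?powR_ge0.
move=> u A mu_ um uA.
have A0 : 0 <= A by rewrite -lee_fin; apply: le_trans (gag_ge0 _ _) uA.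
have um' : (mass u <= `|m|%:E)%E.
  by apply: le_trans um _; rewrite lee_fin ler_norm.
apply: le_trans (pot_le mu_ um' uA M0 (cube_mass_le mu_ um) l1) _.
rewrite lee_fin /GN_bound.
have := ler_wpM2r A0 (ll1 lam _); rewrite le_max lexx => /(_ isT).
have := ler_wpM2r A0 (ll2 lam _); rewrite le_max lexx orbT => /(_ isT).
set a := (2 * M) `^ gam; set b := (2 * M) `^ l.
set a1 := lam `^ gam; set b1 := lam `^ l; set K := GN_const N s.
set b2 := lam `^ _; set a2 := lam `^ _ => le1 le2.
rewrite (_ : B * _ = B * (b * (b2 * K)) * A + B * (a * (a2 * K)) * A +
  B * (a * (a1 * `|m|) + b * (b1 * `|m|))); last by ring.
by rewrite lerD2r; lra.
Qed.

(** Lions' vanishing lemma in quantitative form. At cut-off level 1 the bracket of [GN_le] is at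
    most the fixed number [Q], and [2 * M <= 1] lets the power with exponent [gam] dominate the one
    with exponent [l]; [t] is the value at which it is small enough. *)
Lemma pot_vanishing (m A e : R) : 0 <= m -> 0 <= A -> 0 < e ->
  exists2 M : R, 0 < M & forall u, measurable_fun setT u ->
    (mass u <= m%:E)%E -> (gag s u <= A%:E)%E ->
    (forall x, \int[mu]_(y in cube x 1) (u y ^+ 2)%:E <= (M ^+ 2)%:E)%E ->
    (pot u <= e%:E)%E.
Proof.
move=> m0 A0 e0; have K0 := GN_const_gt0 s N0.
set Q := m + GN_const N s * A.
have Q0 : 0 <= Q by rewrite addr_ge0// mulr_ge0// ltW.
have Q1 : 0 < 2 * B * (Q + 1) by rewrite !mulr_gt0// ltr_wpDl.
pose t := (e / (2 * B * (Q + 1))) `^ gam^-1.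
have t0 : 0 < t by rewrite powR_gt0// divr_gt0.
pose M := Num.min 1 t / 2.
have M0 : 0 < M by rewrite divr_gt0// lt_min ltr01 t0.
exists M => // u mu_ um uA uM.
apply: le_trans (pot_le mu_ um uA M0 uM (lexx 1)) _.
have M2 : 2 * M = Num.min 1 t by rewrite /M; field.
have M21 : 0 < 2 * M <= 1 by rewrite mulr_gt0//= M2 ge_min lexx.
have ple : (2 * M) `^ l <= (2 * M) `^ gam by rewrite ger_powR// ltW.
have pgam : (2 * M) `^ gam <= e / (2 * B * (Q + 1)).
  apply: (@le_trans _ _ (t `^ gam)).
    rewrite ge0_ler_powR ?nnegrE ?(ltW gam0) ?(ltW t0)//.
      by have /andP[/ltW] := M21.
    by rewrite M2 ge_min lexx orbT.
  by rewrite -powRrM mulVf ?gt_eqF// powRr1// ltW// divr_gt0.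
rewrite lee_fin /GN_bound !powR1 !mul1r -/Q.
apply: (@le_trans _ _ (B * (2 * ((2 * M) `^ gam * Q)))).
  rewrite ler_pM2l//; have := ler_wpM2r Q0 ple; lra.
apply: (@le_trans _ _ ((2 * M) `^ gam * (2 * B * (Q + 1)))); last first.
  by rewrite -ler_pdivlMr.
rewrite [leLHS](_ : _ = (2 * M) `^ gam * (2 * B * Q)); last by ring.
by rewrite ler_wpM2l ?powR_ge0// ler_wpM2l ?mulr_ge0 ?(ltW B0)// lerDl.
Qed.

Variable Bp : R.
Hypothesis Bp0 : 0 < Bp.
Hypothesis Gincr : forall x (a b : R), `|G x (a + b) - G x a| <=
  Bp * `|b| * ((`|a| + `|b|) `^ (gam + 1) + (`|a| + `|b|) `^ (l + 1)).

(** Either [b <= eta * a], and the product is a small multiple of the power of [a], or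
    [a < b / eta], and it is a large multiple of the power of [b]. *)
Lemma incr_pow (p a b eta : R) : 0 < p -> 0 <= a -> 0 <= b -> 0 < eta ->
  b * (a + b) `^ (p + 1) <=
  eta * (1 + eta) `^ (p + 1) * (a ^+ 2 * a `^ p) +
  (eta^-1 + 1) `^ (p + 1) * (b ^+ 2 * b `^ p).
Proof.
move=> p0 a0 b0 eta0.
have p1 : 0 <= p + 1 by rewrite addr_ge0// ltW.
have sq t : 0 <= t -> t ^+ 2 * t `^ p = t * t `^ (p + 1).
  move=> t0; have [->|t1] := eqVneq t 0; first by rewrite expr0n mul0r mul0r.
  by rewrite powRD ?t1 ?implybT// powRr1// mulrA mulrAC.
rewrite !sq//.
have t1 : 0 <= eta * (1 + eta) `^ (p + 1) * (a * a `^ (p + 1)).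
  by rewrite !mulr_ge0 ?powR_ge0// ltW.
have t2 : 0 <= (eta^-1 + 1) `^ (p + 1) * (b * b `^ (p + 1)).
  by rewrite !mulr_ge0 ?powR_ge0.
have e1 : 0 <= 1 + eta by rewrite addr_ge0// ltW.
have e2 : 0 <= eta^-1 + 1 by rewrite addr_ge0// invr_ge0 ltW.
have [ba|ba] := leP b (eta * a).
  rewrite -[leLHS]addr0 lerD//.
  have -> : eta * (1 + eta) `^ (p + 1) * (a * a `^ (p + 1)) =
     eta * a * ((1 + eta) * a) `^ (p + 1) by rewrite powRM//; ring.
  rewrite ler_pM// ?powR_ge0//; apply: ge0_ler_powR => //.
  - by rewrite nnegrE addr_ge0.
  - by rewrite nnegrE mulr_ge0.
  - by rewrite mulrDl mul1r lerD2l.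
rewrite -[leLHS]add0r lerD//.
have -> : (eta^-1 + 1) `^ (p + 1) * (b * b `^ (p + 1)) =
   b * ((eta^-1 + 1) * b) `^ (p + 1) by rewrite powRM//; ring.
apply: ler_wpM2l => //; apply: ge0_ler_powR => //.
- by rewrite nnegrE addr_ge0.
- by rewrite nnegrE mulr_ge0.
- by rewrite mulrDl mul1r lerD2r mulrC ler_pdivlMr// mulrC ltW.
Qed.

Lemma G0 x : G x 0 = 0.
Proof.
have := Gbound x 0; rewrite normr0 expr0n/= !mul0r addr0 mulr0 => /andP[h1 h2].
by apply/eqP; rewrite eq_le h1 h2.
Qed.

Lemma eta_pick (e p : R) : 0 < e -> 0 <= p ->
  exists2 eta : R, 0 < eta <= 1 & eta * (1 + eta) `^ p <= e.
Proof.
move=> e0 p0; exists (Num.min 1 (e / 2 `^ p)).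
  by rewrite ge_min lexx lt_min ltr01 divr_gt0 ?powR_gt0.
apply: (@le_trans _ _ ((e / 2 `^ p) * 2 `^ p)); last first.
  by rewrite divfK// gt_eqF ?powR_gt0.
rewrite ler_pM ?powR_ge0//.
- by rewrite le_min ler01 divr_ge0 ?powR_ge0// ltW.
- by rewrite ge_min lexx orbT.
- rewrite ge0_ler_powR ?nnegrE ?addr_ge0 ?le_min ?ler01 ?divr_ge0 ?powR_ge0 ?(ltW e0)//.
  by rewrite (_ : 2 = 1 + 1 :> R)// lerD2l ge_min lexx.
Qed.

Hypothesis Gcont : forall x, continuous (G x).

(** The domination asked by [brezis_lieb], to be used with a = w_n - u and b = u: the part in [a]
    has a small factor, the part in [b] is fixed. Since [1 + eta] and [eta^-1 + 1] are at least 1,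
    their powers of order [l + 1] bound those of order [gam + 1]. *)
Lemma increment_bound (e : R) : 0 < e -> exists2 K : R, 0 <= K &
  forall x (a b : R), `|G x (a + b) - G x a - G x b| <=
    e * (`|a| ^+ 2 * `|a| `^ gam + `|a| ^+ 2 * `|a| `^ l) +
    K * (`|b| ^+ 2 * `|b| `^ gam + `|b| ^+ 2 * `|b| `^ l).
Proof.
move=> e0; have l0 : 0 < l := lt_trans gam0 gl.
have l1 : 0 <= l + 1 by rewrite addr_ge0// ltW.
have [eta /andP[eta0 eta1] etae] := eta_pick (divr_gt0 e0 Bp0) l1.
have ie : 0 <= eta^-1 + 1 by rewrite addr_ge0// invr_ge0 ltW.
have ie1 : 1 <= eta^-1 + 1 by rewrite lerDr invr_ge0 ltW.
have e1 : 1 <= 1 + eta by rewrite lerDl ltW.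
exists (Bp * (eta^-1 + 1) `^ (l + 1) + B).
  by rewrite addr_ge0 ?(ltW B0)// mulr_ge0 ?powR_ge0// ltW.
move=> x a b.
have p0 r (t : R) : 0 <= `|t| ^+ 2 * `|t| `^ r.
  by rewrite mulr_ge0 ?powR_ge0 ?sqr_ge0.
have i1 := incr_pow gam0 (normr_ge0 a) (normr_ge0 b) eta0.
have i2 := incr_pow l0 (normr_ge0 a) (normr_ge0 b) eta0.
have /andP[Gb0 Gb] := Gbound x b.
have le_gl t : 1 <= t -> t `^ (gam + 1) <= t `^ (l + 1).
  by move=> t1; rewrite ler_powR// lerD2r ltW.
have ea r : r = gam \/ r = l ->
    Bp * (eta * (1 + eta) `^ (r + 1) * (`|a| ^+ 2 * `|a| `^ r)) <=
    e * (`|a| ^+ 2 * `|a| `^ r).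
  move=> rgl; rewrite mulrA ler_wpM2r// mulrC -ler_pdivlMr//.
  apply: le_trans etae; rewrite ler_wpM2l ?(ltW eta0)//.
  by case: rgl => ->//; exact: le_gl.
have eb r : r = gam \/ r = l ->
    Bp * ((eta^-1 + 1) `^ (r + 1) * (`|b| ^+ 2 * `|b| `^ r)) <=
    Bp * (eta^-1 + 1) `^ (l + 1) * (`|b| ^+ 2 * `|b| `^ r).
  move=> rgl; rewrite mulrA ler_wpM2r// ler_wpM2l ?(ltW Bp0)//.
  by case: rgl => ->//; exact: le_gl.
apply: le_trans (ler_normB _ _) _; rewrite (ger0_norm Gb0).
have i3 := Gincr x a b.
have := ler_wpM2l (ltW Bp0) (lerD i1 i2).
have := ea _ (or_introl erefl); have := ea _ (or_intror erefl).
have := eb _ (or_introl erefl); have := eb _ (or_intror erefl).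
rewrite -mulrA mulrDr in i3.
move: i3 Gb.
rewrite !(mulrDr Bp) !(mulrDr B) !(mulrDr e) !mulrDl !(mulrDr (_ * _)) !(mulrDr B).
lra.
Qed.

Lemma pot_splitting (w : nat -> Rn R N -> R) u (m A : R) :
  (forall n, measurable_fun setT (w n)) -> measurable_fun setT u ->
  (forall n, mass (w n) <= m%:E)%E -> (mass u <= m%:E)%E ->
  (forall n, gag s (w n) <= A%:E)%E -> (gag s u <= A%:E)%E ->
  (\forall x \ae mu, w ^~ x @ \oo --> u x) ->
  forall e : R, 0 < e -> \forall n \near \oo,
    `|fine (pot (w n)) - fine (pot (fun x => w n x - u x)) - fine (pot u)| <= e.
Proof.
move=> mw mu_ wm um wA uA cv.
have mv n : measurable_fun setT (fun x => w n x - u x) by exact: measurable_funB.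
have four (t : R) : ((4 * t)%:E = 2%:E * t%:E + 2%:E * t%:E)%E.
  by rewrite -!EFinM -EFinD; congr EFin; ring.
have vm n : (mass (fun x => w n x - u x)%R <= (4 * m)%:E)%E.
  apply: le_trans (massB_le _ _) _ => //.
  by rewrite four; apply: leeD; apply: lee_wpmul2l; rewrite ?lee_fin.
have vA n : (gag s (fun x => w n x - u x)%R <= (4 * A)%:E)%E.
  apply: le_trans (gagB_le _ _ _) _ => //.
  by rewrite four; apply: leeD; apply: lee_wpmul2l; rewrite ?lee_fin.
have lt_lty (t : \bar R) (r : R) : (t <= r%:E -> t < +oo)%E.
  by move=> tr; apply: le_lt_trans tr _; rewrite ltry.
have rg : 0 <= gam <= crit N s by rewrite (ltW gam0) (ltW (lt_trans gl lc)).
have rl : 0 <= l <= crit N s by rewrite (ltW (lt_trans gam0 gl)) ltW.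
have G_ge0 x t : 0 <= G x t by have /andP[] := Gbound x t.
apply: fine_splitting => //.
- by move=> n; exact: mG.
- by move=> n; exact: mG.
- exact: mG.
- by move=> n; apply: pot_lty => //; apply: lt_lty.
- by move=> n; apply: pot_lty => //; [exact: lt_lty (vm n)|exact: lt_lty (vA n)].
- by apply: pot_lty => //; [exact: lt_lty um|exact: lt_lty uA].
have mp (f : Rn R N -> R) : measurable_fun setT f -> measurable_fun setT
    (fun x => `|f x| ^+ 2 * `|f x| `^ gam + `|f x| ^+ 2 * `|f x| `^ l).
  by move=> mf; apply: measurable_funD; exact: measurable_pow2.
have p0 (t : R) : 0 <= `|t| ^+ 2 * `|t| `^ gam + `|t| ^+ 2 * `|t| `^ l.
  by rewrite addr_ge0 ?mulr_ge0 ?powR_ge0 ?sqr_ge0.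
have M0 : 0 < Num.sqrt (`|4 * m| + 1) by rewrite sqrtr_gt0 ltr_wpDl.
set M := Num.sqrt _ in M0.
(* The dominating functions are the growth functions of the remainders, whose mass and seminorm are
   at most [4 * m] and [4 * A]; Gagliardo-Nirenberg at cut-off level 1 bounds their integrals
   uniformly. *)
apply: (@brezis_lieb _ _ _ mu _ (fun n x =>
    `|w n x - u x| ^+ 2 * `|w n x - u x| `^ gam +
    `|w n x - u x| ^+ 2 * `|w n x - u x| `^ l)
    (GN_bound M 1 (4 * m) (4 * A) gam + GN_bound M 1 (4 * m) (4 * A) l)) => //.
- move=> n; apply: measurableT_comp => //; apply: measurable_funB; last exact: mG.
  by apply: measurable_funB; exact: mG.
- by move=> n; exact: mp.
- move=> n; rewrite integralD_EFin_ge0; [|exact: measurable_pow2..| |];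
    try by move=> x; rewrite mulr_ge0 ?powR_ge0 ?sqr_ge0.
  rewrite EFinD; apply: leeD; apply: pow_le => //; exact: cube_mass_le.
- apply: filterS cv => x wx.
  have -> : 0 = `|G x (u x) - G x (u x - u x) - G x (u x)|.
    by rewrite subrr G0 subr0 subrr normr0.
  apply: cvg_norm; apply: cvgB; last exact: cvg_cst.
  apply: cvgB; first by apply: continuous_cvg => //; exact: Gcont.
  apply: continuous_cvg; first exact: Gcont.
  by apply: cvgB => //; exact: cvg_cst.
- move=> e e0; have [K K0 KP] := increment_bound e0.
  exists (fun x => K * (`|u x| ^+ 2 * `|u x| `^ gam + `|u x| ^+ 2 * `|u x| `^ l)).
  split.
  + by apply: measurable_funM => //; exact: mp.
  + rewrite integralZ_EFin_ge0//; last exact: mp.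
    rewrite lte_mul_pinfty ?lee_fin//.
    rewrite integralD_EFin_ge0; [|exact: measurable_pow2..| |];
      try by move=> x; rewrite mulr_ge0 ?powR_ge0 ?sqr_ge0.
    by apply: lte_add_pinfty; apply: pow_lty => //;
      [exact: lt_lty um|exact: lt_lty uA|exact: lt_lty um|exact: lt_lty uA].
  + by move=> x; rewrite mulr_ge0.
  + by move=> n x; have := KP x (w n x - u x) (u x); rewrite subrK.
Qed.

End potential.

(** * Negativity of the infimum *)

Section test_function.
Context {R : realType}.
Variables (N : nat) (s : R).
Hypotheses (s0 : 0 < s) (s1 : s < 1) (N0 : (0 < N)%N).
Implicit Types (x y a : Rn R N) (u v w : Rn R N -> R).
Local Notation mu := (@lebesgue_Rn R N).
Local Notation e := (N%:R + 2 * s).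

Lemma nneseries_geometric_le (A q : R) : 0 <= A -> 0 <= q < 1 ->
  (\sum_(n <oo) (A * q ^+ n)%:E <= (A / (1 - q))%:E)%E.
Proof.
move=> A0 /andP[q0 q1]; apply: lime_le.
  by apply: is_cvg_nneseries => n _ _; rewrite lee_fin mulr_ge0 ?exprn_ge0.
have q1' : 0 < 1 - q by rewrite subr_gt0.
apply: nearW => n; rewrite sumEFin lee_fin.
have := @geometric_seriesE R A q; rewrite lt_eqF// => /(_ isT).
move=> /(congr1 (fun f => f n)); rewrite /series/= => ->.
rewrite ler_pM2r ?invr_gt0// ler_piMr// lerBlDr lerDl exprn_ge0//.
Qed.

(* [ker rho x y] dominates the difference quotient of a function of size 1 that
   is Lipschitz at scale [rho] *)
Definition ker (rho : R) x y : R :=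
  Num.min 1 (N%:R ^+ 2 * edist x y ^+ 2 / rho ^+ 2) / edist x y `^ e.

Lemma ker_ge0 rho x y : 0 <= ker rho x y.
Proof.
by rewrite /ker mulr_ge0 ?invr_ge0 ?powR_ge0// le_min ler01 mulr_ge0 ?invr_ge0
  ?sqr_ge0// mulr_ge0 ?sqr_ge0.
Qed.

Lemma kerC rho x y : ker rho x y = ker rho y x.
Proof. by rewrite /ker edistC. Qed.

Lemma measurable_ker rho :
  measurable_fun setT (fun z : Rn R N * Rn R N => ker rho z.1 z.2).
Proof.
apply: measurable_funM.
  apply: measurable_minr => //; apply: measurable_funM => //.
  apply: measurable_funM => //; apply: measurable_funX; exact: measurable_edist.
rewrite (_ : (fun _ => _) = fun z : Rn R N * Rn R N => edist z.1 z.2 `^ (- e)).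
  apply: (@measurableT_comp _ _ _ _ _ _ (fun t : R => t `^ (- e))).
    exact: measurable_powR.
  exact: measurable_edist.
by apply/funext => z; rewrite powRN.
Qed.

(** Bounds for [ker] on dyadic shells. Outside the cube of radius [rho], the minimum is at most 1
    and the distance at least $2^n\rho$. Inside, the distance lies between $\rho/2^{n+1}$ and
    $2\sqrt N\rho/2^n$, and the Lipschitz bound yields $4N^3/4^n$. In [shells] whole cubes replace
    the shells, which costs only constants. *)
Definition ca (rho : R) n : R := (rho * 2 ^+ n) `^ (- e).
Definition cb (rho : R) n : R :=
  4 * N%:R ^+ 3 / 4 ^+ n * (rho / 2 ^+ n.+1) `^ (- e).

Definition shells (rho : R) x n y : R :=
  ca rho n * \1_(cube x (rho * 2 ^+ n.+1)) y +
  cb rho n * \1_(cube x (rho / 2 ^+ n)) y.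

Lemma ca_ge0 rho n : 0 <= ca rho n. Proof. exact: powR_ge0. Qed.

Lemma cb_ge0 rho n : 0 <= cb rho n.
Proof.
by rewrite /cb mulr_ge0 ?powR_ge0// mulr_ge0 ?invr_ge0 ?exprn_ge0.
Qed.

Lemma shells_ge0 rho x n y : 0 <= shells rho x n y.
Proof.
apply: addr_ge0; apply: mulr_ge0 => //; first exact: ca_ge0.
exact: cb_ge0.
Qed.

Lemma pow2_unbounded (t : R) : exists n : nat, t <= 2 ^+ n.
Proof.
have [n tn] := exists_nat_ge t; exists n; apply: le_trans tn _.
by rewrite -natrX ler_nat ltnW// ltn_expl.
Qed.

Lemma ker_le_shell rho x y : 0 < rho -> exists n, ker rho x y <= shells rho x n y.
Proof.
move=> rho0.
have e0 : 0 < e by rewrite ltr_wpDl// mulr_gt0.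
have [->|xy] := eqVneq y x.
  exists 0%N; apply: le_trans (shells_ge0 _ _ _ _).
  by rewrite /ker edistxx expr0n/= mulr0 mul0r minEle ler10 mul0r.
have d0 : 0 < edist x y.
  rewrite lt_neqAle edist_ge0 andbT eq_sym; apply/eqP => /edist_eq0 /esym/eqP.
  by rewrite (negbTE xy).
have [ynear|yfar] := pselect (cube x rho y).
- have ex : exists n, `[< ~ cube x (rho / 2 ^+ n) y >].
    have [i yi] : exists i, tnth y i != tnth x i.
      apply/existsP; apply: contra_neqT xy; rewrite negb_exists => /forallP h.
      by apply: eq_from_tnth => i; apply/eqP; rewrite -[_ == _]negbK; exact: h.
    have di : 0 < `|tnth y i - tnth x i| by rewrite normr_gt0 subr_eq0.
    have [n nP] := pow2_unbounded (2 * rho / `|tnth y i - tnth x i|).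
    exists n; apply/asboolP => /(_ i); apply/negP; rewrite -ltNge.
    rewrite ltr_pdivrMr ?exprn_gt0// mulrC.
    rewrite ler_pdivrMr// in nP.
    by apply: lt_le_trans nP; rewrite mulr_natl mulr2n ltrDl.
  (* The first of the shrinking cubes that misses [y] has index [m.+1]; index 0 is excluded because
     [y] lies in the cube of radius [rho]. *)
  case: (ex_minnP ex) => -[/asboolP|m] /=; first by rewrite expr0 divr1.
  move=> /asboolP ym1 mmin; exists m.
  have ym : cube x (rho / 2 ^+ m) y.
    by apply: contrapT => /asboolP/mmin; rewrite ltnn.
  have dlo : rho / 2 ^+ m.+1 <= edist x y by exact: le_edist.
  have r0 : 0 < rho / 2 ^+ m by rewrite divr_gt0 ?exprn_gt0.
  have r1 : 0 < rho / 2 ^+ m.+1 by rewrite divr_gt0 ?exprn_gt0.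
  have dhi := edist_cube (cube_refl x (ltW r0)) ym.
  rewrite /shells; apply: (@le_trans _ _ (cb rho m)); last first.
    rewrite [X in _ + _ * X]indicE mem_set// mulr1 lerDr.
    by rewrite mulr_ge0 ?ca_ge0.
  rewrite /ker /cb powRN ler_pM ?invr_ge0 ?powR_ge0//.
  + by rewrite le_min ler01 mulr_ge0 ?invr_ge0 ?sqr_ge0// mulr_ge0 ?sqr_ge0.
  + rewrite ge_min; apply/orP; right.
    apply: (@le_trans _ _ (N%:R ^+ 2 *
      (2 * (rho / 2 ^+ m) * Num.sqrt N%:R) ^+ 2 / rho ^+ 2)).
      rewrite ler_wpM2r ?invr_ge0 ?sqr_ge0// ler_wpM2l ?sqr_ge0//.
      by rewrite ler_sqr ?nnegrE ?edist_ge0//; apply: le_trans dhi; exact: edist_ge0.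
    rewrite !exprMn sqr_sqrtr// (_ : 4 ^+ m = (2 ^+ m) ^+ 2); last first.
      by rewrite exprAC (_ : 2 ^+ 2 = 4)//; ring.
    rewrite le_eqVlt; apply/orP; left; apply/eqP; field.
    by rewrite expf_neq0//= gt_eqF.
  + rewrite lef_pV2 ?posrE ?powR_gt0//.
    by rewrite ge0_ler_powR ?nnegrE ?(ltW e0) ?(ltW r1) ?(ltW d0).
- have ex : exists n, `[< cube x (rho * 2 ^+ n) y >].
    have [n nP] := pow2_unbounded ((\sum_(i < N) `|tnth y i - tnth x i|) / rho).
    exists n; apply/asboolP => i; rewrite ler_pdivrMr// mulrC in nP.
    apply: le_trans nP; rewrite (bigD1 i)//= lerDl sumr_ge0//.
  (* Here [m.+1] is the index of the first growing cube that contains [y]. *)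
  case: (ex_minnP ex) => -[/asboolP|m] /=; first by rewrite expr0 mulr1.
  move=> /asboolP ym1 mmin; exists m.
  have ym : ~ cube x (rho * 2 ^+ m) y.
    by move=> /asboolP/mmin; rewrite ltnn.
  have dlo : rho * 2 ^+ m <= edist x y by exact: le_edist.
  have r0 : 0 < rho * 2 ^+ m by rewrite mulr_gt0 ?exprn_gt0.
  rewrite /shells; apply: (@le_trans _ _ (ca rho m)); last first.
    rewrite [X in _ * X + _]indicE mem_set// mulr1 lerDl.
    by rewrite mulr_ge0 ?cb_ge0.
  rewrite /ker /ca powRN -[leRHS]mul1r ler_pM ?invr_ge0 ?powR_ge0//.
  + by rewrite le_min ler01 mulr_ge0 ?invr_ge0 ?sqr_ge0// mulr_ge0 ?sqr_ge0.
  + by rewrite ge_min lexx.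
  + rewrite lef_pV2 ?posrE ?powR_gt0//.
    by rewrite ge0_ler_powR ?nnegrE ?(ltW e0) ?(ltW r0) ?(ltW d0).
Qed.

(** Ratios of the two geometric series of shell integrals. The outer one converges because [0 < s],
    the inner one because [s < 1], thanks to the factor $4^{-n}$ from the Lipschitz bound. *)
Definition qa : R := 2 `^ (- (2 * s)).
Definition qb : R := 2 `^ (2 * s - 2).
Definition Cb : R := 4 * N%:R ^+ 3 * 2 ^+ N * 2 `^ e.

Definition ker_const : R := 4 ^+ N / (1 - qa) + Cb / (1 - qb).

Lemma qa01 : 0 <= qa < 1.
Proof.
by rewrite powR_ge0/= powR_lt1 ?ltr1n// oppr_lt0 mulr_gt0.
Qed.

Lemma qb01 : 0 <= qb < 1.
Proof.
by rewrite powR_ge0/= powR_lt1 ?ltr1n// subr_lt0 -[ltRHS]mulr1 ltr_pM2l.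
Qed.

Lemma ker_const_gt0 : 0 < ker_const.
Proof.
have /andP[_ a1] := qa01; have /andP[_ b1] := qb01.
rewrite ltr_wpDr//.
  rewrite divr_ge0 ?subr_ge0 ?(ltW b1)// /Cb !mulr_ge0 ?powR_ge0 ?exprn_ge0//.
by rewrite divr_gt0 ?subr_gt0// exprn_gt0.
Qed.

Lemma integral_shells rho x n : 0 < rho ->
  (\int[mu]_y (shells rho x n y)%:E =
   (rho `^ (- (2 * s)) * 4 ^+ N * qa ^+ n)%:E +
   (rho `^ (- (2 * s)) * Cb * qb ^+ n)%:E)%E.
Proof.
move=> rho0.
have m1 A : measurable A -> measurable_fun setT (\1_A : Rn R N -> R).
  by move=> mA; exact: measurable_indic.
rewrite integralD_EFin_ge0; last 4 first.
- by apply: measurable_funM => //; apply: m1; exact: measurable_cube.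
- by apply: measurable_funM => //; apply: m1; exact: measurable_cube.
- by move=> y; rewrite mulr_ge0 ?ca_ge0.
- by move=> y; rewrite mulr_ge0 ?cb_ge0.
rewrite !integralZ_EFin_ge0 ?ca_ge0 ?cb_ge0//; last 2 first.
  by apply: m1; exact: measurable_cube.
  by apply: m1; exact: measurable_cube.
rewrite !integral_indic//; [|exact: measurable_cube..].
have r1 : 0 <= rho / 2 ^+ n by rewrite divr_ge0 ?exprn_ge0// ltW.
have r2 : 0 <= rho * 2 ^+ n.+1 by rewrite mulr_ge0 ?exprn_ge0// ltW.
rewrite !setIT [X in (_ * X + _)%E](lebesgue_cube x r2).
rewrite [X in (_ + _ * X)%E](lebesgue_cube x r1).
have rN (r : R) : 0 < r -> r `^ (- e) * r ^+ N = r `^ (- (2 * s)).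
  move=> r0; rewrite -powR_mulrn ?(ltW r0)// -powRD; last first.
    by rewrite (gt_eqF r0) implybT.
  by congr (_ `^ _); ring.
have n0 : 0 < 2 ^+ n :> R by rewrite exprn_gt0.
rewrite -!EFinM; congr (_%:E + _%:E)%E.
- rewrite /ca exprS (_ : 2 * (rho * (2 * 2 ^+ n)) = 4 * (rho * 2 ^+ n)); last by ring.
  rewrite exprMn mulrCA rN ?mulr_gt0// powRM ?(ltW rho0) ?(ltW n0)//.
  by rewrite powR_exprn// /qa; ring.
- have r0 : 0 < rho / 2 ^+ n by rewrite divr_gt0.
  rewrite /cb (exprS 2 n) (_ : rho / (2 * 2 ^+ n) = rho / 2 ^+ n * 2^-1); last first.
    by field; rewrite expf_neq0.
  rewrite powRM ?(ltW r0) ?invr_ge0// exprMn.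
  have -> : 2^-1 `^ (- e) = 2 `^ e :> R by rewrite -powR_inv1// -powRrM mulN1r opprK.
  rewrite [LHS](_ : _ = 4 * N%:R ^+ 3 * 2 ^+ N * 2 `^ e / 4 ^+ n *
    ((rho / 2 ^+ n) `^ (- e) * (rho / 2 ^+ n) ^+ N)); last by ring.
  rewrite rN// powRM ?(ltW rho0) ?invr_ge0 ?(ltW n0)//.
  have -> : (2 ^+ n)^-1 `^ (- (2 * s)) = (2 `^ (2 * s)) ^+ n :> R.
    rewrite -powR_exprn// -powR_inv1 ?(ltW n0)// -powRrM.
    by congr (_ `^ _); ring.
  have -> : qb = 2 `^ (2 * s) / 4.
    rewrite /qb powRD ?pnatr_eq0 ?implybT// powRN; congr (_ / _).
    by rewrite powR_mulrn//; ring.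
  by rewrite exprMn exprVn /Cb; ring.
Qed.

Lemma ker_integral_le rho x : 0 < rho ->
  (\int[mu]_y (ker rho x y)%:E <= (ker_const * rho `^ (- (2 * s)))%:E)%E.
Proof.
move=> rho0.
have msh n : measurable_fun setT (shells rho x n).
  by apply: measurable_funD; apply: measurable_funM => //;
    apply: measurable_indic; exact: measurable_cube.
have mk : measurable_fun setT (ker rho x).
  rewrite (_ : ker rho x = (fun z => ker rho z.1 z.2) \o pair x)//.
  by apply: measurableT_comp; first exact: measurable_ker.
pose h n : Rn R N -> \bar R := EFin \o shells rho x n.
have h0 n y : (0 <= h n y)%E by rewrite lee_fin shells_ge0.
have mh n : measurable_fun setT (h n) by exact/measurable_EFinP.
have msum : measurable_fun setT (fun y => \sum_(n <oo) h n y)%E.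
  by apply: (@ge0_emeasurable_sum _ _ _ _ h xpredT).
apply: (@le_trans _ _ (\int[mu]_y (\sum_(n <oo) h n y))%E).
  apply: ge0_le_integral => //.
  - by move=> y _; rewrite lee_fin ker_ge0.
  - exact/measurable_EFinP.
  - move=> y _; have [n kn] := ker_le_shell x y rho0.
    apply: le_trans (nneseries_lim_ge n.+1 _) => //=.
    rewrite big_nat_recr//= -[leLHS]add0e leeD ?lee_fin//.
    by apply: sume_ge0.
rewrite integral_nneseries//.
have rp : 0 <= rho `^ (- (2 * s)) by exact: powR_ge0.
have Cb0 : 0 <= Cb by rewrite /Cb !mulr_ge0 ?powR_ge0 ?exprn_ge0.
have /andP[qa0 _] := qa01; have /andP[qb0 _] := qb01.
under eq_eseriesr do rewrite integral_shells//.
rewrite nneseriesD; last 2 first.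
- by move=> n _ _; rewrite lee_fin !mulr_ge0 ?exprn_ge0.
- by move=> n _ _; rewrite lee_fin !mulr_ge0 ?exprn_ge0.
apply: le_trans (leeD (nneseries_geometric_le _ qa01) (nneseries_geometric_le _ qb01)) _.
- by rewrite mulr_ge0 ?exprn_ge0.
- by rewrite mulr_ge0.
by rewrite -EFinD lee_fin le_eqVlt /ker_const; apply/orP; left; apply/eqP; ring.
Qed.

(** A tent over the $\ell^1$ norm: its Lipschitz constant for the Euclidean distance is at most N /
    rho, which is the origin of the factor $N^2$ in [ker]. *)
Definition tent (rho : R) x : R :=
  Num.max 0 (1 - (\sum_(i < N) `|tnth x i|) / rho).

Lemma measurable_tent rho : measurable_fun setT (tent rho).
Proof.
apply: measurable_maxr => //; apply: measurable_funB => //.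
apply: measurable_funM => //; apply: measurable_sum => i.
by apply: measurableT_comp => //; exact: measurable_tnth.
Qed.

Lemma tent_ge0 rho x : 0 <= tent rho x.
Proof. by rewrite le_max lexx. Qed.

Lemma tent_le1 rho x : 0 < rho -> tent rho x <= 1.
Proof.
move=> rho0; rewrite ge_max ler01/= gerBl divr_ge0 ?(ltW rho0)//.
exact: sumr_ge0.
Qed.

Lemma tent_eq0 rho x : 0 < rho -> ~ cube (origin N) rho x -> tent rho x = 0.
Proof.
move=> rho0 /existsNP[i /negP]; rewrite -ltNge tnth_mktuple subr0 => xi.
apply/eqP; rewrite eq_le tent_ge0 andbT ge_max lexx/= subr_le0 ler_pdivlMr// mul1r.
by apply: (le_trans (ltW xi)); rewrite (bigD1 i)//= lerDl sumr_ge0.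
Qed.

Lemma tent_ge_half rho x : 0 < rho ->
  cube (origin N) (rho / (2 * N%:R)) x -> 2^-1 <= tent rho x.
Proof.
move=> rho0 xc; rewrite le_max; apply/orP; right.
have NR : 0 < N%:R :> R by rewrite ltr0n.
have : \sum_(i < N) `|tnth x i| <= \sum_(i < N) rho / (2 * N%:R).
  by apply: ler_sum => i _; have := xc i; rewrite tnth_mktuple subr0.
rewrite sumr_const card_ord (_ : rho / (2 * N%:R) *+ N = rho / 2); last first.
  by rewrite -mulr_natr; field; rewrite gt_eqF.
move=> le1; have : (\sum_(i < N) `|tnth x i|) / rho <= 2^-1.
  by rewrite ler_pdivrMr// mulrC.
lra.
Qed.

Lemma tent_lipschitz rho x y : 0 < rho ->
  `|tent rho x - tent rho y| <= N%:R * edist x y / rho.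
Proof.
move=> rho0.
have dl : `|\sum_(i < N) `|tnth x i| - \sum_(i < N) `|tnth y i| |
    <= N%:R * edist x y.
  rewrite -sumrB; apply: le_trans (ler_norm_sum _ _ _) _.
  apply: (@le_trans _ _ (\sum_(i < N) edist x y)).
    apply: ler_sum => i _; apply: le_trans (ler_dist_dist _ _) _.
    rewrite -sqrtr_sqr ler_wsqrtr// (bigD1 i)//= lerDl sumr_ge0// => j _.
    exact: sqr_ge0.
  by rewrite sumr_const card_ord mulr_natl.
have max_lip (a b : R) : `|Num.max 0 a - Num.max 0 b| <= `|a - b|.
  have := ler_norm (a - b); have := ler_norm (- (a - b)).
  rewrite normrN => ab1 ab2.
  rewrite ler_norml; have [a0|a0] := leP 0 a; have [b0|b0] := leP 0 b;
    apply/andP; split; lra.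
apply: le_trans (max_lip _ _) _.
set S1 := \sum_(i < N) `|tnth x i| in dl *.
set S2 := \sum_(i < N) `|tnth y i| in dl *.
rewrite (_ : 1 - S1 / rho - (1 - S2 / rho) = - ((S1 - S2) / rho)); last by ring.
by rewrite normrN normrM (gtr0_norm (x := rho^-1)) ?invr_gt0// ler_pM2r ?invr_gt0.
Qed.

(** The slope vanishes unless one of the points is in the support cube. With an indicator in a
    single variable, each term reduces by Tonelli to an integral of [ker] in the other. *)
Lemma slope_tent_le rho x y : 0 < rho ->
  slope s (tent rho) x y <=
  \1_(cube (origin N) rho) x * ker rho x y + \1_(cube (origin N) rho) y * ker rho x y.
Proof.
move=> rho0; have k0 := ker_ge0 rho x y.
have [xy|nxy] := pselect (cube (origin N) rho x \/ cube (origin N) rho y).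
  apply: (@le_trans _ _ (ker rho x y)); last first.
    case: xy => xK.
      by rewrite [X in X * _ + _]indicE mem_set// mul1r lerDl mulr_ge0.
    by rewrite [X in _ + X * _]indicE mem_set// mul1r lerDr mulr_ge0.
  rewrite /slope /ker ler_wpM2r ?invr_ge0 ?powR_ge0// le_min.
  apply/andP; split.
    rewrite -[leRHS](expr1n _ 2) ler_sqr ?nnegrE// ler_norml.
    have := tent_ge0 rho x; have := tent_ge0 rho y.
    have := tent_le1 x rho0; have := tent_le1 y rho0.
    by move=> ? ? ? ?; apply/andP; split; lra.
  rewrite -exprMn -[in leRHS]exprVn -exprMn ler_sqr ?nnegrE//; last first.
    by rewrite !mulr_ge0 ?edist_ge0 ?invr_ge0// ltW.
  exact: tent_lipschitz.
rewrite /slope !tent_eq0//; [|by move=> h; apply: nxy; right|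
  by move=> h; apply: nxy; left].
rewrite subrr normr0 expr0n mul0r; apply: addr_ge0; exact: mulr_ge0.
Qed.

Lemma gag_tent_le rho : 0 < rho ->
  (gag s (tent rho) <=
   (2 * (2 * rho) ^+ N * (ker_const * rho `^ (- (2 * s))))%:E)%E.
Proof.
move=> rho0; set K := cube (origin N) rho; set Q := ker_const * _.
have mK : measurable K by exact: measurable_cube.
have mi : measurable_fun setT (\1_K : Rn R N -> R) by exact: measurable_indic.
have Q0 : 0 <= Q by rewrite mulr_ge0 ?powR_ge0// ltW// ker_const_gt0.
have mk := measurable_ker rho.
have m1 : measurable_fun setT (fun z : Rn R N * Rn R N => \1_K z.1 * ker rho z.1 z.2).
  by apply: measurable_funM => //; apply: measurableT_comp.
have m2 : measurable_fun setT (fun z : Rn R N * Rn R N => \1_K z.2 * ker rho z.1 z.2).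
  by apply: measurable_funM => //; apply: measurableT_comp.
have p1 z : 0 <= \1_K z.1 * ker rho z.1 z.2 :> R by rewrite mulr_ge0 ?ker_ge0.
have p2 z : 0 <= \1_K z.2 * ker rho z.1 z.2 :> R by rewrite mulr_ge0 ?ker_ge0.
have bnd x : (\int[mu]_y (\1_K x * ker rho x y)%:E <= (Q * \1_K x)%:E)%E.
  rewrite integralZ_EFin_ge0//; last 2 first.
    rewrite (_ : ker rho x = (fun z => ker rho z.1 z.2) \o pair x)//.
    exact: measurableT_comp.
    by move=> y; exact: ker_ge0.
  rewrite mulrC EFinM; apply: lee_wpmul2l; first by rewrite lee_fin.
  exact: ker_integral_le.
have total : (\int[mu]_x (Q * \1_K x)%:E = (Q * (2 * rho) ^+ N)%:E)%E.
  rewrite integralZ_EFin_ge0// integral_indic// setIT.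
  by rewrite [X in (_ * X)%E](lebesgue_cube (origin N) (ltW rho0)).
have mQ : measurable_fun setT (fun x : Rn R N => (Q * \1_K x)%:E).
  by apply/measurable_EFinP; exact: measurable_funM.
apply: (@le_trans _ _ (\int[mu \x mu]_z (\1_K z.1 * ker rho z.1 z.2 +
   \1_K z.2 * ker rho z.1 z.2)%:E)%E).
  apply: le_integral_EFin.
  - by apply: measurable_slope; exact: measurable_tent.
  - exact: measurable_funD.
  - by move=> z; exact: slope_ge0.
  - by move=> z; exact: slope_tent_le.
rewrite integralD_EFin_ge0//.
rewrite (_ : 2 * _ * Q = Q * (2 * rho) ^+ N + Q * (2 * rho) ^+ N); last by ring.
rewrite EFinD; apply: leeD.
- rewrite fubini_tonelli1//; [|exact/measurable_EFinP].
  rewrite -total; apply: ge0_le_integral => //.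
  + by move=> x _; apply: integral_ge0 => y _; rewrite lee_fin (p1 (x, y)).
  + apply: (measurable_fun_fubini_tonelli_F
      (fun z => (\1_K z.1 * ker rho z.1 z.2)%:E)) => //.
    exact/measurable_EFinP.
  + by move=> x _; exact: bnd.
- rewrite fubini_tonelli2//; [|exact/measurable_EFinP].
  rewrite -total; apply: ge0_le_integral => //.
  + by move=> y _; apply: integral_ge0 => x _; rewrite lee_fin (p2 (x, y)).
  + apply: (measurable_fun_fubini_tonelli_G
      (fun z => (\1_K z.2 * ker rho z.1 z.2)%:E)) => //.
    exact/measurable_EFinP.
  + move=> y _; rewrite /fubini_G; apply: le_trans (bnd y).
    by under eq_integral do rewrite /= kerC.
Qed.

Lemma mass_tent_le rho : 0 < rho -> (mass (tent rho) <= ((2 * rho) ^+ N)%:E)%E.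
Proof.
move=> rho0; set K := cube (origin N) rho.
have mK : measurable K by exact: measurable_cube.
apply: (@le_trans _ _ (\int[mu]_x (\1_K x)%:E)%E).
  apply: le_integral_EFin.
  - by apply: measurable_sqr; exact: measurable_tent.
  - exact: measurable_indic.
  - by move=> x; exact: sqr_ge0.
  - move=> x; have [xK|xK] := pselect (K x).
      by rewrite indicE mem_set// exprn_ile1 ?tent_ge0 ?tent_le1.
    by rewrite tent_eq0// expr0n.
by rewrite integral_indic// setIT [leLHS](lebesgue_cube (origin N) (ltW rho0)).
Qed.

Lemma mass_tent_ge rho : 0 < rho ->
  ((4^-1 * (rho / N%:R) ^+ N)%:E <= mass (tent rho))%E.
Proof.
move=> rho0; set K := cube (origin N) (rho / (2 * N%:R)).
have NR : 0 < N%:R :> R by rewrite ltr0n.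
have mK : measurable K by exact: measurable_cube.
have r0 : 0 <= rho / (2 * N%:R) by rewrite divr_ge0 ?mulr_ge0// ltW.
have mi : measurable_fun setT (\1_K : Rn R N -> R) by exact: measurable_indic.
have -> : (4^-1 * (rho / N%:R) ^+ N)%:E = (\int[mu]_x (4^-1 * \1_K x)%:E)%E.
  rewrite integralZ_EFin_ge0// integral_indic// setIT.
  rewrite [X in (_ * X)%E](lebesgue_cube (origin N) r0) -EFinM.
  by congr (_ * _ ^+ _)%:E; field; rewrite gt_eqF.
apply: le_integral_EFin.
- exact: measurable_funM.
- by apply: measurable_sqr; exact: measurable_tent.
- by move=> x; rewrite mulr_ge0.
- move=> x; have [xK|xK] := pselect (K x).
    rewrite indicE mem_set// mulr1 (_ : 4^-1 = 2^-1 ^+ 2); last by field.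
    by rewrite ler_sqr ?nnegrE ?tent_ge0// tent_ge_half.
  by rewrite indicE memNset// mulr0 sqr_ge0.
Qed.

(** A tent of width [rho] and mass $c^2$ has height of order $\rho^{-N/2}$. Its seminorm is at most
    $K_2\rho^{-2s}$ and its potential at least $K_3\rho^{N-N\alpha/2}$, so the quotient of potential
    by seminorm grows at least like $\rho^{be}$, with [be > 0] by the condition on [al]. *)
Lemma negative_energy (G : Rn R N -> R -> R) (C c al dl S0 : R) :
  (forall u, measurable_fun setT u -> measurable_fun setT (fun x => G x (u x))) ->
  (forall x t, 0 <= G x t) ->
  0 < C -> 0 < c -> 0 < al -> N%:R / 2 * al < N%:R + 2 * s ->
  0 < dl -> 0 < S0 ->
  (\forall x \ae mu, forall t, 0 < `|t| -> `|t| < S0 -> dl * `|t| `^ al <= G x t) ->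
  exists u, [/\ measurable_fun setT u, mass u = (c ^+ 2)%:E, (gag s u < +oo)%E &
    ((C / 2)%:E * gag s u < pot G u)%E].
Proof.
move=> mG G_ge0 C0 c0 al0 alN dl0 S00 Glow.
have NR : 0 < N%:R :> R by rewrite ltr0n.
have kc0 := ker_const_gt0.
pose K2 := 8 * c ^+ 2 * (2 * N%:R) ^+ N * ker_const.
pose K3 := dl * (c / 2) `^ al * 2 `^ (- (N%:R / 2 * al)) / N%:R ^+ N.
pose be := N%:R - N%:R / 2 * al + 2 * s.
have K20 : 0 < K2.
  by apply: mulr_gt0 => //; rewrite !mulr_gt0 ?exprn_gt0// mulr_gt0.
have K30 : 0 < K3.
  by rewrite divr_gt0 ?exprn_gt0// !mulr_gt0// powR_gt0// divr_gt0.
have be0 : 0 < be by rewrite /be; lra.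
have eta0 : 0 < K3 / (C * K2) by rewrite divr_gt0// mulr_gt0.
have nbe0 : - be < 0 by rewrite oppr_lt0.
have [lam l1 lamP] := powR_neg_small nbe0 eta0.
(* The summand [lam] makes the potential win, [N%:R] gives $(N/\rho)^N \le N/\rho$, and the last one
   then keeps the height [a] below [S0], where the lower bound on [G] holds. *)
pose rho := lam + N%:R + (4 * c ^+ 2 * N%:R / S0 ^+ 2 + 1).
have q0 : 0 < 4 * c ^+ 2 * N%:R / S0 ^+ 2.
  by rewrite divr_gt0 ?exprn_gt0// !mulr_gt0// exprn_gt0.
have rl : lam <= rho by rewrite /rho; lra.
have rN : N%:R <= rho by rewrite /rho; lra.
have rq : 4 * c ^+ 2 * N%:R / S0 ^+ 2 < rho by rewrite /rho; lra.
have rho0 : 0 < rho by exact: lt_le_trans rN.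
have mt := measurable_tent rho.
have mlo := mass_tent_ge rho0; have mhi := mass_tent_le rho0.
have mfin : mass (tent rho) \is a fin_num.
  by rewrite ge0_fin_numE ?mass_ge0//; apply: le_lt_trans mhi _; rewrite ltry.
set m := fine (mass (tent rho)).
have mE : mass (tent rho) = m%:E by rewrite fineK.
rewrite mE !lee_fin in mlo mhi.
have m0 : 0 < m.
  by apply: lt_le_trans mlo; rewrite mulr_gt0// exprn_gt0// divr_gt0.
have sm0 : 0 < Num.sqrt m by rewrite sqrtr_gt0.
pose a := c / Num.sqrt m.
have a0 : 0 < a by rewrite divr_gt0.
have a2 : a ^+ 2 = c ^+ 2 / m by rewrite /a exprMn exprVn sqr_sqrtr// ltW.
have a2hi : a ^+ 2 <= 4 * c ^+ 2 * (N%:R / rho) ^+ N.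
  rewrite a2 ler_pdivrMr//.
  apply: (@le_trans _ _ (4 * c ^+ 2 * (N%:R / rho) ^+ N *
     (4^-1 * (rho / N%:R) ^+ N))); last first.
    by rewrite ler_wpM2l// !mulr_ge0 ?exprn_ge0 ?divr_ge0// ltW.
  rewrite [leRHS](_ : _ = c ^+ 2 * ((N%:R / rho) ^+ N * (rho / N%:R) ^+ N)); last by field.
  rewrite -exprMn (_ : N%:R / rho * (rho / N%:R) = 1) ?expr1n ?mulr1//.
  by field; rewrite !gt_eqF.
have aS : a < S0.
  rewrite -ltr_sqr ?nnegrE ?(ltW a0) ?(ltW S00)//; apply: le_lt_trans a2hi _.
  apply: (@le_lt_trans _ _ (4 * c ^+ 2 * (N%:R / rho))).
    apply: ler_wpM2l; first by apply: mulr_ge0 => //; exact: sqr_ge0.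
    rewrite -[leRHS]expr1.
    by rewrite ler_wiXn2l ?divr_ge0 ?(ltW rho0)// ler_pdivrMr// mul1r.
  rewrite mulrA ltr_pdivrMr//; move: rq.
  by rewrite ltr_pdivrMr ?exprn_gt0// (mulrC rho).
have mu_ : measurable_fun setT (fun x => a * tent rho x) by exact: measurable_funM.
have uA : (gag s (fun x => a * tent rho x)%R <= (K2 * rho `^ (- (2 * s)))%:E)%E.
  rewrite gagZ//.
  apply: (@le_trans _ _ ((a ^+ 2)%:E *
    (2 * (2 * rho) ^+ N * (ker_const * rho `^ (- (2 * s))))%:E)%E).
    by apply: lee_wpmul2l; [rewrite lee_fin sqr_ge0|exact: gag_tent_le].
  rewrite -EFinM lee_fin.
  apply: (@le_trans _ _ (4 * c ^+ 2 * (N%:R / rho) ^+ N *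
      (2 * (2 * rho) ^+ N * (ker_const * rho `^ (- (2 * s)))))).
    by rewrite ler_wpM2r// !mulr_ge0 ?powR_ge0 ?exprn_ge0 ?(ltW kc0)// mulr_ge0 ?ltW.
  rewrite [leLHS](_ : _ = 8 * c ^+ 2 * ((N%:R / rho) ^+ N * (2 * rho) ^+ N) *
      ker_const * rho `^ (- (2 * s))); last by ring.
  rewrite -exprMn (_ : N%:R / rho * (2 * rho) = 2 * N%:R); last first.
    by field; rewrite gt_eqF.
  by rewrite /K2.
exists (fun x => a * tent rho x); split => //.
- by rewrite massZ// mE -EFinM a2 divfK// gt_eqF.
- by apply: le_lt_trans uA _; rewrite ltry.
set K := cube (origin N) (rho / (2 * N%:R)).
have mK : measurable K by exact: measurable_cube.
have r0 : 0 <= rho / (2 * N%:R) by rewrite divr_ge0 ?mulr_ge0// ltW.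
pose P := dl * (a / 2) `^ al * (rho / N%:R) ^+ N.
have uP : (P%:E <= pot G (fun x => a * tent rho x)%R)%E.
  have -> : P%:E = (\int[mu]_x (dl * (a / 2) `^ al * \1_K x)%:E)%E.
    rewrite integralZ_EFin_ge0//; last first.
      by rewrite mulr_ge0 ?powR_ge0// ltW.
    rewrite integral_indic// setIT.
    rewrite [X in (_ * X)%E](lebesgue_cube (origin N) r0) -EFinM /P.
    by congr (_ * _ ^+ _)%:E; field; rewrite gt_eqF.
  apply: ae_ge0_le_integral => //.
  - by move=> x _; rewrite lee_fin !mulr_ge0 ?powR_ge0// ltW.
  - by apply/measurable_EFinP; apply: measurable_funM => //; exact: measurable_indic.
  - by move=> x _; rewrite lee_fin.
  - by apply/measurable_EFinP; exact: mG.
  - apply: filterS Glow => x Gx _; rewrite lee_fin.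
    have [xK|xK] := pselect (K x); last by rewrite indicE memNset// mulr0.
    rewrite indicE mem_set// mulr1.
    have th := tent_ge_half rho0 xK; have t1 := tent_le1 x rho0.
    have t0 : 0 < tent rho x by apply: lt_le_trans th; rewrite invr_gt0.
    have nE : `|a * tent rho x| = a * tent rho x by rewrite gtr0_norm// mulr_gt0.
    apply: le_trans (Gx (a * tent rho x) _ _); rewrite nE.
    + rewrite ler_wpM2l ?(ltW dl0)// ge0_ler_powR ?nnegrE ?(ltW al0)//.
      * by rewrite divr_ge0// ltW.
      * by rewrite mulr_ge0// ltW.
      * by rewrite ler_wpM2l// ltW.
    + by rewrite mulr_gt0.
    + by apply: le_lt_trans aS; rewrite ler_piMr// ltW.
apply: lt_le_trans uP.
apply: (@le_lt_trans _ _ ((C / 2 * (K2 * rho `^ (- (2 * s))))%:E)).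
  rewrite [leRHS]EFinM; apply: lee_wpmul2l => //.
  by rewrite lee_fin divr_ge0// ltW.
rewrite lte_fin.
have r20 : 0 < 2 * rho by rewrite mulr_gt0.
have alo : c * (2 * rho) `^ (- (N%:R / 2)) <= a.
  rewrite /a ler_wpM2l ?(ltW c0)// powRN lef_pV2 ?posrE ?powR_gt0//.
  rewrite -(@ler_sqr _ (Num.sqrt m)) ?nnegrE ?powR_ge0 ?(ltW sm0)//.
  rewrite sqr_sqrtr ?(ltW m0)// -powR_mulrn ?powR_ge0// -powRrM divfK//.
  by rewrite powR_mulrn ?(ltW r20).
have Plo : K3 * (rho `^ be * rho `^ (- (2 * s))) <= P.
  apply: (@le_trans _ _ (dl * (c / 2 * (2 * rho) `^ (- (N%:R / 2))) `^ al *
      (rho / N%:R) ^+ N)); last first.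
    rewrite /P ler_wpM2r ?exprn_ge0 ?divr_ge0 ?(ltW rho0)//.
    rewrite ler_wpM2l ?(ltW dl0)// ge0_ler_powR ?nnegrE ?(ltW al0)//.
    + by rewrite mulr_ge0 ?powR_ge0// divr_ge0// ltW.
    + by rewrite divr_ge0// ltW.
    + by rewrite mulrAC ler_wpM2r.
  have c20 : 0 <= c / 2 by rewrite divr_ge0// ltW.
  rewrite (@powRM _ (c / 2) ((2 * rho) `^ _)) ?powR_ge0// -powRrM.
  rewrite (@powRM _ 2 rho) ?(ltW rho0)//.
  rewrite -powRD; last by rewrite (gt_eqF rho0) implybT.
  rewrite exprMn exprVn -(@powR_mulrn _ rho) ?(ltW rho0)//.
  have -> : be - 2 * s = - (N%:R / 2) * al + N%:R by rewrite /be; ring.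
  rewrite powRD; last by rewrite (gt_eqF rho0) implybT.
  rewrite /K3 mulNr le_eqVlt; apply/orP; left; apply/eqP; ring.
have CK : 0 < C * K2 by exact: mulr_gt0.
have key : C / 2 * K2 < K3 * rho `^ be.
  have := lamP _ rl; rewrite powRN ler_pdivlMr//.
  rewrite mulrC ler_pdivrMr ?powR_gt0// => le1.
  apply: lt_le_trans le1; rewrite (mulrAC C) ltr_pdivrMr//.
  by rewrite ltr_pMr// ltr1n.
apply: lt_le_trans Plo.
by rewrite (mulrA K3) (mulrA (C / 2) K2) ltr_pM2r// powR_gt0.
Qed.

End test_function.

(** * Minimizing sequences *)

Section product_limits.
Context {R : realType}.
Variables (N : nat) (s : R).
Hypothesis s0 : 0 < s.
Implicit Types (x y a : Rn R N) (u v w : Rn R N -> R).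
Local Notation mu := (@lebesgue_Rn R N).

Lemma ae_prod (P : Rn R N -> Prop) : (\forall x \ae mu, P x) ->
  \forall z \ae (mu \x mu)%E, P z.1 /\ P z.2.
Proof.
move=> [A [mA A0 PA]].
exists ((A `*` setT) `|` (setT `*` A)); split.
- by apply: measurableU; apply: measurableX.
- apply/eqP; rewrite eq_le measure_ge0 andbT.
  apply: le_trans (measureU2 _ _ _) _; try exact: measurableX.
  have p1 : (mu \x mu)%E (A `*` setT) = 0%E.
    have := product_measure1E mu mu mA measurableT.
    by move=> ->; rewrite [X in (X * _)%E]A0 mul0e.
  have p2 : (mu \x mu)%E (setT `*` A) = 0%E.
    have := product_measure1E mu mu measurableT mA.
    by move=> ->; rewrite [X in (_ * X)%E]A0 mule0.
  by rewrite [X in (X + _)%E]p1 [X in (_ + X)%E]p2 adde0.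
- move=> [x y] /= /not_andP[nP|nP]; [left|right]; split => //; exact: PA.
Qed.

(** A signed square root of [slope]. Without the absolute value it is linear in [u], so that
    [sqr_splitting] on the product space applies to the seminorm. *)
Definition quot u (z : Rn R N * Rn R N) : R :=
  (u z.1 - u z.2) / edist z.1 z.2 `^ (N%:R / 2 + s).

Lemma Ns0 : 0 < N%:R + 2 * s.
Proof. by rewrite ltr_wpDl// mulr_gt0. Qed.

Lemma quot_sqr u z : quot u z ^+ 2 = slope s u z.1 z.2.
Proof.
rewrite slopeE ?Ns0// /quot !exprMn real_normK// num_real//.
Qed.

Lemma measurable_quot u : measurable_fun setT u -> measurable_fun setT (quot u).
Proof.
move=> mu_; apply: measurable_funM.
  by apply: measurable_funB; apply: measurableT_comp.
rewrite (_ : (fun _ => _) = fun z : Rn R N * Rn R N =>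
    edist z.1 z.2 `^ (- (N%:R / 2 + s))); last first.
  by apply/funext => z; rewrite powRN.
apply: (@measurableT_comp _ _ _ _ _ _ (fun t : R => t `^ (- (N%:R / 2 + s)))).
  exact: measurable_powR.
exact: measurable_edist.
Qed.

Lemma gag_quotE u : gag s u = (\int[mu \x mu]_z (quot u z ^+ 2)%:E)%E.
Proof. by apply: eq_integral => z _; rewrite quot_sqr. Qed.

Lemma quot_cvg (w : nat -> Rn R N -> R) u :
  (\forall x \ae mu, w ^~ x @ \oo --> u x) ->
  \forall z \ae (mu \x mu)%E, (fun n => quot (w n) z) @ \oo --> quot u z.
Proof.
move=> /ae_prod; apply: filterS => z [z1 z2].
by apply: cvgM; [exact: cvgB|exact: cvg_cst].
Qed.

Lemma mass_limit_le (w : nat -> Rn R N -> R) u L :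
  (forall n, measurable_fun setT (w n)) -> measurable_fun setT u ->
  (forall n, mass (w n) <= L)%E ->
  (\forall x \ae mu, w ^~ x @ \oo --> u x) -> (mass u <= L)%E.
Proof.
move=> mw mu_ wL cv.
apply: (@fatou_EFin _ _ _ mu (fun n x => w n x ^+ 2)) => //.
- by move=> n; exact: measurable_sqr.
- exact: measurable_sqr.
- by move=> n x; exact: sqr_ge0.
- by move=> x; exact: sqr_ge0.
- by apply: filterS cv => x wx; rewrite expr2; exact: cvgM.
Qed.

Lemma gag_limit_le (w : nat -> Rn R N -> R) u L :
  (forall n, measurable_fun setT (w n)) -> measurable_fun setT u ->
  (forall n, gag s (w n) <= L)%E ->
  (\forall x \ae mu, w ^~ x @ \oo --> u x) -> (gag s u <= L)%E.
Proof.
move=> mw mu_ wL cv; rewrite gag_quotE.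
apply: (@fatou_EFin _ _ _ (mu \x mu)%E (fun n z => quot (w n) z ^+ 2)) => //.
- by move=> n; apply: measurable_funX; exact: measurable_quot.
- by apply: measurable_funX; exact: measurable_quot.
- by move=> n x; exact: sqr_ge0.
- by move=> x; exact: sqr_ge0.
- by apply: filterS (quot_cvg cv) => z wz; rewrite expr2; exact: cvgM.
- by move=> n; rewrite -gag_quotE.
Qed.

Lemma gag_splitting (w : nat -> Rn R N -> R) u (A : R) :
  (forall n, measurable_fun setT (w n)) -> measurable_fun setT u ->
  (forall n, gag s (w n) <= A%:E)%E -> (gag s u <= A%:E)%E ->
  (\forall x \ae mu, w ^~ x @ \oo --> u x) ->
  forall e : R, 0 < e -> \forall n \near \oo,
    `|fine (gag s (w n)) - fine (gag s (fun x => w n x - u x)) -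
      fine (gag s u)| <= e.
Proof.
move=> mw mu_ wA uA cv e e0.
have wA' n : (\int[mu \x mu]_z (quot (w n) z ^+ 2)%:E <= A%:E)%E.
  by rewrite -gag_quotE.
have uA' : (\int[mu \x mu]_z (quot u z ^+ 2)%:E <= A%:E)%E.
  by rewrite -gag_quotE.
have := sqr_splitting (fun n => measurable_quot (mw n)) (measurable_quot mu_)
  wA' uA' (quot_cvg cv) e0.
apply: filterS => n; rewrite !gag_quotE; congr (`|_ - fine _ - _| <= _).
apply: eq_integral => z _; congr (_ ^+ 2)%:E.
by rewrite /quot -mulrBl; congr (_ / _); ring.
Qed.

(* an integer translation brings [cube x 1] into [cube 0 2] *)
Lemma integral_cube_translate x : exists z : 'I_N -> int, forall u,
  measurable_fun setT u ->
  (\int[mu]_(y in cube x 1) (u y ^+ 2)%:E <=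
   \int[mu]_(y in cube (origin N) 2) (u (translate y z) ^+ 2)%:E)%E.
Proof.
pose z : 'I_N -> int := fun i => Num.floor (tnth x i); exists z => u mu_.
have mc a r : measurable_fun setT (\1_(cube a r) : Rn R N -> R).
  by apply: measurable_indic; exact: measurable_cube.
have mt := @measurable_translate R N z.
have m1 : measurable_fun setT (fun y => u y ^+ 2 * \1_(cube x 1) y).
  by apply: measurable_funM => //; exact: measurable_sqr.
rewrite integral_indicM [leRHS]integral_indicM.
rewrite -(ge0_integral_translate z
  (f := fun y => (u y ^+ 2 * \1_(cube x 1) y)%:E)); last 2 first.
  exact/measurable_EFinP.
  by move=> y; rewrite lee_fin mulr_ge0 ?sqr_ge0.
apply: le_integral_EFin.
- exact: (measurableT_comp m1 mt).
- apply: measurable_funM => //; apply: measurable_funX.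
  exact: measurableT_comp.
- by move=> y; rewrite mulr_ge0 ?sqr_ge0.
- move=> y; rewrite ler_wpM2l ?sqr_ge0// !indicE ler_nat.
  have [/set_mem ty|//] := boolP (translate y z \in cube x 1).
  rewrite mem_set// => i; rewrite tnth_mktuple subr0.
  have := ty i; rewrite tnth_mktuple /z.
  have /andP[] := floor_itv (tnth x i); rewrite intrD.
  by rewrite !ler_norml => ? ? /andP[? ?]; apply/andP; split; lra.
Qed.

(** The limit keeps mass because a single term, [w (phi 2)], is within $M^2/8$ of it in squared
    $L^2$ norm on the cube of radius 2, while it has mass at least $M^2$ there. The index 2 is the
    radius of this cube. *)
Lemma limit_extraction (w : nat -> Rn R N -> R) (m Lam M : R) : (0 < N)%N ->
  (forall n, measurable_fun setT (w n)) ->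
  (forall n, mass (w n) <= m%:E)%E ->
  (forall n, gag s (w n) <= Lam%:E)%E -> 0 < M ->
  (forall n, ((M ^+ 2)%:E <=
     \int[mu]_(x in cube (origin N) 2) (w n x ^+ 2)%:E)%E) ->
  exists (phi : nat -> nat) (u : Rn R N -> R),
  [/\ forall i, (i <= phi i)%N, measurable_fun setT u,
     \forall x \ae mu, (fun i => w (phi i) x) @ \oo --> u x & (0 < mass u)%E].
Proof.
move=> N0 mw wm wg M0 wM.
(* The first entry is the rate required by [fast_cauchy_cvg]; the second makes the limit retain mass
   in the cube of radius 2. *)
pose eps (k : nat) : R := Num.min ((4 ^+ k)^-1 / (2 ^ (k + 1))%:R) (M ^+ 2 / 8).
have eps0 k : 0 < eps k.
  rewrite lt_min divr_gt0 ?invr_gt0 ?exprn_gt0 ?ltr0n ?expn_gt0//=.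
  by rewrite divr_gt0// exprn_gt0.
have [phi [iphi phiP]] := local_compactness s0 N0 eps0 mw wm wg.
have mwp i : measurable_fun setT (w (phi i)) by [].
have cub x : \forall n \near \oo, cube (origin N) n%:R x.
  have [n0 n0P] := exists_nat_ge (\sum_(i < N) `|tnth x i|).
  exists n0 => // n /= n0n i; rewrite tnth_mktuple subr0.
  apply: (@le_trans _ _ n0%:R); last by rewrite ler_nat.
  by apply: le_trans n0P; rewrite (bigD1 i)//= lerDl sumr_ge0.
have cv0 : \forall x \ae mu, cvgn (fun i => w (phi i) x).
  apply: (@fast_cauchy_cvg _ _ _ mu (fun i => w (phi i))
    (fun k => cube (origin N) k%:R)) => //.
    by move=> k; exact: measurable_cube.
  move=> k; apply: le_trans (phiP k k k.+1 (leqnn k) (leqnSn k)) _.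
  by rewrite lee_fin /eps ge_min lexx.
have [u mu_ uP] := ae_limit_measurable mwp cv0.
exists phi, u; split => //.
have mc : measurable_fun setT (\1_(cube (origin N) 2) : Rn R N -> R).
  by apply: measurable_indic; exact: measurable_cube.
have c01 x : 0 <= (\1_(cube (origin N) 2) x : R) <= 1.
  by rewrite indicE; case: (_ \in _); rewrite /= ?lexx ?ler01.
have c0' x : 0 <= (\1_(cube (origin N) 2) x : R) by have /andP[] := c01 x.
have md (a b : Rn R N -> R) : measurable_fun setT a -> measurable_fun setT b ->
    measurable_fun setT (fun x => (a x - b x) ^+ 2 * \1_(cube (origin N) 2) x).
  move=> ma mb; apply: measurable_funM => //; apply: measurable_funX.
  exact: measurable_funB.
have near2 : (\int[mu]_x
    ((w (phi 2%N) x - u x) ^+ 2 * \1_(cube (origin N) 2) x)%:E <=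
    (M ^+ 2 / 8)%:E)%E.
  apply: (@fatou_EFin _ _ _ mu 
    (fun j x => (w (phi 2%N) x - w (phi (j + 2)%N) x) ^+ 2 *
    \1_(cube (origin N) 2) x)).
  - by move=> n; exact: md.
  - exact: md.
  - by move=> n x; rewrite mulr_ge0 ?sqr_ge0.
  - by move=> x; rewrite mulr_ge0 ?sqr_ge0.
  - apply: filterS uP => x wx.
    apply: cvgM; last exact: cvg_cst.
    rewrite expr2; apply: cvgM; apply: cvgB; try exact: cvg_cst;
      by rewrite (cvg_shiftn 2 (fun j => w (phi j) x)).
  - move=> j; rewrite -integral_indicM.
    apply: le_trans (phiP 2%N 2%N (j + 2)%N (leqnn _) (leq_addl _ _)) _.
    by rewrite lee_fin /eps ge_min lexx orbT.
have split2 : ((M ^+ 2)%:E <= 2%:E * (M ^+ 2 / 8)%:E + 2%:E * mass u)%E.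
  apply: le_trans (wM (phi 2%N)) _.
  rewrite integral_indicM.
  apply: (@le_trans _ _ (\int[mu]_x
    (2 * ((w (phi 2%N) x - u x) ^+ 2 * \1_(cube (origin N) 2) x) +
     2 * u x ^+ 2)%:E)%E).
    apply: le_integral_EFin.
    - by apply: measurable_funM => //; exact: measurable_sqr.
    - apply: measurable_funD; apply: measurable_funM => //; first exact: md.
      exact: measurable_sqr.
    - by move=> x; rewrite mulr_ge0 ?sqr_ge0.
    - move=> x; set a := w _ x; set b := u x; set i := \1_ _ x.
      have /andP[i0 i1] : 0 <= i <= 1 by exact: c01.
      rewrite -subr_ge0.
      rewrite (_ : _ - _ = i * (a - 2 * b) ^+ 2 + 2 * b ^+ 2 * (1 - i)); last by ring.
      by rewrite addr_ge0// mulr_ge0 ?sqr_ge0 ?subr_ge0// mulr_ge0// sqr_ge0.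
  rewrite integralD_EFin_ge0; last 4 first.
  - by apply: measurable_funM => //; exact: md.
  - by apply: measurable_funM => //; exact: measurable_sqr.
  - by move=> x; rewrite mulr_ge0// mulr_ge0 ?sqr_ge0.
  - by move=> x; rewrite mulr_ge0// sqr_ge0.
  rewrite integralZ_EFin_ge0//; last 2 first.
  - exact: md.
  - by move=> x; rewrite mulr_ge0 ?sqr_ge0.
  rewrite integralZ_EFin_ge0//; last 2 first.
  - exact: measurable_sqr.
  - by move=> x; rewrite sqr_ge0.
  by apply: leeD => //; apply: lee_wpmul2l.
rewrite lt_neqAle mass_ge0 andbT eq_sym; apply/eqP => u0.
move: split2; rewrite u0 mule0 adde0 -EFinM lee_fin.
have := exprn_gt0 2 M0; lra.
Qed.

End product_limits.

(** * Existence of a minimizer on the sphere *)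

Section minimization.
Context {R : realType}.
Variables (N : nat) (s C c : R).
Hypotheses (s0 : 0 < s) (N0 : (0 < N)%N) (C0 : 0 < C) (c0 : 0 < c).
Implicit Types (x y a : Rn R N) (u v w : Rn R N -> R).
Local Notation mu := (@lebesgue_Rn R N).
Variables (G : Rn R N -> R -> R) (B gam l Bp sig : R).
Hypothesis mG : forall u, measurable_fun setT u ->
  measurable_fun setT (fun x => G x (u x)).
Hypotheses (B0 : 0 < B) (gam0 : 0 < gam) (gl : gam < l) (lc : l < crit N s).
Hypothesis Gbound : forall x t,
  0 <= G x t <= B * (`|t| ^+ 2 * `|t| `^ gam + `|t| ^+ 2 * `|t| `^ l).
Hypothesis Bp0 : 0 < Bp.
Hypothesis Gincr : forall x (a b : R), `|G x (a + b) - G x a| <=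
  Bp * `|b| * ((`|a| + `|b|) `^ (gam + 1) + (`|a| + `|b|) `^ (l + 1)).
Hypothesis Gcont : forall x, continuous (G x).
Hypothesis sig0 : 0 < sig.
Hypothesis Gsuper : forall (theta : R) x t, 1 <= theta ->
  theta `^ (sig + 2) * G x t <= G x (theta * t).
Hypothesis Gpos : \forall x \ae mu, forall t, t != 0 -> 0 < G x t.
Hypothesis Gper : forall (z : 'I_N -> int) u, measurable_fun setT u ->
  pot G (fun x => u (translate x z)) = pot G u.

Definition adm u := [/\ measurable_fun setT u, (mass u < +oo)%E & (gag s u < +oo)%E].
Definition on_sphere u :=
  [/\ measurable_fun setT u, mass u = (c ^+ 2)%:E & (gag s u < +oo)%E].
(** On [adm] both terms are finite, so this real number is the energy and ordinary arithmetic is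
    available; [energyE] is the link. *)
Definition Jr u : R := C / 2 * fine (gag s u) - fine (pot G u).

Lemma on_sphere_adm u : on_sphere u -> adm u.
Proof. by move=> [mu_ um ug]; split => //; rewrite um ltry. Qed.

Lemma adm_mass u : adm u -> mass u = (fine (mass u))%:E.
Proof. by move=> [_ um _]; rewrite fineK// ge0_fin_numE// mass_ge0. Qed.

Lemma adm_gag u : adm u -> gag s u = (fine (gag s u))%:E.
Proof. by move=> [_ _ ug]; rewrite fineK// ge0_fin_numE// gag_ge0. Qed.

Lemma adm_pot u : adm u -> pot G u = (fine (pot G u))%:E.
Proof.
move=> [mu_ um ug]; rewrite fineK// ge0_fin_numE; last exact: pot_ge0 Gbound _.
exact: (pot_lty s0 N0 mG B0 gam0 gl lc Gbound).
Qed.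

Lemma fine_gag_ge0 u : 0 <= fine (gag s u).
Proof. exact/fine_ge0/gag_ge0. Qed.

Lemma fine_pot_ge0 u : 0 <= fine (pot G u).
Proof. exact/fine_ge0/(pot_ge0 Gbound). Qed.

Lemma pot_scale w (theta : R) : adm w -> 1 <= theta ->
  theta `^ (sig + 2) * fine (pot G w) <= fine (pot G (fun x => theta * w x)).
Proof.
move=> aw t1; have [mw wm wg] := aw.
have mtw : measurable_fun setT (fun x => theta * w x) by exact: measurable_funM.
have atw : adm (fun x => theta * w x).
  split => //; first by rewrite massZ// lte_mul_pinfty ?lee_fin ?sqr_ge0.
  by rewrite gagZ// lte_mul_pinfty ?lee_fin ?sqr_ge0.
rewrite -lee_fin EFinM -(adm_pot aw) -(adm_pot atw) /pot.
rewrite -integralZ_EFin_ge0 ?powR_ge0//; last 2 first.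
  exact: mG.
  by move=> x; have /andP[] := Gbound x (w x).
apply: le_integral_EFin.
- by apply: measurable_funM => //; exact: mG.
- exact: mG.
- by move=> x; rewrite mulr_ge0 ?powR_ge0//; have /andP[] := Gbound x (w x).
- by move=> x; exact: Gsuper.
Qed.

(* comparison with the dilate [theta w] on the sphere, [theta = c / |w|_2] *)
Lemma scaling_bound w (t Iv : R) : adm w -> mass w = t%:E -> 0 < t <= c ^+ 2 ->
  (forall v, on_sphere v -> Iv <= Jr v) ->
  t / c ^+ 2 * Iv + ((c / Num.sqrt t) `^ sig - 1) * fine (pot G w) <= Jr w.
Proof.
move=> aw wt /andP[t0 tc] IJ; have [mw wm wg] := aw.
have st0 : 0 < Num.sqrt t by rewrite sqrtr_gt0.
have th1 : 1 <= c / Num.sqrt t.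
  rewrite ler_pdivlMr// mul1r -ler_sqr ?nnegrE ?(ltW c0) ?(ltW st0)//.
  by rewrite sqr_sqrtr// ltW.
set th := c / Num.sqrt t in th1 *.
have th0 : 0 < th by apply: lt_le_trans th1.
have th2 : th ^+ 2 = c ^+ 2 / t by rewrite /th exprMn exprVn sqr_sqrtr// ltW.
have mtw : measurable_fun setT (fun x => th * w x) by exact: measurable_funM.
have sv : on_sphere (fun x => th * w x).
  split => //; first by rewrite massZ// wt -EFinM th2 divfK// gt_eqF.
  by rewrite gagZ// lte_mul_pinfty ?lee_fin ?sqr_ge0.
have := IJ _ sv; rewrite /Jr gagZ// (adm_gag aw) -EFinM /=.
have := pot_scale aw th1.
rewrite powRD; last by rewrite (gt_eqF th0) implybT.
rewrite powR_mulrn ?(ltW th0)//.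
set A := fine (gag s w); set P := fine (pot G w); set P' := fine (pot G _).
set ts := th `^ sig => PP IvJ.
have c20 : 0 < t / c ^+ 2 by rewrite divr_gt0// exprn_gt0.
have e1 : t / c ^+ 2 * th ^+ 2 = 1.
  by rewrite th2; field; rewrite !gt_eqF//= exprn_gt0.
have : t / c ^+ 2 * Iv <= t / c ^+ 2 * (C / 2 * (th ^+ 2 * A) - ts * th ^+ 2 * P).
  by rewrite ler_wpM2l ?(ltW c20)//; lra.
rewrite (_ : t / c ^+ 2 * (C / 2 * (th ^+ 2 * A) - ts * th ^+ 2 * P) =
  (t / c ^+ 2 * th ^+ 2) * (C / 2 * A - ts * P)); last by ring.
rewrite e1 mul1r; lra.
Qed.

Lemma scaling_lower w (t Iv : R) : adm w -> mass w = t%:E -> 0 <= t <= c ^+ 2 ->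
  (forall v, on_sphere v -> Iv <= Jr v) -> t / c ^+ 2 * Iv <= Jr w.
Proof.
move=> aw wt /andP[t0 tc] IJ; have [mw wm wg] := aw.
have [t1|t1] := ltP 0 t.
  have tcc : 0 < t <= c ^+ 2 by rewrite t1.
  have := scaling_bound aw wt tcc IJ.
  have st0 : 0 < Num.sqrt t by rewrite sqrtr_gt0.
  have th1 : 1 <= c / Num.sqrt t.
    rewrite ler_pdivlMr// mul1r -ler_sqr ?nnegrE ?(ltW c0) ?(ltW st0)//.
    by rewrite sqr_sqrtr// ltW.
  have : 1 <= (c / Num.sqrt t) `^ sig.
    by rewrite -(powRr0 (c / Num.sqrt t)) ler_powR// ltW.
  move=> p1; apply: le_trans; rewrite lerDl mulr_ge0 ?fine_pot_ge0// subr_ge0//.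
(* A function of mass 0 cannot be dilated to the sphere. Its potential is 0, by [pot_vanishing] with
   mass bound 0 and every [e], so its energy is nonnegative. *)
have t00 : t = 0 by apply/eqP; rewrite eq_le t0 t1.
have w0 : (mass w <= 0%:E)%E by rewrite wt t00.
have wA : (gag s w <= (fine (gag s w))%:E)%E by rewrite -adm_gag.
have P0 : fine (pot G w) <= 0.
  apply/ler_addgt0Pr => e e0; rewrite add0r -lee_fin -adm_pot//.
  have [M M0 MP] := pot_vanishing s0 N0 mG B0 gam0 gl lc Gbound (lexx 0)
    (fine_gag_ge0 w) e0.
  apply: MP => // x; apply: le_trans (integral_cube_le_mass _ _ mw) _.
  by apply: le_trans w0 _; rewrite lee_fin sqr_ge0.
rewrite t00 !mul0r /Jr; have := fine_gag_ge0 w.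
have := mulr_ge0 (ltW C0) (fine_gag_ge0 w); lra.
Qed.

Lemma pot_gt0 u : adm u -> 0 < fine (mass u) -> 0 < fine (pot G u).
Proof.
move=> au m0; have [mu_ um ug] := au.
rewrite lt_neqAle fine_pot_ge0 andbT eq_sym; apply/eqP => P0.
have Pu : pot G u = 0%E by rewrite adm_pot// P0.
have Gu0 x : 0 <= G x (u x) by have /andP[] := Gbound x (u x).
have ae0 : ae_eq mu setT (fun x => (G x (u x))%:E) (cst 0%E).
  apply/ae_eq_integral_abs => //; first by apply/measurable_EFinP; exact: mG.
  by rewrite -Pu; apply: eq_integral => x _; rewrite gee0_abs ?lee_fin.
have : mass u = 0%E.
  rewrite /mass -(integral0 mu setT).
  apply: ge0_ae_eq_integral => //.
  - by apply/measurable_EFinP; exact: measurable_sqr.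
  - by move=> x _; rewrite lee_fin sqr_ge0.
  - apply: filterS2 ae0 Gpos => x /= Gx Gp xT; move: (Gx xT) => -[] Gx0.
    have [->|ux] := eqVneq (u x) 0; first by rewrite expr0n.
    by have := Gp _ ux; rewrite Gx0 ltxx.
by move=> mu0; rewrite mu0 ltxx in m0.
Qed.

Lemma energy_coercive : exists2 K : R, 0 <= K &
  forall v, on_sphere v -> C / 4 * fine (gag s v) - K <= Jr v.
Proof.
have C4 : 0 < C / 4 by rewrite divr_gt0.
have [K K0 KP] := pot_coercive s0 N0 mG B0 gam0 gl lc Gbound (c ^+ 2) C4.
exists K => // v sv; have av := on_sphere_adm sv; have [mv vm vg] := sv.
have vm' : (mass v <= (c ^+ 2)%:E)%E by rewrite vm.
have vg' : (gag s v <= (fine (gag s v))%:E)%E by rewrite -adm_gag.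
have := KP v _ mv vm' vg'; rewrite (adm_pot av) lee_fin /Jr; lra.
Qed.

Hypothesis neg : exists2 u, on_sphere u & ((C / 2)%:E * gag s u < pot G u)%E.

Lemma minimizing_sequence :
  exists (Iv d Lam M : R) (w : nat -> Rn R N -> R),
  [/\ [/\ 0 < M, 0 < d & Iv < 0], forall v, on_sphere v -> Iv <= Jr v,
    forall n, on_sphere (w n) /\ Jr (w n) <= Iv + d / n.+1%:R,
    forall n, (gag s (w n) <= Lam%:E)%E
  & forall n, ((M ^+ 2)%:E <=
      \int[mu]_(x in cube (origin N) 2) (w n x ^+ 2)%:E)%E].
Proof.
have [K K0 Kco] := energy_coercive.
have [u0 su0 u0neg] := neg.
have Ju0 : Jr u0 < 0.
  have au0 := on_sphere_adm su0.
  by move: u0neg; rewrite (adm_gag au0) (adm_pot au0) -EFinM lte_fin /Jr subr_lt0.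
pose E := [set Jr v | v in on_sphere].
have hE : has_inf E.
  split; first by exists (Jr u0), u0.
  exists (- K) => _ [v sv <-]; have := Kco _ sv.
  have := mulr_ge0 (ltW C0) (fine_gag_ge0 v); lra.
have IJ v : on_sphere v -> inf E <= Jr v.
  by move=> sv; apply: ge_inf; [exact: hE.2|exists v].
have I0 : inf E < 0 by apply: le_lt_trans Ju0; exact: IJ.
(* With this slack every term of the sequence has energy at most [- d], hence potential at least
   [d]. [pot_vanishing] at level [d / 2] then forces a cube of mass above $M^2$. *)
pose d := - inf E / 2.
have d0 : 0 < d by rewrite /d; lra.
have dn (n : nat) : 0 < d / n.+1%:R by rewrite divr_gt0.
have ex (n : nat) : exists v, on_sphere v /\ Jr v <= inf E + d / n.+1%:R.
  have [_ [v sv <-] vJ] := inf_adherent (dn n) hE.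
  by exists v; split => //; exact: ltW.
have /choice[v vP] := ex.
pose Lam := 4 * K / C.
have Jd n : Jr (v n) <= - d.
  apply: le_trans (vP n).2 _; apply: (@le_trans _ _ (inf E + d)); last by rewrite /d; lra.
  by rewrite lerD2l ler_piMr ?(ltW d0)// invf_le1 ?ltr0Sn// ler1n.
have vg n : fine (gag s (v n)) <= Lam.
  rewrite /Lam ler_pdivlMr//.
  have := Kco _ (vP n).1; have := Jd n; lra.
have vgE n : (gag s (v n) <= Lam%:E)%E.
  by rewrite (adm_gag (on_sphere_adm (vP n).1)) lee_fin.
have Lam0 : 0 <= Lam by apply: le_trans (vg 0%N); exact: fine_gag_ge0.
have d20 : 0 < d / 2 by rewrite divr_gt0.
have [M M0 MP] := pot_vanishing s0 N0 mG B0 gam0 gl lc Gbound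
  (sqr_ge0 c) Lam0 d20.
have conc n : exists x, ((M ^+ 2)%:E < \int[mu]_(y in cube x 1) (v n y ^+ 2)%:E)%E.
  have sv := (vP n).1; have [mv vm _] := sv.
  apply: contrapT => /forallNP nx.
  have : (pot G (v n) <= (d / 2)%:E)%E.
    apply: MP => //; first by rewrite vm.
    by move=> x; rewrite leNgt; apply/negP; exact: nx.
  rewrite (adm_pot (on_sphere_adm sv)) lee_fin => P1.
  have := Jd n; rewrite /Jr; have := mulr_ge0 (ltW C0) (fine_gag_ge0 (v n)); lra.
have shift n : exists z : 'I_N -> int, ((M ^+ 2)%:E <=
    \int[mu]_(y in cube (origin N) 2) (v n (translate y z) ^+ 2)%:E)%E.
  have [x Mx] := conc n; have [z zP] := integral_cube_translate x.
  exists z; apply: le_trans (ltW Mx) (zP _ _); by have [] := (vP n).1.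
have /choice[z zP] := shift.
have mt n := @measurable_translate R N (z n).
have mv n : measurable_fun setT (v n) by have [] := (vP n).1.
have gE n : gag s (fun x => v n (translate x (z n))) = gag s (v n).
  exact: gag_translate.
exists (inf E), d, Lam, M, (fun n x => v n (translate x (z n))).
split => //.
- move=> n; have [_ vm vg'] := (vP n).1; split; last first.
    by rewrite /Jr gE Gper//; exact: (vP n).2.
  split; first exact: measurableT_comp.
    by rewrite mass_translate.
  by rewrite gE.
- by move=> n; rewrite gE.
Qed.

Lemma minimizer : exists2 u, on_sphere u & forall v, on_sphere v -> Jr u <= Jr v.
Proof.
have [Iv [d [Lam [M [w0 [[M0 d0 I0] IJ w0P w0g w0M]]]]]] := minimizing_sequence.
have mw0 n : measurable_fun setT (w0 n) by have [[]] := w0P n.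
have w0m n : (mass (w0 n) <= (c ^+ 2)%:E)%E by have [[_ ->]] := w0P n.
have [phi [u [iphi mu_ cv u0]]] := limit_extraction s0 N0 mw0 w0m w0g M0 w0M.
pose w i := w0 (phi i).
have mw n : measurable_fun setT (w n) by exact: mw0.
have ws n : on_sphere (w n) by exact: (w0P _).1.
have wJ n : Jr (w n) <= Iv + d / n.+1%:R.
  apply: le_trans (w0P (phi n)).2 _; rewrite lerD2l ler_pM2l// lef_pV2 ?posrE//.
  by rewrite ler_nat ltnS.
have wm n : (mass (w n) <= (c ^+ 2)%:E)%E by exact: w0m.
have wg n : (gag s (w n) <= Lam%:E)%E by exact: w0g.
have um : (mass u <= (c ^+ 2)%:E)%E := mass_limit_le mw mu_ wm cv.
have ug : (gag s u <= Lam%:E)%E := gag_limit_le s0 mw mu_ wg cv.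
have au : adm u.
  by split => //; [exact: le_lt_trans um (ltry _)|exact: le_lt_trans ug (ltry _)].
pose v i := (fun x => w i x - u x) : Rn R N -> R.
have mv n : measurable_fun setT (v n) by exact: measurable_funB.
have av n : adm (v n).
  split => //.
    apply: le_lt_trans (massB_le (mw n) mu_) _.
    by have [_ -> _] := ws n; rewrite (adm_mass au) -!EFinM -EFinD ltry.
  apply: le_lt_trans (gagB_le s (mw n) mu_) _.
  by rewrite (adm_gag au) (adm_gag (on_sphere_adm (ws n))) -!EFinM -EFinD ltry.
set t := fine (mass u).
have tE : mass u = t%:E by rewrite (adm_mass au).
have t0 : 0 < t by move: u0; rewrite tE lte_fin.
have tc : t <= c ^+ 2 by move: um; rewrite tE lee_fin.
have c20 : 0 < c ^+ 2 by rewrite exprn_gt0.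
set A := fine (gag s u); set P := fine (pot G u).
have P0 : 0 < P by exact: pot_gt0.
(* Splitting gives Jr(w_n) close to Jr(u) + Jr(v_n). The left side tends to I and Jr(v_n) is bounded
   below by nearly (1 - t / c^2) I, which leaves at most (t / c^2) I for u. *)
have key (e : R) : 0 < e -> Jr u <= t / c ^+ 2 * Iv + e.
  move=> e0.
  have [k kE] : exists k, k = Iv / c ^+ 2 by exists (Iv / c ^+ 2).
  have k0 : k < 0 by rewrite kE pmulr_llt0 ?invr_gt0.
  (* The error budget in units of [e1]: [C / 2] for the seminorm, 1 for the potential, 1 for the
     excess over the infimum, [- k] for the mass. The condition [e1 <= t] keeps the mass of [v n] at
     most $c^2$, as [scaling_lower] requires. *)
  pose b := C / 2 + 2 - k.
  have b0 : 0 < b by have C20 := divr_gt0 C0 (ltr0n R 2); rewrite /b; lra.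
  pose e1 := Num.min (e / b) t.
  have e10 : 0 < e1 by rewrite lt_min divr_gt0.
  have e1t : e1 <= t by rewrite ge_min lexx orbT.
  have e1b : e1 * b <= e by rewrite -ler_pdivlMr// ge_min lexx.
  have near1 : \forall n \near \oo, d / n.+1%:R <= e1.
    have [n0 n0P] := exists_nat_ge (d / e1).
    exists n0 => // n /= n0n; rewrite ler_pdivrMr ?ltr0Sn// mulrC -ler_pdivrMr//.
    by apply: le_trans n0P _; rewrite ler_nat ltnW// ltnS.
  have nearm := sqr_splitting mw mu_ wm um cv e10.
  have nearg := gag_splitting s0 mw mu_ wg ug cv e10.
  have nearp := pot_splitting s0 N0 mG B0 gam0 gl lc Gbound Bp0 Gincr Gcont
    mw mu_ wm um wg ug cv e10.
  have [n [[n1 nm] [ng np]]] := filter_ex (filterI (filterI near1 nearm)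
    (filterI nearg nearp)).
  have := wJ n; move: n1 nm ng np; rewrite -/(v n).
  rewrite (_ : (\int[mu]_x (w n x ^+ 2)%:E)%E = (c ^+ 2)%:E); last first.
    by have [_ <- _] := ws n.
  rewrite (_ : (\int[mu]_x ((w n x - u x) ^+ 2)%:E)%E = mass (v n))// -/t.
  rewrite -/(mass u) -/t /= -/A -/P.
  set mn := fine (mass (v n)); set A1 := fine (gag s (w n)).
  set A2 := fine (gag s (v n)) => n1 nm.
  have mnE : mass (v n) = mn%:E by rewrite (adm_mass (av n)).
  have mn0 : 0 <= mn by exact/fine_ge0/mass_ge0.
  have /andP[nm1 nm2] : - e1 <= c ^+ 2 - mn - t <= e1 by rewrite -ler_norml.
  have mnc : 0 <= mn <= c ^+ 2 by rewrite mn0/=; lra.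
  have := scaling_lower (av n) mnE mnc IJ.
  rewrite /Jr -/A -/P -/A1 -/A2.
  set P1 := fine (pot G (w n)); set P2 := fine (pot G (v n)) => Jv.
  rewrite !ler_norml => /andP[g1 g2] /andP[p1 p2] Jw.
  have Jv' : (c ^+ 2 - t + e1) * k <= C / 2 * A2 - P2.
    apply: le_trans Jv; rewrite mulrAC -mulrA -kE.
    by rewrite ler_nM2r//; lra.
  have e2 : c ^+ 2 * k = Iv by rewrite kE mulrC divfK// gt_eqF.
  have Cg : C / 2 * (A - (A1 - A2)) <= C / 2 * e1.
    by rewrite ler_pM2l ?divr_gt0//; lra.
  have -> : t / c ^+ 2 * Iv = t * k by rewrite kE mulrAC -mulrA.
  have : C / 2 * e1 + 2 * e1 - e1 * k <= e.
    by rewrite (_ : _ - _ = e1 * b)// /b; ring.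
  move: Jv'; rewrite (_ : _ * k = Iv - t * k + e1 * k); last by rewrite -e2; ring.
  move: Cg; rewrite !mulrBr; move: (C / 2 * e1) (C / 2 * A) (C / 2 * A1)
    (C / 2 * A2) (e1 * k) (t * k) (d / _) n1 Jw => *; lra.
have Jut : Jr u <= t / c ^+ 2 * Iv by apply/ler_addgt0Pr.
have t0c : 0 < t <= c ^+ 2 by rewrite t0.
have := scaling_bound au tE t0c IJ; rewrite -/P => sb.
have st0 : 0 < Num.sqrt t by rewrite sqrtr_gt0.
have tcE : t = c ^+ 2.
  apply/eqP; rewrite eq_le tc leNgt /=; apply/negP => tltc.
  have : 1 < (c / Num.sqrt t) `^ sig.
    suff: 1 `^ sig < (c / Num.sqrt t) `^ sig by rewrite powR1.
    rewrite gt0_ltr_powR// ?nnegrE ?ler01 ?divr_ge0 ?(ltW c0) ?(ltW st0)//.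
    rewrite ltr_pdivlMr// mul1r -ltr_sqr ?nnegrE ?(ltW c0) ?(ltW st0)//.
    by rewrite sqr_sqrtr// ltW.
  rewrite -subr_gt0 => p1; have := mulr_gt0 p1 P0; lra.
exists u; first by split => //; [rewrite tE tcE|case: au].
move=> v' sv'; apply: le_trans (IJ _ sv').
by move: Jut; rewrite tcE divff ?mul1r// gt_eqF.
Qed.

End minimization.

(** * Reduction to a Borel potential *)

Section superposition.
Context {R : realType}.

Lemma dyadic_floor_cvg (t : R) :
  (Num.floor (t * 2 ^+ k))%:~R / 2 ^+ k @[k --> \oo] --> t.
Proof.
have p0 (k : nat) : 0 < 2 ^+ k :> R by rewrite exprn_gt0.
apply/cvgrPdist_le => /= e e0.
have [n ne] := pow2_unbounded e^-1.
exists n => // k /= nk.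
have /andP[f1 f2] := floor_itv (t * 2 ^+ k).
rewrite (_ : t - _ = (t * 2 ^+ k - (Num.floor (t * 2 ^+ k))%:~R) / 2 ^+ k); last first.
  by rewrite mulrBl mulfK// gt_eqF.
rewrite normrM ger0_norm ?subr_ge0// gtr0_norm ?invr_gt0// ler_pdivrMr//.
apply: (@le_trans _ _ 1); first by rewrite intrD in f2; lra.
rewrite -ler_pdivrMl// mulr1; apply: le_trans ne _.
by rewrite ler_weXn2l// ler1n.
Qed.

(** Rounding [u] down to multiples of $2^{-k}$ gives functions with countably many values, on whose
    level sets only the dyadic sections of [G] occur; continuity in the second variable passes to
    the limit. *)
Lemma measurable_superposition d (T : measurableType d) (G : T -> R -> R) u :
  (forall (z : int) (k : nat), 
     measurable_fun setT (fun x => G x (z%:~R / 2 ^+ k))) ->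
  (forall x, continuous (G x)) ->
  measurable_fun setT u -> measurable_fun setT (fun x => G x (u x)).
Proof.
move=> mG cG mu_.
pose uk k x : R := (Num.floor (u x * 2 ^+ k))%:~R / 2 ^+ k.
apply: (@measurable_fun_cvg _ _ _ _ (fun k x => G x (uk k x))); last first.
  move=> x _; apply: (@cvg_comp _ _ _ (uk ^~ x) (G x) \oo (nbhs (u x))).
    exact: dyadic_floor_cvg.
  exact: cG.
move=> k _ Y mY; rewrite setTI.
pose V (z : int) := u @^-1` `[z%:~R / 2 ^+ k, (z + 1)%:~R / 2 ^+ k[%classic.
have p0 : 0 < 2 ^+ k :> R by rewrite exprn_gt0.
rewrite (_ : _ @^-1` Y = \bigcup_(z in [set: int])
    (V z `&` (fun x => G x (z%:~R / 2 ^+ k)) @^-1` Y)).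
  apply: countable_bigcupT_measurable => // z; apply: measurableI.
    by rewrite -[X in measurable X]setTI; exact: mu_.
  by rewrite -[X in measurable X]setTI; exact: mG.
have VE z x : V z x <-> Num.floor (u x * 2 ^+ k) = z.
  rewrite /V/= in_itv/= ler_pdivrMr// ltr_pdivlMr//; split => [h|<-].
    exact: floor_def.
  exact: floor_itv.
apply/seteqP; split => [x Yx|x [z _ [/VE zx Yx]]]/=.
  by exists (Num.floor (u x * 2 ^+ k)) => //; split => //; exact/VE.
by rewrite /uk zx.
Qed.

(** The exceptional null set in the definition of measurability depends on [t]. Over the countable
    set of dyadic [t] the union is still null, and for functions continuous in [t] these values
    suffice. *)
Lemma ae_eq_dyadic N (F : Rn R N -> R -> R) :
  (forall t, lebesgue_measurable_fun (F ^~ t)) ->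
  exists (A : set (Rn R N)) (g : int * nat -> Rn R N -> R),
  [/\ measurable A, lebesgue_Rn N A = 0%E, forall q, measurable_fun setT (g q)
    & forall x, ~ A x -> forall q, F x (q.1%:~R / 2 ^+ q.2) = g q x].
Proof.
move=> mF.
have /choice[g gP] (q : int * nat) : exists g : Rn R N -> R,
    measurable_fun setT g /\
    \forall x \ae lebesgue_Rn N, F x (q.1%:~R / 2 ^+ q.2) = g x.
  by have [g mg ge] := mF (q.1%:~R / 2 ^+ q.2); exists g.
have : \forall x \ae lebesgue_Rn N, forall n, forall q : int * nat,
    unpickle n = Some q -> F x (q.1%:~R / 2 ^+ q.2) = g q x.
  apply: ae_foralln => n; case: (unpickle n) => [q|]; last exact: aeW.
  by apply: filterS (gP q).2 => x xq _ [<-].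
move=> [A [mA A0 sub]]; exists A, g; split => //; first by move=> q; exact: (gP q).1.
move=> x nAx q; have := contra_not (sub x) nAx.
by move=> /contrapT /(_ (pickle q)); apply; rewrite pickleK.
Qed.

Lemma MVT_increment (f : R -> R) (a b : R) : (forall t, derivable f t 1) ->
  exists2 c, `|c| <= `|a| + `|b| & f (a + b) - f a = derive1 f c * b.
Proof.
move=> df.
have cf (p q : R) : {within `[p, q], continuous f}.
  apply: derivable_within_continuous => t _; exact: df.
have isd (t : R) : is_derive t 1 f (derive1 f t).
  by rewrite derive1E; exact: DeriveDef.
have [b0|b0] := leP 0 b.
  have ab : a <= a + b by rewrite lerDl.
  have [c cab ->] := MVT_segment ab (fun t _ => isd t) (cf _ _).
  exists c; last by rewrite addrAC subrr add0r.
  move: cab; rewrite in_itv/= => /andP[c1 c2].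
  have := ler_norm a; have := ler_norm (- a); have := ler_norm b.
  by rewrite normrN ler_norml => *; apply/andP; split; lra.
have ab : a + b <= a by rewrite gerDl ltW.
have [c cab fc] := MVT_segment ab (fun t _ => isd t) (cf _ _).
exists c; last by rewrite -opprB fc; ring.
move: cab; rewrite in_itv/= => /andP[c1 c2].
have := ler_norm a; have := ler_norm (- a); have := ler_norm (- b).
by rewrite !normrN ler_norml => *; apply/andP; split; lra.
Qed.

End superposition.

Section reduction.
Context {R : realType}.
Variables (N : nat) (s : R) (F : Rn R N -> R -> R).
Hypotheses (s0 : 0 < s) (N0 : (0 < N)%N).
Local Notation mu := (@lebesgue_Rn R N).
Hypothesis dF : forall x t, derivable (F x) t 1.
Hypothesis perF : Zperiodic F.

(** The translation moves every coordinate into the interval from [K] to [K + 1], where [K >= r]. *)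
Lemma integer_translate_annulus (r : R) : 0 < r ->
  exists2 Q : R, 0 < Q & forall x : Rn R N, exists z : 'I_N -> int,
    r <= enorm (translate x z) <= Q.
Proof.
move=> r0; have [K rK] := exists_nat_ge r.
have K0 : 0 < K%:R :> R by exact: lt_le_trans rK.
have K1 : 0 < (K.+1)%:R :> R by rewrite ltr0n.
exists (Num.sqrt (\sum_(i < N) (K.+1)%:R ^+ 2)).
  rewrite sqrtr_gt0 sumr_const card_ord.
  by rewrite mulrn_wgt0 ?exprn_gt0.
move=> x; pose z (i : 'I_N) : int := K%:Z - Num.floor (tnth x i).
exists z; have zi i : K%:R <= tnth (translate x z) i <= K.+1%:R.
  rewrite tnth_mktuple /z intrB -pmulrn.
  have /andP[] := floor_itv (tnth x i); rewrite intrD -natr1 => ? ?.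
  by apply/andP; split; lra.
have zi0 i : 0 <= tnth (translate x z) i.
  by have /andP[+ _] := zi i; apply: le_trans; rewrite ltW.
apply/andP; split; last first.
  rewrite /enorm ler_wsqrtr//; apply: ler_sum => i _.
  by rewrite ler_sqr ?nnegrE ?(ltW K1)//; have /andP[] := zi i.
apply: (le_trans rK); rewrite /enorm.
have K2 : K%:R = Num.sqrt (K%:R ^+ 2) :> R by rewrite sqrtr_sqr ger0_norm ?(ltW K0).
rewrite K2 ler_wsqrtr// (bigD1 (Ordinal N0))//=.
apply: (@le_trans _ _ (tnth (translate x z) (Ordinal N0) ^+ 2)).
  by rewrite ler_sqr ?nnegrE ?(ltW K0)//; have /andP[] := zi (Ordinal N0).
by rewrite lerDl sumr_ge0// => i _; exact: sqr_ge0.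
Qed.

(* Periodicity extends the bound of (F1) from the exterior of a ball to all of
   R^N, with a constant that no longer decays. *)
Lemma F1_lower : condF1 s F -> exists al dl S0 : R,
  [/\ 0 < al, N%:R / 2 * al < N%:R + 2 * s, 0 < dl, 0 < S0 &
    forall x t, 0 < `|t| -> `|t| < S0 -> dl * `|t| `^ al <= F x t].
Proof.
move=> [Delta [S0 [r [al [p [[D0 S00 r0 al0] /andP[p0 p2] alp HF]]]]]].
have [Q Q0 QP] := integer_translate_annulus r0.
exists al, (Delta * Q `^ (- p)), S0; split => //.
- by apply: le_lt_trans alp; rewrite lerDl.
- by rewrite mulr_gt0// powR_gt0.
move=> x t t0 tS; have [z /andP[rz zQ]] := QP x.
rewrite -(perF x t z); apply/ltW; apply: le_lt_trans (HF _ _ rz t0 tS).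
rewrite ler_wpM2r ?powR_ge0// ler_pM2l//; apply: le_powR_neg => //.
  exact: lt_le_trans rz.
by rewrite oppr_le0.
Qed.

(** The lower bound gives positivity for small arguments only. For larger [t], (F5) carries it over
    from [t / th], of modulus [S0 / 2]. *)
Lemma F5_pos (sig al dl S0 : R) : 0 < dl -> 0 < S0 ->
  (forall x t, 0 < `|t| -> `|t| < S0 -> dl * `|t| `^ al <= F x t) ->
  (forall (theta : R) x t, 1 <= theta ->
     theta `^ (sig + 2) * F x t <= F x (theta * t)) ->
  forall x t, t != 0 -> 0 < F x t.
Proof.
move=> dl0 S00 Flow Fsup x t t0; have nt0 : 0 < `|t| by rewrite normr_gt0.
have small t' : 0 < `|t'| -> `|t'| < S0 -> 0 < F x t'.
  move=> h1 h2; apply: lt_le_trans (Flow x t' h1 h2).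
  by rewrite mulr_gt0// powR_gt0.
have [tS|St] := ltP `|t| S0; first exact: small.
pose th := 2 * `|t| / S0.
have th1 : 1 <= th by rewrite ler_pdivlMr// mul1r; lra.
have th0 : 0 < th by apply: lt_le_trans th1.
have -> : t = th * (t / th) by rewrite mulrC divfK// gt_eqF.
apply: lt_le_trans (Fsup _ _ _ th1); rewrite mulr_gt0 ?powR_gt0//.
have tE : `|t / th| = S0 / 2.
  rewrite normrM normfV (gtr0_norm th0) /th; field.
  by rewrite !gt_eqF.
by apply: small; rewrite tE; lra.
Qed.

(** The value 0 on [A] preserves continuity in [t], the bounds of (F4) and the inequality of (F5) at
    every point. Pointwise periodicity may be lost, as [A] need not be invariant. *)
Definition off (A : set (Rn R N)) x t : R := if x \in A then 0 else F x t.

Lemma off_continuous A x : continuous (off A x).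
Proof.
rewrite /off; case: (x \in A) => t; first exact: cvg_cst.
by apply/differentiable_continuous/derivable1_diffP; exact: dF.
Qed.

Lemma off_measurable : (forall t, lebesgue_measurable_fun (F ^~ t)) ->
  exists A, [/\ measurable A, mu A = 0%E & forall u : Rn R N -> R,
    measurable_fun setT u -> measurable_fun setT (fun x => off A x (u x))].
Proof.
move=> mF; have [A [g [mA A0 mg gF]]] := ae_eq_dyadic mF.
exists A; split => // u mu_; apply: measurable_superposition => //.
  move=> z k; rewrite (_ : (fun _ => _) = fun x => g (z, k) x * \1_(~` A) x).
    apply: measurable_funM => //; apply: measurable_indic.
    exact: measurableC.
  apply/funext => x; rewrite /off indicE; have [xA|xA] := boolP (x \in A).
    by rewrite memNset ?mulr0//= => /(_ (set_mem xA)).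
  have nA : ~ A x by move=> Ax; rewrite mem_set in xA.
  by rewrite mem_set// mulr1 (gF x nA (z, k)).
exact: off_continuous.
Qed.

Hypothesis F_ge0 : forall x t, 0 <= F x t.

Lemma off_ge0 A x t : 0 <= off A x t.
Proof. by rewrite /off; case: ifPn. Qed.

Lemma pot_off A u : measurable A -> mu A = 0%E -> pot F u = pot (off A) u.
Proof.
move=> mA A0; apply: (integral_eq_off_null mA A0) => x.
- by rewrite lee_fin.
- by rewrite lee_fin off_ge0.
- by move=> Ax; rewrite /off memNset.
Qed.

Lemma translate_null (A : set (Rn R N)) (z : 'I_N -> int) : measurable A ->
  mu A = 0%E -> let A' := (fun x => translate x z) @^-1` A in
  measurable A' /\ mu A' = 0%E.
Proof.
move=> mA A0 A'.
have mA' : measurable A'.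
  by rewrite -[X in measurable X]setTI; exact: measurable_translate.
have ind B : measurable B -> mu B = (\int[mu]_x (\1_B x)%:E)%E.
  by move=> mB; rewrite integral_indic// setIT.
split => //; rewrite (ind _ mA') -[RHS]A0 (ind _ mA).
rewrite -[RHS](ge0_integral_translate z)//.
by apply/measurable_EFinP; exact: measurable_indic.
Qed.

(** The integrands agree off [A] and its preimage under the translation, and both are null. *)
Lemma pot_off_translate A (z : 'I_N -> int) u : measurable A -> mu A = 0%E ->
  measurable_fun setT (fun x => off A x (u x)) ->
  pot (off A) (fun x => u (translate x z)) = pot (off A) u.
Proof.
move=> mA A0 mG; have [mA' A'0] := translate_null z mA A0.
rewrite -[RHS](ge0_integral_translate z); last 2 first.
  exact/measurable_EFinP.
  by move=> x; rewrite lee_fin off_ge0.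
pose A' := (fun x : Rn R N => translate x z) @^-1` A.
apply: (@integral_eq_off_null _ _ _ mu (A `|` A')).
- exact: measurableU.
- apply/eqP; rewrite eq_le measure_ge0 andbT.
  apply: le_trans (measureU2 _ mA mA') _.
  by rewrite [X in (X + _)%E]A0 [X in (_ + X)%E]A'0 adde0.
- by move=> x; rewrite lee_fin off_ge0.
- by move=> x; rewrite lee_fin off_ge0.
- move=> x /not_orP[Ax A'x]; rewrite /off memNset// memNset//.
  by rewrite perF.
Qed.

End reduction.

(** * Return to the extended-real energy *)

Section energy_on_sphere.
Context {R : realType}.
Variables (N : nat) (s C c : R).
Hypotheses (s0 : 0 < s) (C0 : 0 < C).
Implicit Types (u v : Rn R N -> R) (F : Rn R N -> R -> R).

Lemma sphereP u : sphere s c u <-> on_sphere s c u.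
Proof.
have Ns : 0 < N%:R + 2 * s by rewrite ltr_wpDl// mulr_gt0.
rewrite /sphere/=; split => [[/(HsP _ Ns)[mu_ um ug] uc]|[mu_ um ug]] => //.
by split => //; apply/(HsP _ Ns); split => //; rewrite um ltry.
Qed.

Lemma energyE F u : (gag s u < +oo)%E -> (0 <= pot F u < +oo)%E ->
  energy C s F u = (Jr s C F u)%:E.
Proof.
move=> ug /andP[P0 Poo].
have gE : gag s u = (fine (gag s u))%:E by rewrite fineK// ge0_fin_numE// gag_ge0.
have pE : pot F u = (fine (pot F u))%:E by rewrite fineK// ge0_fin_numE.
rewrite /energy /grad_s_norm2.
rewrite (_ : (\int[_]_z _)%E = gag s u)// (_ : (\int[_]_x _)%E = pot F u)//.
by rewrite gE pE -!EFinM -EFinB /Jr mulrA (mulrC 2^-1).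
Qed.

End energy_on_sphere.

Theorem theorem1p2 (R : realType) (N : nat) (s C : R) (F : Rn R N -> R -> R)
    (c : R) :
  (1 <= N)%N -> 0 < s < 1 -> 2 * s <= N%:R -> 0 < C ->
  caratheodory_fun F ->
  (forall x t, derivable (F x) t 1) ->
  Zperiodic F ->
  condF1 s F -> condF4 s F -> condF5 s F ->
  0 < c ->
  exists2 u : Rn R N -> R, sphere s c u & energy C s F u = energy_inf C s F c.
Proof.
move=> N0 /andP[s0 s1] _ C0 [mF _] dF perF F1.
move=> [B [B' [gam [l [[B0 B'0] gam0 gl lc F4]]]]] [sig /andP[sig0 _] F5] c0.
have F_ge0 x t : 0 <= F x t by have [/andP[]] := F4 x t.
have [al [dl [S0 [al0 alN dl0 S00 Flow]]]] := F1_lower N0 perF F1.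
have Fpos := F5_pos dl0 S00 Flow F5.
have [A [mA A0 mG]] := off_measurable dF mF.
(* The minimization is carried out for [G]; its potential equals that of [F] for every [u], since
   [A] is null. *)
set G := off F A in mG.
have mu0 : \forall x \ae lebesgue_Rn N, ~ A x.
  by exists A; split => // x /= /contrapT.
have Goff x : ~ A x -> G x = F x.
  by move=> Ax; apply/funext => t; rewrite /G /off memNset.
have Gbound x t : 0 <= G x t <= B * (`|t| ^+ 2 * `|t| `^ gam + `|t| ^+ 2 * `|t| `^ l).
  rewrite -!powR_add2 ?(lt_trans gam0 gl)//.
  rewrite /G /off; case: ifPn => _; last by have [] := F4 x t.
  by rewrite lexx/= mulr_ge0 ?(ltW B0)// addr_ge0 ?powR_ge0.
have Gincr x (a b : R) : `|G x (a + b) - G x a| <=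
    B' * `|b| * ((`|a| + `|b|) `^ (gam + 1) + (`|a| + `|b|) `^ (l + 1)).
  have [Ax|Ax] := pselect (A x).
    rewrite /G /off mem_set// subrr normr0.
    by rewrite mulr_ge0 ?mulr_ge0 ?addr_ge0 ?powR_ge0 ?(ltW B'0).
  (* The mean value theorem gives a point [e] with $|e| \le |a| + |b|$, at which the increasing
     derivative bound of (F4) is evaluated. *)
  rewrite Goff//; have [e eab ->] := MVT_increment a b (dF x).
  rewrite normrM mulrAC ler_wpM2r//; apply: le_trans (F4 x e).2 _.
  have l0 := lt_trans gam0 gl.
  have mono (r : R) : 0 < r -> `|e| `^ (r + 1) <= (`|a| + `|b|) `^ (r + 1).
    by move=> r0; rewrite ge0_ler_powR// ?nnegrE ?addr_ge0// ltW.
  by rewrite ler_pM2l// lerD// mono.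
have Gsuper (theta : R) x t : 1 <= theta ->
    theta `^ (sig + 2) * G x t <= G x (theta * t).
  move=> th1; rewrite /G /off; case: ifPn => _; first by rewrite mulr0.
  exact: F5.
have Gpos : \forall x \ae lebesgue_Rn N, forall t, t != 0 -> 0 < G x t.
  by apply: filterS mu0 => x Ax t t0; rewrite Goff//; exact: Fpos.
have Glow : \forall x \ae lebesgue_Rn N, forall t, 0 < `|t| -> `|t| < S0 ->
    dl * `|t| `^ al <= G x t.
  by apply: filterS mu0 => x Ax t t0 tS; rewrite Goff//; exact: Flow.
have Gper z u : measurable_fun setT u -> pot G (fun x => u (translate x z)) = pot G u.
  by move=> mu_; apply: pot_off_translate => //; exact: mG.
have [u0 [mu_ um ug Pu]] := negative_energy s0 s1 N0 mG
  (fun x t => proj1 (andP (Gbound x t))) C0 c0 al0 alN dl0 S00 Glow.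
have neg : exists2 u, on_sphere s c u & ((C / 2)%:E * gag s u < pot G u)%E.
  by exists u0.
have [u su uJ] := minimizer s0 N0 C0 c0 mG B0 gam0 gl lc Gbound B'0 Gincr
  (fun x => @off_continuous R N F dF A x) sig0 Gsuper Gpos Gper neg.
have JE v : on_sphere s c v -> energy C s F v = (Jr s C G v)%:E.
  move=> sv; have [mv vm vg] := sv.
  have pE : pot F v = pot G v by exact: pot_off.
  rewrite energyE// /Jr pE// (pot_ge0 Gbound).
  by rewrite (pot_lty s0 N0 mG B0 gam0 gl lc Gbound)// vm ltry.
exists u; first exact/(sphereP c s0).
apply/eqP; rewrite eq_le; apply/andP; split.
  apply: le_ereal_inf_tmp => _ [v /(sphereP c s0) sv <-].
  by rewrite !JE// lee_fin uJ.
by apply: ereal_inf_lbound; exists u => //; exact/(sphereP c s0).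
Qed.
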